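(* The following three statements hold for the logic $\mathsf{FOC}$ and arbitrary (not necessarily injective) $\omega$-automatic presentations. (i) There is an effective procedure that, given an $\omega$-automatic presentation $\mathfrak{d}, f$ of a structure $\mathfrak{A}$ and an $\mathsf{FOC}$-formula $\varphi(\vec a,\vec x)$ with parameters $\vec a$ from $\mathfrak{A}$ and $k$ free variables $\vec x$, defining the $k$-ary relation $R=\{\vec b\in A^k : \mathfrak{A}\models\varphi(\vec a,\vec b)\}$, constructs a $k$-tape synchronous $\omega$-automaton recognising $f^{-1}(R)=\{(w_1,\dots,w_k)\in L(\mathcal{A})^k : (f(w_1),\dots,f(w_k))\in R\}$. (ii) The $\mathsf{FOC}$-theory of every $\omega$-automatic structure is decidable. (iii) The class of $\omega$-automatic structures is closed under $\mathsf{FOC}$-interpretations.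
   Context: Let $\Sigma$ be a finite alphabet. For $\omega$-words $w_1,\dots,w_m\in\Sigma^\omega$ their convolution $\otimes\vec w\in(\Sigma^m)^\omega$ is defined by $\otimes\vec w[i]=(w_1[i],\dots,w_m[i])$. An $m$-ary relation on $\Sigma^\omega$ is $\omega$-regular if the set of convolutions of its tuples is accepted by a finite (nondeterministic Büchi, equivalently parity or Muller) automaton over $\Sigma^m$; such an automaton is called a synchronous $m$-tape $\omega$-automaton. An $\omega$-automatic presentation of a relational structure $\mathfrak{A}=(A,\{R_i\}_i)$ consists of $\omega$-automata $\mathfrak{d}=(\mathcal{A},\mathcal{A}_\approx,\{\mathcal{A}_i\}_i)$ and a surjective naming function $f:L(\mathcal{A})\to A$ such that: $\mathcal{A}_\approx$ recognises the relation $\approx\;=\{(u,w)\in L(\mathcal{A})^2: f(u)=f(w)\}$; each $L(\mathcal{A}_i)$ has the arity of $R_i$; and $f$ induces an isomorphism from $(L(\mathcal{A}),\{L(\mathcal{A}_i)\}_i)/\!\approx$ onto $\mathfrak{A}$ (so $\approx$ is a congruence). The presentation is injective if $f$ is injective. A structure is $\omega$-automatic if it has an $\omega$-automatic presentation. $\mathsf{FOC}$ is first-order logic extended by the quantifiers: $\exists^{(r\,\mathrm{mod}\,m)}x\,\varphi$ (''the number of $x$ satisfying $\varphi$ is finite and congruent to $r$ modulo $m$''), $\exists^\infty x\,\varphi$ (''infinitely many $x$ satisfy $\varphi$''), $\exists^{\le\aleph_0}x\,\varphi$ and $\exists^{>\aleph_0}x\,\varphi$ (''the set of $x$ satisfying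 $\varphi$ is countable (finite or countably infinite), resp. uncountable''). An $\mathsf{FOC}$-interpretation is an interpretation (defining the domain, the equality and the relations of a new structure inside tuples of the old one) all of whose defining formulas are $\mathsf{FOC}$-formulas.
   Formalization: In (i) each parameter is required to have an ultimately periodic name in L(A), given to the procedure as such; for other parameters the claim fails (e.g. x = a in an injective presentation). Signatures are finite. *)

(* Defs.v *)
From mathcomp Require Export all_boot.
From mathcomp Require Export boolp classical_sets functions cardinality.

Set Implicit Arguments.
Unset Strict Implicit.
Unset Printing Implicit Defensive.

Local Open Scope nat_scope.
Local Open Scope classical_set_scope.

(* Kleene's mu-recursive functions.  Argument tuples are lists; a program is
   undefined on argument lists that are too short. *)
Inductive recfun : Type :=
| RZero
| RSucc
| RProj (i : nat)
| RComp (g : recfun) (hs : seq recfun)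
| RPrec (g h : recfun)
| RMin (g : recfun).

(* [computes p v y]: program [p] halts on input [v] with output [y]. *)
Inductive computes : recfun -> seq nat -> nat -> Prop :=
| ev_zero v : computes RZero v 0
| ev_succ x v : computes RSucc (x :: v) x.+1
| ev_proj i v : i < size v -> computes (RProj i) v (nth 0 v i)
| ev_comp g hs v ys z :
    computes_all hs v ys -> computes g ys z -> computes (RComp g hs) v z
| ev_prec0 g h v y : computes g v y -> computes (RPrec g h) (0 :: v) y
| ev_precS g h n v y z :
    computes (RPrec g h) (n :: v) y -> computes h [:: n, y & v] z ->
    computes (RPrec g h) (n.+1 :: v) z
| ev_min g v n (ys : nat -> nat) :
    (forall m, m < n -> computes g (m :: v) (ys m).+1) ->
    computes g (n :: v) 0 -> computes (RMin g) v n
with computes_all : seq recfun -> seq nat -> seq nat -> Prop :=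
| evs_nil v : computes_all [::] v [::]
| evs_cons h hs v y ys :
    computes h v y -> computes_all hs v ys ->
    computes_all (h :: hs) v (y :: ys).

Definition word (L : Type) := nat -> L.

(* Nondeterministic Büchi automata over the alphabet [L]; the finite sets of
   initial states, transitions and accepting states are given as lists. *)
Record nba (L : Type) := Nba {
  nba_size : nat;
  nba_init : seq 'I_nba_size;
  nba_trans : seq ('I_nba_size * L * 'I_nba_size);
  nba_acc : seq 'I_nba_size
}.

Definition accepts (L : eqType) (B : nba L) (w : word L) : Prop :=
  exists r : nat -> 'I_(nba_size B),
    [/\ r 0 \in nba_init B,
        forall i, (r i, w i, r i.+1) \in nba_trans B
      & forall i, exists2 j, i <= j & r j \in nba_acc B].

Definition lang (L : eqType) (B : nba L) : Type := {w : word L | accepts B w}.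

Definition convolution (s m : nat) (ws : 'I_m -> word 'I_s) :
    word (m.-tuple 'I_s) :=
  fun i => [tuple ws j i | j < m].

(* Every omega-word over the product alphabet is a convolution, so this says
   that the language of [B] is exactly the set of convolutions of [R]. *)
Definition recognises (s m : nat) (B : nba (m.-tuple 'I_s))
    (R : ('I_m -> word 'I_s) -> Prop) : Prop :=
  forall ws, accepts B (convolution ws) <-> R ws.

(* A finite relational signature is the list of its arities. *)
Definition signature := seq nat.
Definition arity (sg : signature) (i : 'I_(size sg)) : nat := nth 0 sg i.
Arguments arity : clear implicits.

Record structure (sg : signature) := Structure {
  carrier :> Type;
  interp : forall i : 'I_(size sg), ('I_(arity sg i) -> carrier) -> Prop
}.

Record presentation (sg : signature) := Presentation {
  alph : nat;
  dom_aut : nba 'I_alph;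
  eq_aut : nba (2.-tuple 'I_alph);
  rel_aut : forall i : 'I_(size sg), nba ((arity sg i).-tuple 'I_alph)
}.

(* The relation f^{-1}(R) on words; all its components lie in L(B). *)
Definition preimage_rel (s : nat) (B : nba 'I_s) (T : Type) (f : lang B -> T)
    (k : nat) (R : ('I_k -> T) -> Prop) (ws : 'I_k -> word 'I_s) : Prop :=
  exists us : 'I_k -> lang B,
    (forall i, sval (us i) = ws i) /\ R (fun i => f (us i)).

(* The last clause says that the automata recognise relations on the domain
   language that are invariant under having the same f-value and correspond
   under f to the relations of [A]: f induces an isomorphism of the quotient
   onto [A]. *)
Definition is_presentation (sg : signature) (A : structure sg)
    (d : presentation sg) (f : lang (dom_aut d) -> A) : Prop :=
  [/\ forall a, exists u, f u = a,
      recognises (eq_aut d)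
        (preimage_rel f (fun a : 'I_2 -> A => a ord0 = a ord_max))
    & forall i, recognises (rel_aut d i) (preimage_rel f (@interp sg A i))].

Definition omega_automatic (sg : signature) (A : structure sg) : Prop :=
  exists (d : presentation sg) (f : lang (dom_aut d) -> A), is_presentation f.

(* [formula sg n]: formulas with free variables among n de Bruijn indices;
   a quantifier binds index 0 of its body. *)
Inductive formula (sg : signature) : nat -> Type :=
| FEq n (x y : 'I_n) : formula sg n
| FRel n (i : 'I_(size sg)) (xs : (arity sg i).-tuple 'I_n) : formula sg n
| FNot n (phi : formula sg n) : formula sg n
| FAnd n (phi psi : formula sg n) : formula sg n
| FEx n (phi : formula sg n.+1) : formula sg n
| FMod n (r m : nat) (m_gt0 : 0 < m) (phi : formula sg n.+1) : formula sg n
| FInf n (phi : formula sg n.+1) : formula sg n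
| FCountable n (phi : formula sg n.+1) : formula sg n
| FUncountable n (phi : formula sg n.+1) : formula sg n.

Definition env_cons (T : Type) n (a : T) (e : 'I_n -> T) : 'I_n.+1 -> T :=
  fun i => if unlift ord0 i is Some j then e j else a.

Definition env_cat (T : Type) m n (e1 : 'I_m -> T) (e2 : 'I_n -> T) :
    'I_(m + n) -> T :=
  fun i => match fintype.split i with inl j => e1 j | inr j => e2 j end.

Definition env0 (T : Type) : 'I_0 -> T :=
  fun i => False_rect T (notF (ltn_ord i)).

Fixpoint sat (sg : signature) (A : structure sg) n (phi : formula sg n) :
    ('I_n -> A) -> Prop :=
  match phi in formula _ n return ('I_n -> A) -> Prop with
  | FEq _ x y => fun e => e x = e y
  | FRel _ i xs => fun e => interp (fun j => e (tnth xs j))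
  | FNot _ phi => fun e => ~ sat phi e
  | FAnd _ phi psi => fun e => sat phi e /\ sat psi e
  | FEx _ phi => fun e => exists a : A, sat phi (env_cons a e)
  | FMod _ r m _ phi => fun e =>
      exists c : nat,
        ([set a : A | sat phi (env_cons a e)] #= `I_c)%card /\ c = r %[mod m]
  | FInf _ phi => fun e => infinite_set [set a : A | sat phi (env_cons a e)]
  | FCountable _ phi => fun e => countable [set a : A | sat phi (env_cons a e)]
  | FUncountable _ phi => fun e =>
      ~ countable [set a : A | sat phi (env_cons a e)]
  end.

(* The ultimately periodic word u (x v)^omega. *)
Record upname (s : nat) := Upname {
  up_pre : seq 'I_s;
  up_head : 'I_s;
  up_tail : seq 'I_s
}.

Definition up_word (s : nat) (q : upname s) : word 'I_s :=
  fun i =>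
    if i < size (up_pre q) then nth (up_head q) (up_pre q) i
    else nth (up_head q) (up_head q :: up_tail q)
           ((i - size (up_pre q)) %% (size (up_tail q)).+1).

Notation code := CodeSeq.code.

Definition code_ords (s : nat) (l : seq 'I_s) : nat :=
  code [seq val x | x <- l].

Definition code_nba (L : Type) (cl : L -> nat) (B : nba L) : nat :=
  code [:: nba_size B; code_ords (nba_init B);
           code [seq code [:: val t.1.1; cl t.1.2; val t.2] | t <- nba_trans B];
           code_ords (nba_acc B)].

Definition code_letter (s m : nat) (t : m.-tuple 'I_s) : nat := code_ords t.

Definition code_presentation (sg : signature) (d : presentation sg) : nat :=
  code [:: code sg; alph d;
           code_nba val (dom_aut d);
           code_nba (@code_letter _ _) (eq_aut d);
           code [seq code_nba (@code_letter _ _) (rel_aut d i)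
                | i <- enum 'I_(size sg)]].

Definition code_upname (s : nat) (q : upname s) : nat :=
  code [:: code_ords (up_pre q); code_ords (up_head q :: up_tail q)].

Definition code_params (s p : nat) (qs : 'I_p -> upname s) : nat :=
  code [seq code_upname (qs j) | j <- enum 'I_p].

Fixpoint code_formula (sg : signature) n (phi : formula sg n) : nat :=
  match phi with
  | FEq _ x y => code [:: 0; val x; val y]
  | FRel _ i xs => code [:: 1; val i; code_ords xs]
  | FNot _ phi => code [:: 2; code_formula phi]
  | FAnd _ phi psi => code [:: 3; code_formula phi; code_formula psi]
  | FEx _ phi => code [:: 4; code_formula phi]
  | FMod _ r m _ phi => code [:: 5; r; m; code_formula phi]
  | FInf _ phi => code [:: 6; code_formula phi]
  | FCountable _ phi => code [:: 7; code_formula phi]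
  | FUncountable _ phi => code [:: 8; code_formula phi]
  end.

Definition FOC_theory_decidable (sg : signature) (A : structure sg) : Prop :=
  exists p : recfun, forall phi : formula sg 0,
    (sat phi (@env0 A) -> computes p [:: code_formula phi] 1) /\
    (~ sat phi (@env0 A) -> computes p [:: code_formula phi] 0).

(* In [int_rel i] the free variables form arity-many consecutive blocks of
   length [int_dim], one block for each argument. *)
Record FOC_interpretation (sg tau : signature) := FOCInterpretation {
  int_dim : nat;
  int_dom : formula sg int_dim;
  int_eq : formula sg (int_dim + int_dim);
  int_rel : forall i : 'I_(size tau), formula sg (arity tau i * int_dim)
}.

Lemma block_subproof r d (i : 'I_(r * d)) : i %/ d < r.
Proof.
case: d i => [|d] i; last by rewrite ltn_divLR // ltn_ord.
by case: i => i; rewrite muln0.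
Qed.

Lemma offset_subproof r d (i : 'I_(r * d)) : i %% d < d.
Proof.
by case: d i => [|d] i; [case: i => i; rewrite muln0 | rewrite ltn_pmod].
Qed.

Definition env_flatten (T : Type) r d (xs : 'I_r -> 'I_d -> T) :
    'I_(r * d) -> T :=
  fun i => xs (Ordinal (block_subproof i)) (Ordinal (offset_subproof i)).

(* [B] is isomorphic to the structure that [I] defines in [A]; the isomorphism
   is given as a coordinate map [h] from the tuples satisfying the domain
   formula onto [B]. *)
Definition interprets (sg tau : signature) (I : FOC_interpretation sg tau)
    (A : structure sg) (B : structure tau) : Prop :=
  exists h : {x : 'I_(int_dim I) -> A | sat (int_dom I) x} -> B,
    [/\ forall b, exists x, h x = b,
        forall x y, sat (int_eq I) (env_cat (sval x) (sval y)) <-> h x = h y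
      & forall (i : 'I_(size tau)) xs,
          sat (int_rel I i) (env_flatten (fun j => sval (xs j))) <->
          interp (fun j => h (xs j))].

(* Main.v *)
(** A relation on infinite words is handled through a finite congruence on finite
    blocks that saturates it.  Such relations are closed under complement,
    intersection, projection (take the sets of colours of all extensions of a
    block) and counting modulo [m] of finite sets (count the extensions of each
    colour modulo [m]); by Ramsey's theorem they are accepted by Büchi automata,
    and a nonempty one contains an ultimately periodic word of bounded size.
    Hence first-order formulas over automatic relations can be evaluated on
    ultimately periodic words, and an automaton for a formula is found by
    searching for the first one that provably agrees with it.

    The cardinality quantifiers reduce to first-order ones.  If a recognisable
    equivalence has countably many classes, then a number [C] of words, bounded
    by the size of the congruence, suffices for every class to contain a word
    eventually equal to one of them.  Otherwise choose [C + 1] words greedily; by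
    Ramsey and the pigeonhole principle two of them, [x] and [y], have equal
    diagonal colours along a common factorisation, and mixing their blocks along
    the branches of a binary tree gives continuum many classes.  Finite sets of
    classes are counted through lexicographically least representatives among
    the words that agree with one of the [C] words outside a finite set. *)

From HB Require Import structures.
Require Import Defs.
From mathcomp Require Import zify.

Set Implicit Arguments.
Unset Strict Implicit.
Unset Printing Implicit Defensive.

Local Open Scope nat_scope.

(** * Recursive functions on codes *)

(** A presentation need not be injective: an element is a whole class of words, and in general no
    regular choice of representatives is at hand. This shapes the treatment of cardinalities. What
    can be bounded uniformly is a list of words up to finite changes; a common finite support then
    leaves finitely many candidate names, among which a lexicographic minimum exists, whereas an
    infinite set of words may have none. The closure properties are proved classically and yield no
    algorithm. Effectiveness comes from the evaluator alone, which uses nothing of a congruence but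
    a bound on its size, and this bound is computed from the formula. The existence of an automaton
    only makes the search terminate; that a candidate is correct is a sentence which the evaluator
    decides. A single number [b] bounds letters and states alike, because runs of automata are
    themselves words quantified in the logic. It is taken above the codes of the data involved. *)

Definition vcomp (n : nat) (g : seq nat -> nat) : Prop :=
  exists p, forall v, size v = n -> computes p v (g v).

Lemma vcomp_ext n g g' :
  (forall v, size v = n -> g v = g' v) -> vcomp n g -> vcomp n g'.
Proof. by move=> e [p Hp]; exists p => v sv; rewrite -e //; apply: Hp. Qed.

Lemma vcomp_c1 n g h : vcomp 1 g -> vcomp n h -> vcomp n (fun v => g [:: h v]).
Proof.
move=> [p Hp] [q Hq]; exists (RComp p [:: q]) => v sv.
by apply: ev_comp; [apply: evs_cons; [apply: Hq | apply: evs_nil] | apply: Hp].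
Qed.

Lemma vcomp_c2 n g h1 h2 : vcomp 2 g -> vcomp n h1 -> vcomp n h2 ->
  vcomp n (fun v => g [:: h1 v; h2 v]).
Proof.
move=> [p Hp] [q1 Hq1] [q2 Hq2]; exists (RComp p [:: q1; q2]) => v sv.
apply: ev_comp; last exact: Hp.
apply: evs_cons; [exact: Hq1|].
apply: evs_cons; [exact: Hq2|exact: evs_nil].
Qed.

Lemma vcomp_nth n i : i < n -> vcomp n (fun v => nth 0 v i).
Proof. by move=> lin; exists (RProj i) => v sv; apply: ev_proj; rewrite sv. Qed.

Lemma vcomp_succ : vcomp 1 (fun v => (nth 0 v 0).+1).
Proof. by exists RSucc => -[//|x v] _; apply: ev_succ. Qed.

Lemma vcomp_const n c : vcomp n (fun _ => c).
Proof.
elim: c => [|c IH]; first by exists RZero => v _; apply: ev_zero.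
exact: (vcomp_c1 vcomp_succ IH).
Qed.

Fixpoint nrec (B : Type) (b : B) (f : nat -> B -> B) (n : nat) : B :=
  if n is k.+1 then f k (nrec b f k) else b.

Lemma vcomp_prec n g h : vcomp n g -> vcomp n.+2 h ->
  vcomp n.+1 (fun v => nrec (g (behead v))
                (fun k y => h [:: k, y & behead v]) (nth 0 v 0)).
Proof.
move=> [p Hp] [q Hq]; exists (RPrec p q) => -[//|m v] [sv] /=.
elim: m => [|m IH] /=; first by apply: ev_prec0; apply: Hp.
by apply: ev_precS; [exact: IH | apply: Hq; rewrite /= sv].
Qed.

Lemma vcomp_prec1 n g h t : vcomp n g -> vcomp n.+2 h ->
  (forall v, size v = n -> t (0 :: v) = g v) ->
  (forall k v, size v = n -> t (k.+1 :: v) = h [:: k, t (k :: v) & v]) ->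
  vcomp n.+1 t.
Proof.
move=> cg ch t0 tS; apply: vcomp_ext (vcomp_prec cg ch) => -[//|m v] [sv] /=.
by elim: m => [|m IH] /=; rewrite ?t0 ?tS ?IH.
Qed.

Lemma vcomp_add : vcomp 2 (fun v => nth 0 v 0 + nth 0 v 1).
Proof.
apply: (@vcomp_prec1 1 _ (fun v => (nth 0 v 1).+1)
   _ (@vcomp_nth 1 0 erefl)).
- by apply: (vcomp_c1 vcomp_succ (@vcomp_nth 3 1 _)).
- by move=> [|x []].
- by move=> k [|x []] //= _; rewrite addSn.
Qed.

Lemma vcomp_mul : vcomp 2 (fun v => nth 0 v 0 * nth 0 v 1).
Proof.
apply: (@vcomp_prec1 1 (fun _ => 0) (fun v => nth 0 v 1 + nth 0 v 2)).
- exact: vcomp_const.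
- by apply: (vcomp_c2 vcomp_add (@vcomp_nth 3 1 _) (@vcomp_nth 3 2 _)).
- by [].
- by move=> k [|x []] //= _; rewrite mulSn addnC.
Qed.

Lemma vcomp_pred : vcomp 1 (fun v => (nth 0 v 0).-1).
Proof.
by apply: (@vcomp_prec1 0 (fun _ => 0) (fun v => nth 0 v 0));
  [exact: vcomp_const | exact: vcomp_nth | |].
Qed.

(** Primitive recursion runs on the first argument, hence the exchanged order. *)
Lemma vcomp_subr : vcomp 2 (fun v => nth 0 v 1 - nth 0 v 0).
Proof.
apply: (@vcomp_prec1 1 (fun v => nth 0 v 0) (fun v => (nth 0 v 1).-1)).
- exact: vcomp_nth.
- by apply: (vcomp_c1 vcomp_pred (@vcomp_nth 3 1 _)).
- by move=> [|x []] //= _; rewrite subn0.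
- by move=> k [|x []] //= _; rewrite subnS.
Qed.

Lemma vcomp_sub : vcomp 2 (fun v => nth 0 v 0 - nth 0 v 1).
Proof.
by apply: (vcomp_c2 vcomp_subr (@vcomp_nth 2 1 _) (@vcomp_nth 2 0 _)).
Qed.

Lemma vcomp_half : vcomp 1 (fun v => (nth 0 v 0)./2).
Proof.
apply: (@vcomp_prec1 0 (fun _ => 0) (fun v => nth 0 v 0 - nth 0 v 1)).
- exact: vcomp_const.
- by apply: (vcomp_c2 vcomp_sub (@vcomp_nth 2 0 _) (@vcomp_nth 2 1 _)).
- by [].
- by move=> k [] //= _; lia.
Qed.

Lemma vcomp_odd : vcomp 1 (fun v => odd (nth 0 v 0)).
Proof.
apply: (@vcomp_prec1 0 (fun _ => 0) (fun v => 1 - nth 0 v 1)).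
- exact: vcomp_const.
- by apply: (vcomp_c2 vcomp_sub (vcomp_const 2 1) (@vcomp_nth 2 1 _)).
- by [].
- by move=> k [] //= _; case: (odd k).
Qed.

(** One step of [CodeSeq.code]: prepending [x] to the list coded by [y]. It serves both as list
    constructor and as pairing function. *)
Definition consn (x y : nat) : nat := 2 ^ x * y.*2.+1.

Lemma vcomp_consn : vcomp 2 (fun v => consn (nth 0 v 0) (nth 0 v 1)).
Proof.
apply: (@vcomp_prec1 1 (fun v => (nth 0 v 0 + nth 0 v 0).+1)
  (fun v => nth 0 v 1 + nth 0 v 1)).
- exact: (vcomp_c1 vcomp_succ (vcomp_c2 vcomp_add (@vcomp_nth 1 0 _) (@vcomp_nth 1 0 _))).
- by apply: (vcomp_c2 vcomp_add (@vcomp_nth 3 1 _) (@vcomp_nth 3 1 _)).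
- by move=> [|x []] //= _; rewrite /consn mul1n addnn.
- by move=> k [|x []] //= _; rewrite /consn expnS; lia.
Qed.

Lemma consn_inj x y x' y' : consn x y = consn x' y' -> x = x' /\ y = y'.
Proof.
move=> e; have : CodeSeq.code (x :: CodeSeq.decode y)
                 = CodeSeq.code (x' :: CodeSeq.decode y').
  by rewrite /= !CodeSeq.decodeK.
by move/(can_inj CodeSeq.codeK) => -[-> /(can_inj CodeSeq.decodeK) ->].
Qed.

Lemma consn_gt0 x y : 0 < consn x y.
Proof. by rewrite muln_gt0 expn_gt0. Qed.

Lemma subn1_consn x y : 1 - consn x y = 0.
Proof. by apply/eqP; rewrite subn_eq0 consn_gt0. Qed.

Lemma consn_ltl x y : x < consn x y.
Proof. by rewrite (leq_trans (ltn_expl x (ltnSn 1))) // leq_pmulr. Qed.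

Lemma consn_ltr x y : y < consn x y.
Proof. rewrite /consn; have := expn_gt0 2 x; nia. Qed.

Definition headn (z : nat) : nat := head 0 (CodeSeq.decode z).
Definition tailn (z : nat) : nat := CodeSeq.code (behead (CodeSeq.decode z)).

Lemma decode_consn x y : CodeSeq.decode (consn x y) = x :: CodeSeq.decode y.
Proof.
by apply: (can_inj CodeSeq.codeK); rewrite CodeSeq.decodeK /= CodeSeq.decodeK.
Qed.

Lemma headnK x y : headn (consn x y) = x.
Proof. by rewrite /headn decode_consn. Qed.

Lemma tailnK x y : tailn (consn x y) = y.
Proof. by rewrite /tailn decode_consn /= CodeSeq.decodeK. Qed.

Lemma consnP z : z = 0 \/ exists x y, z = consn x y.
Proof.
rewrite -[z]CodeSeq.decodeK; case: CodeSeq.decode => [|x l]; first by left.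
by right; exists x, (CodeSeq.code l).
Qed.

Definition halvings (k z : nat) : nat := nrec z (fun _ y => y./2) k.

Lemma vcomp_halvings : vcomp 2 (fun v => halvings (nth 0 v 0) (nth 0 v 1)).
Proof.
apply: (@vcomp_prec1 1 (fun v => nth 0 v 0) (fun v => (nth 0 v 1)./2)).
- exact: vcomp_nth.
- by apply: (vcomp_c1 vcomp_half (@vcomp_nth 3 1 _)).
- by [].
- by [].
Qed.

Lemma halvings_consn k x y : k <= x -> halvings k (consn x y) = consn (x - k) y.
Proof.
elim: k => [|k IH] lkx; first by rewrite subn0.
rewrite /halvings /= -/(halvings k _) IH 1?ltnW // /consn.
have -> : x - k = (x - k.+1).+1 by lia.
by rewrite expnS -mulnA mul2n doubleK.
Qed.

Lemma consn_odd x y : odd (consn x y) = (x == 0).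
Proof. by rewrite oddM oddX /= odd_double andbT orbF. Qed.

Lemma vcomp_headn : vcomp 1 (fun v => headn (nth 0 v 0)).
Proof.
(* The head is the exponent of 2, found by unbounded search for the first odd halving. The test also
   succeeds when the code is 0, where no halving is odd and the search would diverge. *)
have [p Hp] : vcomp 2 (fun v => (1 - nth 0 v 1) * 0 +
      (1 - (odd (halvings (nth 0 v 0) (nth 0 v 1)) + (1 - nth 0 v 1)))).
  apply: vcomp_c2 vcomp_add _ _.
    apply: vcomp_c2 vcomp_mul _ (vcomp_const _ _).
    exact: (vcomp_c2 vcomp_sub (vcomp_const _ _) (@vcomp_nth 2 1 _)).
  apply: (vcomp_c2 vcomp_sub (vcomp_const _ _)).
  apply: (vcomp_c2 vcomp_add).
    exact: (vcomp_c1 vcomp_odd vcomp_halvings).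
  exact: (vcomp_c2 vcomp_sub (vcomp_const _ _) (@vcomp_nth 2 1 _)).
exists (RMin p) => -[|z []] //= _.
have Hz m := Hp [:: m; z] erefl.
case: (consnP z) => [z0|[x [y zE]]].
  apply: (@ev_min _ _ _ (fun _ => 0)); rewrite z0 //=.
  by have := Hz 0; rewrite z0 /= addn1 subSS sub0n.
rewrite zE headnK -zE; apply: (@ev_min _ _ _ (fun _ => 0)).
  move=> m lmx; have := Hz m; rewrite /= zE halvings_consn 1?ltnW // consn_odd.
  by rewrite subn1_consn subn_eq0 leqNgt lmx.
have := Hz x; rewrite /= zE halvings_consn // consn_odd subnn eqxx /=.
by rewrite subn1_consn.
Qed.

Lemma vcomp_tailn : vcomp 1 (fun v => tailn (nth 0 v 0)).
Proof.
have := vcomp_c1 vcomp_half (vcomp_c2 vcomp_halvings vcomp_headn (@vcomp_nth 1 0 _)).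
move=> /(_ erefl); apply: vcomp_ext => -[|z []] //= _.
case: (consnP z) => [->|[x [y ->]]] //.
by rewrite headnK tailnK halvings_consn // subnn /consn expn0 mul1n /= uphalf_double.
Qed.

(** * Computable functions between encoded types *)

(** Injectivity suffices: programs are only run on codes of actual elements, so no decoder is part
    of the structure. *)
Class Enc (A : Type) := { enc : A -> nat; enc_inj : injective enc }.

#[global] Instance enc_nat : Enc nat := {| enc := id; enc_inj := @inj_id nat |}.

Lemma nat_of_bool_inj : injective nat_of_bool. Proof. by case; case. Qed.
#[global] Instance enc_bool : Enc bool := {| enc_inj := nat_of_bool_inj |}.

Lemma enc_pair_inj A B (EA : Enc A) (EB : Enc B) :
  injective (fun p : A * B => consn (enc p.1) (enc p.2)).
Proof. by move=> [a b] [a' b'] /= /consn_inj [ea eb]; rewrite (enc_inj ea) (enc_inj eb). Qed.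
#[global] Instance enc_pair A B (EA : Enc A) (EB : Enc B) : Enc (A * B) :=
  {| enc_inj := @enc_pair_inj A B EA EB |}.

Definition enc_list A (EA : Enc A) (s : seq A) : nat :=
  CodeSeq.code [seq enc x | x <- s].
Lemma enc_list_inj A (EA : Enc A) : injective (enc_list EA).
Proof. by move=> s t /(can_inj CodeSeq.codeK) /(inj_map (@enc_inj A EA)). Qed.
#[global] Instance enc_seq A (EA : Enc A) : Enc (seq A) :=
  {| enc_inj := @enc_list_inj A EA |}.

Lemma enc_code (s : seq nat) : enc s = CodeSeq.code s.
Proof. by rewrite /= /enc_list map_id. Qed.

Definition computable A B {EA : Enc A} {EB : Enc B} (f : A -> B) : Prop :=
  exists p, forall a, computes p [:: enc a] (enc (f a)).

Section Comp.
Context {G : Type} {EG : Enc G}.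

Lemma comp_ext B {EB : Enc B} (f g : G -> B) : f =1 g -> computable f -> computable g.
Proof. by move=> e [p Hp]; exists p => a; rewrite -e. Qed.

Lemma comp_id : computable (fun g : G => g).
Proof. by exists (RProj 0) => a; apply: (@ev_proj 0 [:: _]). Qed.

Lemma comp_const B {EB : Enc B} (b : B) : computable (fun _ : G => b).
Proof. by have [p Hp] := vcomp_const 1 (enc b); exists p => a; apply: Hp. Qed.

Lemma comp_comp A B {EA : Enc A} {EB : Enc B} (f : A -> B) (g : G -> A) :
  computable f -> computable g -> computable (fun x => f (g x)).
Proof.
move=> [p Hp] [q Hq]; exists (RComp p [:: q]) => a.
by apply: ev_comp (Hp (g a)); apply: evs_cons (evs_nil _); apply: Hq.
Qed.

Lemma comp_v1 A B {EA : Enc A} {EB : Enc B} g (f : G -> A) (t : G -> B) :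
  vcomp 1 g -> computable f -> (forall a, enc (t a) = g [:: enc (f a)]) -> computable t.
Proof.
move=> [p Hp] [q Hq] e; exists (RComp p [:: q]) => a; rewrite e.
by apply: ev_comp (Hp [:: _] erefl); apply: evs_cons (evs_nil _); apply: Hq.
Qed.

Lemma comp_v2 A A' B {EA : Enc A} {EA' : Enc A'} {EB : Enc B} g
    (f : G -> A) (f' : G -> A') (t : G -> B) :
  vcomp 2 g -> computable f -> computable f' ->
  (forall a, enc (t a) = g [:: enc (f a); enc (f' a)]) -> computable t.
Proof.
move=> [p Hp] [q Hq] [q' Hq'] e; exists (RComp p [:: q; q']) => a; rewrite e.
apply: ev_comp (Hp [:: _; _] erefl).
by apply: evs_cons; [exact: Hq | apply: evs_cons (evs_nil _); apply: Hq'].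
Qed.

Lemma comp_pair A B {EA : Enc A} {EB : Enc B} (f : G -> A) (g : G -> B) :
  computable f -> computable g -> computable (fun x => (f x, g x)).
Proof. by move=> cf cg; apply: (comp_v2 vcomp_consn cf cg). Qed.

Lemma comp_fst A B {EA : Enc A} {EB : Enc B} (f : G -> A * B) :
  computable f -> computable (fun x => (f x).1).
Proof. by move=> cf; apply: (comp_v1 vcomp_headn cf) => a; rewrite /= headnK. Qed.

Lemma comp_snd A B {EA : Enc A} {EB : Enc B} (f : G -> A * B) :
  computable f -> computable (fun x => (f x).2).
Proof. by move=> cf; apply: (comp_v1 vcomp_tailn cf) => a; rewrite /= tailnK. Qed.

Lemma comp_succ (f : G -> nat) : computable f -> computable (fun x => (f x).+1).
Proof. by move=> cf; apply: (comp_v1 vcomp_succ cf). Qed.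
Lemma comp_pred (f : G -> nat) : computable f -> computable (fun x => (f x).-1).
Proof. by move=> cf; apply: (comp_v1 vcomp_pred cf). Qed.
Lemma comp_add (f g : G -> nat) : computable f -> computable g -> computable (fun x => f x + g x).
Proof. by move=> cf cg; apply: (comp_v2 vcomp_add cf cg). Qed.
Lemma comp_sub (f g : G -> nat) : computable f -> computable g -> computable (fun x => f x - g x).
Proof. by move=> cf cg; apply: (comp_v2 vcomp_sub cf cg). Qed.
Lemma comp_mul (f g : G -> nat) : computable f -> computable g -> computable (fun x => f x * g x).
Proof. by move=> cf cg; apply: (comp_v2 vcomp_mul cf cg). Qed.

Lemma comp_enc A {EA : Enc A} (f : G -> A) : computable f -> computable (fun x => enc (f x)).
Proof. by move=> [p Hp]; exists p. Qed.

Lemma comp_decode (f : G -> nat) : computable f -> computable (fun x => CodeSeq.decode (f x)).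
Proof. by move=> [p Hp]; exists p => a; rewrite enc_code CodeSeq.decodeK. Qed.

Lemma comp_code (f : G -> seq nat) : computable f -> computable (fun x => CodeSeq.code (f x)).
Proof. by move=> [p Hp]; exists p => a; rewrite -enc_code. Qed.

End Comp.

Lemma comp_nrec G B {EG : Enc G} {EB : Enc B} (n : G -> nat) (b : G -> B)
    (f : G -> nat -> B -> B) :
  computable b -> computable (fun p : G * (nat * B) => f p.1 p.2.1 p.2.2) -> computable n ->
  computable (fun x => nrec (b x) (f x) (n x)).
Proof.
move=> [pb Hb] [pf Hf] [pn Hn]; have [pc Hc] := vcomp_consn.
pose P i := RProj i.
exists (RComp (RPrec pb (RComp pf [:: RComp pc [:: P 2; RComp pc [:: P 0; P 1]]]))
          [:: pn; P 0]) => a.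
apply: ev_comp.
  apply: evs_cons; first exact: Hn.
  by apply: evs_cons (evs_nil _); apply: (@ev_proj 0 [:: _]).
rewrite /=; elim: (n a) => [|k IH] /=; first by apply: ev_prec0; apply: Hb.
apply: ev_precS IH _; apply: ev_comp (Hf (a, (k, _))).
apply: evs_cons (evs_nil _); apply: ev_comp (Hc [:: _; _] erefl).
apply: evs_cons; first by apply: (@ev_proj 2 [:: _; _; _]).
apply: evs_cons (evs_nil _); apply: ev_comp (Hc [:: _; _] erefl).
apply: evs_cons; first by apply: (@ev_proj 0 [:: _; _; _]).
by apply: evs_cons (evs_nil _); apply: (@ev_proj 1 [:: _; _; _]).
Qed.

Section Comp2.
Context {G : Type} {EG : Enc G}.

(** A conditional is a recursion of length 0 or 1 on the code of the Boolean. *)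
Lemma comp_if B {EB : Enc B} (c : G -> bool) (x y : G -> B) :
  computable c -> computable x -> computable y -> computable (fun g => if c g then x g else y g).
Proof.
move=> [pc Hc] cx cy.
have cn : computable (fun g => c g : nat) by exists pc.
have cx' : computable (fun p : G * (nat * B) => x p.1).
  by apply: comp_comp; [exact: cx | apply: comp_fst; exact: comp_id].
apply: comp_ext (comp_nrec cy (f := fun g _ _ => x g) cx' cn).
by move=> g /=; case: (c g).
Qed.

Lemma comp_lcase A B {EA : Enc A} {EB : Enc B} (s : G -> seq A) (y : G -> B)
    (f : G -> A -> seq A -> B) :
  computable s -> computable y -> computable (fun p : G * (A * seq A) => f p.1 p.2.1 p.2.2) ->
  computable (fun g => if s g is a :: r then f g a r else y g).
Proof.
(* The cons branch runs inside [RPrec], hence only when the list is nonempty. *)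
move=> [ps Hs] [py Hy] [pf Hf]; have [pc Hc] := vcomp_consn.
have [pS HS] := vcomp_c2 vcomp_sub (vcomp_const 1 1)
  (vcomp_c2 vcomp_sub (vcomp_const 1 1) (@vcomp_nth 1 0 erefl)).
pose P i := RProj i.
exists (RComp (RPrec py (RComp pf [:: RComp pc [:: P 2; RComp ps [:: P 2]]]))
          [:: RComp pS [:: ps]; P 0]) => g.
apply: ev_comp.
  apply: evs_cons.
    by apply: ev_comp (HS [:: _] erefl); apply: evs_cons (Hs g) (evs_nil _).
  by apply: evs_cons (evs_nil _); apply: (@ev_proj 0 [:: _]).
have {}Hs := Hs g; case: (s g) Hs => [|a r] Hs.
  by rewrite /=; apply: ev_prec0; apply: Hy.
rewrite [nth _ _ _]/= subn1_consn subn0.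
apply: ev_precS; first by apply: ev_prec0; apply: Hy.
apply: ev_comp (Hf (g, (a, r))); apply: evs_cons (evs_nil _).
apply: ev_comp (Hc [:: _; _] erefl).
apply: evs_cons; first by apply: (@ev_proj 2 [:: _; _; _]).
apply: evs_cons (evs_nil _); apply: ev_comp Hs.
by apply: evs_cons (evs_nil _); apply: (@ev_proj 2 [:: _; _; _]).
Qed.

Lemma comp_nil A {EA : Enc A} : computable (fun _ : G => [::] : seq A).
Proof. exact: comp_const. Qed.

Lemma comp_cons A {EA : Enc A} (a : G -> A) (s : G -> seq A) :
  computable a -> computable s -> computable (fun g => a g :: s g).
Proof. by move=> ca cs; apply: (comp_v2 vcomp_consn ca cs). Qed.

Lemma comp_leq (f g : G -> nat) : computable f -> computable g -> computable (fun x => f x <= g x).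
Proof.
move=> cf cg.
apply: (comp_v2 (vcomp_c2 vcomp_sub (vcomp_const 2 1)
  (vcomp_c2 vcomp_sub (@vcomp_nth 2 0 erefl) (@vcomp_nth 2 1 erefl))) cf cg).
by move=> a /=; rewrite /leq; case: (_ - _).
Qed.

Lemma comp_negb (f : G -> bool) : computable f -> computable (fun x => ~~ f x).
Proof.
move=> cf; apply: comp_ext (comp_if cf (comp_const false) (comp_const true)).
by move=> x; case: (f x).
Qed.
Lemma comp_andb (f g : G -> bool) : computable f -> computable g -> computable (fun x => f x && g x).
Proof. by move=> cf cg; apply: (comp_if cf cg (comp_const false)). Qed.
Lemma comp_orb (f g : G -> bool) : computable f -> computable g -> computable (fun x => f x || g x).
Proof. by move=> cf cg; apply: (comp_if cf (comp_const true) cg). Qed.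

Lemma comp_eq (A : eqType) {EA : Enc A} (f g : G -> A) :
  computable f -> computable g -> computable (fun x => f x == g x).
Proof.
move=> cf cg; have cf' := comp_enc cf; have cg' := comp_enc cg.
apply: comp_ext (comp_andb (comp_leq cf' cg') (comp_leq cg' cf')) => x.
by rewrite -eqn_leq (inj_eq enc_inj).
Qed.

End Comp2.

Ltac comp_var :=
  repeat first [ exact: comp_id | exact: comp_const
               | apply: comp_fst | apply: comp_snd | apply: comp_pair | assumption ].

Lemma comp_app G A B {EG : Enc G} {EA : Enc A} {EB : Enc B} (f : A -> B) :
  computable f -> forall g : G -> A, computable g -> computable (fun x => f (g x)).
Proof. by move=> cf g cg; apply: comp_comp. Qed.

Section CompFold1.
Context {G : Type} {EG : Enc G}.

Lemma size_enc A (EA : Enc A) (s : seq A) : size s <= enc s.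
Proof.
elim: s => //= a s IH; rewrite (leq_ltn_trans IH) //.
exact: (consn_ltr (enc a) (enc s)).
Qed.

Lemma comp_foldl A B {EA : Enc A} {EB : Enc B} (s : G -> seq A) (b : G -> B)
    (f : G -> B -> A -> B) :
  computable (fun p : G * (B * A) => f p.1 p.2.1 p.2.2) -> computable b -> computable s ->
  computable (fun g => foldl (f g) (b g) (s g)).
Proof.
move=> cf cb cs.
(* The state is the remaining list with the accumulator. The number of rounds is the code of the
   list, which bounds its length; once the list is empty the state stays fixed. *)
pose st g (_ : nat) (q : seq A * B) :=
  if q.1 is a :: r then (r, f g q.2 a) else q.
have cst : computable (fun p : G * (nat * (seq A * B)) => st p.1 p.2.1 p.2.2).
  apply: (@comp_lcase _ _ _ _ _ _ (fun p : G * (nat * (seq A * B)) => p.2.2.1)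
     (fun p => p.2.2) (fun p a r => (r, f p.1 p.2.2.2 a))); try by comp_var.
  apply: comp_pair; first by comp_var.
  apply: (comp_app cf (g := fun p => (p.1.1, (p.1.2.2.2, p.2.1)))).
  by comp_var.
have c0 : computable (fun g => (s g, b g)) by apply: comp_pair.
have := comp_snd (comp_nrec c0 cst (comp_enc cs)).
apply: comp_ext => g; have := size_enc EA (s g).
move: (enc _) => n; move: (s g) (b g) => {cs cb c0} s0 b0 lsn.
have stE m t c : nrec (t, c) (st g) m = (drop m t, foldl (f g) c (take m t)).
  elim: m => [|m IH] /=; first by rewrite drop0 take0.
  rewrite IH /st /=; case E: (drop m t) => [|a r].
    rewrite !take_oversize ?drop_oversize //;
      have := congr1 size E; rewrite size_drop /=; lia.
  have lm : m < size t by have := congr1 size E; rewrite size_drop /=; lia.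
  rewrite (take_nth a lm) foldl_rcons.
  have := drop_nth a lm; rewrite E => -[<- <-] //.
by rewrite stE take_oversize.
Qed.

Lemma comp_rev A {EA : Enc A} (s : G -> seq A) : computable s -> computable (fun g => rev (s g)).
Proof.
move=> cs.
have : computable (fun g => foldl (fun r a => a :: r) [::] (s g)).
  apply: (@comp_foldl _ _ _ _ s (fun _ => [::]) (fun _ r a => a :: r)) => //.
    by apply: comp_cons; comp_var.
  exact: comp_nil.
apply: comp_ext => g; rewrite /rev; move: (@nil A).
by elim: (s g) => [|a t IH] r //=.
Qed.

Lemma comp_foldr A B {EA : Enc A} {EB : Enc B} (s : G -> seq A) (b : G -> B)
    (f : G -> A -> B -> B) :
  computable (fun p : G * (A * B) => f p.1 p.2.1 p.2.2) -> computable b -> computable s ->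
  computable (fun g => foldr (f g) (b g) (s g)).
Proof.
move=> cf cb cs.
apply: (comp_ext _ (@comp_foldl A B EA EB (fun g => rev (s g)) b (fun g y a => f g a y)
  _ cb (comp_rev cs))) => [g|]; first by rewrite foldl_rev.
by apply: (comp_app cf (g := fun p => (p.1, (p.2.2, p.2.1)))); comp_var.
Qed.

Lemma comp_map A B {EA : Enc A} {EB : Enc B} (s : G -> seq A) (f : G -> A -> B) :
  computable (fun p : G * A => f p.1 p.2) -> computable s -> computable (fun g => map (f g) (s g)).
Proof.
move=> cf cs.
apply: (comp_ext _ (@comp_foldr A (seq B) EA (enc_seq EB) s (fun _ => [::])
  (fun g a r => f g a :: r) _ comp_nil cs)) => //.
apply: comp_cons; last by comp_var.
by apply: (comp_app cf (g := fun p => (p.1, p.2.1))); comp_var.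
Qed.

Lemma comp_filter A {EA : Enc A} (s : G -> seq A) (f : G -> pred A) :
  computable (fun p : G * A => f p.1 p.2) -> computable s ->
  computable (fun g => filter (f g) (s g)).
Proof.
move=> cf cs.
apply: (comp_ext _ (@comp_foldr A (seq A) EA (enc_seq EA) s (fun _ => [::])
   (fun g a r => if f g a then a :: r else r) _ comp_nil cs)) => //.
apply: comp_if; [|by apply: comp_cons; comp_var|by comp_var].
by apply: (comp_app cf (g := fun p => (p.1, p.2.1))); comp_var.
Qed.

Lemma comp_all A {EA : Enc A} (s : G -> seq A) (f : G -> pred A) :
  computable (fun p : G * A => f p.1 p.2) -> computable s -> computable (fun g => all (f g) (s g)).
Proof.
move=> cf cs.
apply: (comp_ext _ (@comp_foldr A bool EA enc_bool s (fun _ => true)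
  (fun g a r => f g a && r) _ (comp_const _) cs)) => //.
apply: comp_andb; [|by comp_var].
by apply: (comp_app cf (g := fun p => (p.1, p.2.1))); comp_var.
Qed.

Lemma comp_has A {EA : Enc A} (s : G -> seq A) (f : G -> pred A) :
  computable (fun p : G * A => f p.1 p.2) -> computable s -> computable (fun g => has (f g) (s g)).
Proof.
move=> cf cs.
apply: (comp_ext _ (@comp_foldr A bool EA enc_bool s (fun _ => false)
  (fun g a r => f g a || r) _ (comp_const _) cs)) => //.
apply: comp_orb; [|by comp_var].
by apply: (comp_app cf (g := fun p => (p.1, p.2.1))); comp_var.
Qed.

Lemma comp_size A {EA : Enc A} (s : G -> seq A) : computable s -> computable (fun g => size (s g)).
Proof.
move=> cs.
apply: (comp_ext _ (@comp_foldr A nat EA enc_nat s (fun _ => 0) (fun _ _ r => r.+1)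
  _ (comp_const _) cs)) => //.
by apply: comp_succ; comp_var.
Qed.

Lemma comp_count A {EA : Enc A} (s : G -> seq A) (f : G -> pred A) :
  computable (fun p : G * A => f p.1 p.2) -> computable s -> computable (fun g => count (f g) (s g)).
Proof.
move=> cf cs; apply: comp_ext (comp_size (comp_filter cf cs)) => g.
exact: size_filter.
Qed.

Lemma comp_cat A {EA : Enc A} (s t : G -> seq A) :
  computable s -> computable t -> computable (fun g => s g ++ t g).
Proof.
move=> cs ct; apply: (comp_ext _ (@comp_foldr A (seq A) EA (enc_seq EA) s t (fun _ a r => a :: r) _ ct cs));
  last by apply: comp_cons; comp_var.
by move=> g; elim: (s g) => //= a r ->.
Qed.

End CompFold1.

Section CompFold2.
Context {G : Type} {EG : Enc G}.

Lemma comp_flatten A {EA : Enc A} (s : G -> seq (seq A)) :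
  computable s -> computable (fun g => flatten (s g)).
Proof.
move=> cs.
apply: (comp_ext _ (@comp_foldr G EG (seq A) (seq A) (enc_seq EA) (enc_seq EA) s (fun _ => [::])
  (fun _ a r => a ++ r) _ comp_nil cs)) => //.
by apply: comp_cat; comp_var.
Qed.

Lemma comp_rcons A {EA : Enc A} (s : G -> seq A) (a : G -> A) :
  computable s -> computable a -> computable (fun g => rcons (s g) (a g)).
Proof.
move=> cs ca; apply: comp_ext (comp_cat cs (comp_cons ca comp_nil)) => g.
exact: cats1.
Qed.

End CompFold2.

Section CompFold3.
Context {G : Type} {EG : Enc G}.

Lemma comp_iota (m n : G -> nat) : computable m -> computable n -> computable (fun g => iota (m g) (n g)).
Proof.
move=> cm cn.
apply: (comp_ext _ (@comp_nrec G (seq nat) EG (enc_seq enc_nat) n (fun _ => [::])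
  (fun g k r => rcons r (m g + k)) comp_nil _ cn)); last first.
- apply: comp_rcons; first by comp_var.
  apply: comp_add; last by comp_var.
  by apply: (comp_app cm (g := fst)); comp_var.
- by move=> g /=; elim: (n g) => //= k ->; rewrite -[RHS]/(iota _ k.+1) -addn1 iotaD cats1.
Qed.

Lemma comp_nth A {EA : Enc A} (d : G -> A) (s : G -> seq A) (i : G -> nat) :
  computable d -> computable s -> computable i -> computable (fun g => nth (d g) (s g) (i g)).
Proof.
move=> cd cs ci.
have : computable (fun g => if nrec (s g) (fun _ t => if t is a :: r then r else [::]) (i g)
                      is a :: r then a else d g).
  apply: (@comp_lcase G _ A A _ _ _ d (fun _ a _ => a)) => //; last by comp_var.
  apply: (@comp_nrec G (seq A) _ _ i s (fun _ _ t => if t is a :: r then r else [::])) => //.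
  apply: (@comp_lcase _ _ A (seq A) _ _ (fun p : G * (nat * seq A) => p.2.2)
     (fun _ => [::]) (fun _ _ r => r)); by comp_var.
apply: comp_ext => g.
have -> : nrec (s g) (fun _ t => if t is a :: r then r else [::]) (i g) = drop (i g) (s g).
  elim: (i g) => [|k /= ->] /=; first by rewrite drop0.
  by rewrite -add1n -drop_drop; case: (drop k _) => //= a r; rewrite drop0.
elim: (s g) (i g) => [|a r IH] [|k] //=.
Qed.

Lemma comp_mem (A : eqType) {EA : Enc A} (s : G -> seq A) (a : G -> A) :
  computable s -> computable a -> computable (fun g => a g \in s g).
Proof.
move=> cs ca; apply: (comp_ext _ (@comp_has G EG A EA s (fun g x => x == a g) _ cs)) => [g|];
  first exact: has_pred1.
apply: comp_eq; first by comp_var.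
by apply: (comp_app ca (g := fst)); comp_var.
Qed.

Lemma comp_index (A : eqType) {EA : Enc A} (s : G -> seq A) (a : G -> A) :
  computable s -> computable a -> computable (fun g => index (a g) (s g)).
Proof.
move=> cs ca.
apply: (comp_ext _ (@comp_foldr G EG A nat EA enc_nat s (fun _ => 0)
  (fun g x r => if x == a g then 0 else r.+1) _ (comp_const _) cs)).
  by move=> g; rewrite /index; elim: (s g) => //= x r ->.
apply: comp_if; [|by comp_var|by apply: comp_succ; comp_var].
apply: comp_eq; first by comp_var.
by apply: (comp_app ca (g := fst)); comp_var.
Qed.

Lemma comp_exp (f g : G -> nat) : computable f -> computable g -> computable (fun x => f x ^ g x).
Proof.
move=> cf cg; apply: (comp_ext _ (@comp_nrec G nat EG enc_nat g (fun _ => 1) (fun x _ r => f x * r)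
  (comp_const _) _ cg)); last first.
- apply: comp_mul; last by comp_var.
  by apply: (comp_app cf (g := fst)); comp_var.
- by move=> x; elim: (g x) => //= k ->; rewrite expnS.
Qed.

Lemma comp_fact (f : G -> nat) : computable f -> computable (fun x => (f x)`!).
Proof.
move=> cf; apply: (comp_ext _ (@comp_nrec G nat EG enc_nat f (fun _ => 1) (fun _ k r => k.+1 * r)
  (comp_const _) _ cf)); last first.
- by apply: comp_mul; [apply: comp_succ|]; comp_var.
- by move=> x; elim: (f x) => //= k ->; rewrite factS.
Qed.

Lemma comp_modn (f g : G -> nat) : computable f -> computable g -> computable (fun x => f x %% g x).
Proof.
move=> cf cg.
apply: (comp_ext _ (@comp_nrec G nat EG enc_nat f (fun _ => 0)
  (fun x _ r => if r.+1 == g x then 0 else r.+1) (comp_const _) _ cf)); last first.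
- apply: comp_if; [|by comp_var|by apply: comp_succ; comp_var].
  apply: comp_eq; first by apply: comp_succ; comp_var.
  by apply: (comp_app cg (g := fst)); comp_var.
- move=> x; move: (g x) => q; elim: (f x) => /= [|k ->]; first by rewrite mod0n.
  case: q => [|q]; first by rewrite !modn0.
  rewrite modnS; have := ltn_pmod k (ltn0Sn q); have := divn_eq k q.+1.
  case: eqP => [E Ek _|NE Ek lk].
    by rewrite (_ : _ %| _) // Ek -addnS E -mulSnr dvdn_mull.
  case: ifP => // /dvdnP [j Ej]; exfalso.
  have : k.+1 %% q.+1 = 0 by rewrite Ej modnMl.
  by rewrite {1}Ek -addnS modnMDl modn_small //; lia.
Qed.

End CompFold3.

(** Recursion with fuel [n]. It simulates structural recursion on formulas whose other arguments
    change from call to call; the code of the formula is enough fuel, since subformulas have smaller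
    codes. *)
Fixpoint treerec (A B : Type) (sub : A -> seq A) (comb : A -> seq B -> B) n a :=
  if n is k.+1 then comb a [seq treerec sub comb k x | x <- sub a] else comb a [::].

(* The call tree is explored level by level: [Q i] lists all arguments of calls
   at depth [i], and the results are then computed from the bottom up. *)
Lemma comp_treerec G (A : eqType) B {EG : Enc G} {EA : Enc A} {EB : Enc B}
    (sub : G -> A -> seq A) (comb : G -> A -> seq B -> B) (n : G -> nat) (a : G -> A) :
  computable (fun p : G * A => sub p.1 p.2) ->
  computable (fun p : G * (A * seq B) => comb p.1 p.2.1 p.2.2) -> computable n -> computable a ->
  computable (fun g => treerec (sub g) (comb g) (n g) (a g)).
Proof.
move=> csub ccomb cn ca.
pose Q g i := nrec [:: a g] (fun _ q => flatten [seq sub g x | x <- q]) i.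
have cQ : computable (fun p : G * nat => Q p.1 p.2).
  apply: (@comp_nrec _ _ _ _ (fun p : G * nat => p.2) (fun p => [:: a p.1])
    (fun p _ q => flatten [seq sub p.1 x | x <- q])); last by comp_var.
    apply: comp_cons; last exact: comp_nil.
    by apply: (comp_app ca (g := fst)); comp_var.
  apply: comp_flatten; apply: comp_map; last by comp_var.
  by apply: (comp_app csub (g := fun p => (p.1.1.1, p.2))); comp_var.
pose U g j := nrec [seq comb g x [::] | x <- Q g (n g)]
  (fun j u => [seq comb g x [seq nth (comb g (a g) [::]) u (index y (Q g (n g - j))) | y <- sub g x]
              | x <- Q g (n g - j.+1)]) j.
have cd : computable (fun g => comb g (a g) [::]).
  by apply: (comp_app ccomb (g := fun g => (g, (a g, [::])))); comp_var.
have cU : computable (fun g => U g (n g)).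
  apply: (@comp_nrec _ _ _ _ n (fun g => [seq comb g x [::] | x <- Q g (n g)])
    (fun g j u => [seq comb g x [seq nth (comb g (a g) [::]) u (index y (Q g (n g - j))) | y <- sub g x]
              | x <- Q g (n g - j.+1)])) => //.
    apply: comp_map.
      by apply: (comp_app ccomb (g := fun p => (p.1, (p.2, [::])))); comp_var.
    by apply: (comp_app cQ (g := fun g => (g, n g))); comp_var.
  apply: comp_map; last first.
    apply: (comp_app cQ (g := fun p => (p.1, n p.1 - p.2.1.+1))).
    apply: comp_pair; first by comp_var.
    apply: comp_sub; last by apply: comp_succ; comp_var.
    by apply: (comp_app cn (g := fst)); comp_var.
  apply: (comp_app ccomb (g := fun p => (p.1.1, (p.2, _)))).
  apply: comp_pair; first by comp_var.
  apply: comp_pair; first by comp_var.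
  apply: comp_map; last first.
    by apply: (comp_app csub (g := fun p => (p.1.1, p.2))); comp_var.
  apply: comp_nth; [|by comp_var|].
    by apply: (comp_app cd (g := fun p => p.1.1.1)); comp_var.
  apply: comp_index; last by comp_var.
  apply: (comp_app cQ (g := fun p => (p.1.1.1, n p.1.1.1 - p.1.1.2.1))).
  apply: comp_pair; first by comp_var.
  apply: comp_sub; last by comp_var.
  by apply: (comp_app cn (g := fun p => p.1.1.1)); comp_var.
have := comp_nth cd cU (comp_const 0); apply: comp_ext => g.
have UE j : j <= n g -> U g j = [seq treerec (sub g) (comb g) j x | x <- Q g (n g - j)].
  elim: j => [|j IH] lj; first by rewrite subn0.
  rewrite /U /= -/(U g j) IH 1?ltnW //; apply/eq_in_map => x xQ; congr comb.
  apply/eq_in_map => y ys.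
  have yQ : y \in Q g (n g - j).
    have -> : n g - j = (n g - j.+1).+1 by lia.
    by apply/flattenP; exists (sub g x); rewrite ?map_f.
  by rewrite (nth_map y) ?index_mem // nth_index.
by rewrite UE // subnn.
Qed.

Lemma comp_search G {EG : Enc G} (P : G -> nat -> bool) :
  computable (fun p : G * nat => P p.1 p.2) ->
  exists p, forall g n, P g n -> (forall m, m < n -> ~~ P g m) ->
    computes p [:: enc g] n.
Proof.
move=> /comp_negb [q Hq]; have [pc Hc] := vcomp_consn.
exists (RMin (RComp q [:: RComp pc [:: RProj 1; RProj 0]])) => g n Pn Pm.
have E m : computes (RComp q [:: RComp pc [:: RProj 1; RProj 0]]) [:: m; enc g] (~~ P g m).
  apply: ev_comp (Hq (g, m)); apply: evs_cons (evs_nil _).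
  apply: ev_comp (Hc [:: _; _] erefl).
  apply: evs_cons; first by apply: (@ev_proj 1 [:: _; _]).
  by apply: evs_cons (evs_nil _); apply: (@ev_proj 0 [:: _; _]).
apply: (@ev_min _ _ _ (fun _ => 0)) => [m /Pm Pm'|]; first by have := E m; rewrite Pm'.
by have := E n; rewrite Pn.
Qed.

(** * Ramsey's theorem and factorisations of infinite words *)

Definition inf_often (S : nat -> Prop) : Prop := forall n, exists2 m, n <= m & S m.

Lemma inf_often_pigeonhole (T : finType) (S : nat -> Prop) (g : nat -> T) :
  inf_often S -> exists t, inf_often (fun n => S n /\ g n = t).
Proof.
move=> iS; apply: contrapT => /forallNP H.
have HN t : exists N, forall m, N <= m -> S m -> g m <> t.
  apply: contrapT => /forallNP HN; apply: (H t) => n.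
  apply: contrapT => NE; apply: (HN n) => m lm Sm gm; apply: NE.
  by exists m.
have [N {}HN] := choice HN; have [m lm Sm] := iS (\max_t N t).
apply: (HN (g m) m _ Sm erefl); exact: leq_trans (leq_bigmax (g m)) lm.
Qed.

(** Nested infinite sets [Ss n] are chosen so that the point [a n] has one colour [t n] with all
    points kept afterwards; a colour occurring infinitely often among the [t n] gives the
    homogeneous subsequence. *)
Lemma ramsey (T : finType) (g : nat -> nat -> T) :
  exists e (c : nat -> nat), (forall i, c i < c i.+1) /\
    forall i j, i < j -> g (c i) (c j) = e.
Proof.
have step (S : nat -> Prop) : exists x : nat * T * (nat -> Prop), inf_often S ->
    [/\ S x.1.1, inf_often x.2 &
        forall m, x.2 m -> [/\ S m, x.1.1 < m & g x.1.1 m = x.1.2]].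
  have [iS|nS] := pselect (inf_often S); last by exists (0, g 0 0, S).
  have [a _ Sa] := iS 0.
  have iS' : inf_often (fun m => S m /\ a < m).
    move=> n; have [m lm Sm] := iS (maxn n a.+1).
    by exists m; [|split=> //]; lia.
  have [t it] := inf_often_pigeonhole (g a) iS'.
  by exists (a, t, fun m => (S m /\ a < m) /\ g a m = t) => _; split=> // m [[]].
have [F HF] := choice step.
pose Ss n := iter n (fun S => (F S).2) (fun _ => True).
have iSs n : inf_often (Ss n).
  by elim: n => [n|n IH] /=; [exists n | case: (HF _ IH)].
have sub n m : n <= m -> forall k, Ss m k -> Ss n k.
  elim: m => [|m IH]; first by rewrite leqn0 => /eqP ->.
  rewrite leq_eqVlt => /predU1P[-> //|/IH {}IH] k Sk; apply: IH.
  by have [_ _ /(_ k Sk) []] := HF _ (iSs m).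
pose a n := (F (Ss n)).1.1; pose t n := (F (Ss n)).1.2.
have aP n m : n < m -> a n < a m /\ g (a n) (a m) = t n.
  move=> lnm; have [Sa _ _] := HF _ (iSs m).
  by have [_ _ /(_ _ (sub n.+1 m lnm _ Sa)) []] := HF _ (iSs n).
have [e ie] : exists e, inf_often (fun n => True /\ t n = e).
  by apply: inf_often_pigeonhole => n; exists n.
have nx n : exists m, n < m /\ t m = e by have [m lm [_ tm]] := ie n.+1; exists m.
have [nxt nxtP] := choice nx.
pose c' i := iter i nxt (nxt 0); exists e, (fun i => a (c' i)).
have c'lt i j : i < j -> c' i < c' j.
  elim: j => // j IH; rewrite ltnS leq_eqVlt => /predU1P[->|/IH lij].
    by case: (nxtP (c' j)).
  by apply: ltn_trans lij _; case: (nxtP (c' j)).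
split=> [i|i j /c'lt /aP [_ ->]]; first by case: (aP _ _ (c'lt _ _ (ltnSn i))).
by case: i => [|i]; [case: (nxtP 0) | case: (nxtP (c' i))].
Qed.

Section Fac.
Variable A : Type.
Implicit Types x y : nat -> A.

Definition fac x a b : seq A := [seq x t | t <- index_iota a b].

Lemma size_fac x a b : size (fac x a b) = b - a.
Proof. by rewrite size_map size_iota. Qed.

Lemma nth_fac d x a b i : i < b - a -> nth d (fac x a b) i = x (a + i).
Proof. by move=> li; rewrite (nth_map 0) ?size_iota // nth_iota. Qed.

Lemma fac_cat x a b c : a <= b -> b <= c -> fac x a c = fac x a b ++ fac x b c.
Proof.
move=> lab lbc; rewrite /fac /index_iota -map_cat (_ : c - a = (b - a) + (c - b)); last by lia.
by rewrite iotaD subnKC.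
Qed.

Lemma fac_nil x a : fac x a a = [::].
Proof. by rewrite /fac /index_iota subnn. Qed.

Lemma fac1 x a : fac x a a.+1 = [:: x a].
Proof. by rewrite /fac /index_iota subSnn. Qed.

Lemma fac_ext x y a b : (forall t, a <= t < b -> x t = y t) -> fac x a b = fac y a b.
Proof.
by move=> e; apply/eq_in_map => t; rewrite mem_index_iota => /e.
Qed.

Lemma fac_inv x y a b t : fac x a b = fac y a b -> a <= t < b -> x t = y t.
Proof. by move=> /eq_in_map e lt; apply: e; rewrite mem_index_iota. Qed.

Lemma all_fac (P : pred A) x a b : all P (fac x a b) <-> forall t, a <= t < b -> P (x t).
Proof.
rewrite all_map; split=> [/allP H t lt|H]; first by apply: H; rewrite mem_index_iota.
by apply/allP => t; rewrite mem_index_iota => /H.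
Qed.

Lemma has_fac (P : pred A) x a b : has P (fac x a b) <-> exists2 t, a <= t < b & P (x t).
Proof.
rewrite has_map; split=> [/hasP [t lt Pt]|[t lt Pt]].
  by exists t => //; move: lt; rewrite mem_index_iota.
by apply/hasP; exists t; rewrite ?mem_index_iota.
Qed.

End Fac.

Definition cuts (c : nat -> nat) : Prop := c 0 = 0 /\ forall i, c i < c i.+1.

Lemma cuts_lt c i j : cuts c -> i < j -> c i < c j.
Proof.
move=> [_ H]; elim: j => // j IH; rewrite ltnS leq_eqVlt => /predU1P[->//|/IH].
by move/ltn_trans; apply.
Qed.

Lemma cuts_le c i j : cuts c -> i <= j -> c i <= c j.
Proof. by move=> Hc; rewrite leq_eqVlt => /predU1P[->//|/(cuts_lt Hc)/ltnW]. Qed.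

Lemma cuts_ge c i : cuts c -> i <= c i.
Proof. by move=> [_ H]; elim: i => // i /leq_ltn_trans; apply. Qed.

Fixpoint cut_idx (c : nat -> nat) t :=
  if t is s.+1 then let i := cut_idx c s in if c i.+1 == s.+1 then i.+1 else i else 0.

Lemma cut_idxP c t : cuts c -> c (cut_idx c t) <= t < c (cut_idx c t).+1.
Proof.
move=> [c0 H]; elim: t => [|t IH] /=; first by have := H 0; rewrite c0.
case: eqP => [E|NE]; last by lia.
by rewrite E leqnn -E H.
Qed.

Lemma cut_idx_uniq c t i : cuts c -> c i <= t < c i.+1 -> cut_idx c t = i.
Proof.
move=> Hc li; have := cut_idxP t Hc.
case: (ltngtP (cut_idx c t) i) => // l; have := cuts_le Hc l; lia.
Qed.

(** The second conclusion carries a bound on letters from the blocks to the glued word. *)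
Lemma glue A (a0 : A) c (bl : nat -> seq A) : cuts c ->
  (forall i, size (bl i) = c i.+1 - c i) ->
  exists x : nat -> A, (forall i, fac x (c i) (c i.+1) = bl i) /\
    forall t, exists i k, k < size (bl i) /\ x t = nth a0 (bl i) k.
Proof.
move=> Hc sb.
exists (fun t => nth a0 (bl (cut_idx c t)) (t - c (cut_idx c t))); split=> [i|t].
  apply: (@eq_from_nth _ a0) => [|k]; rewrite size_fac ?sb // => lk.
  rewrite nth_fac // (@cut_idx_uniq _ _ i) //; last by lia.
  by rewrite addKn.
exists (cut_idx c t), (t - c (cut_idx c t)); split=> //.
by rewrite sb; have := cut_idxP t Hc; lia.
Qed.

(** * Relations recognised by finite congruences *)

(* Environments are read time first: [w t v] is the letter at time [t] on the
   track named [v]. *)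
Definition bnd b (w : nat -> nat -> nat) : Prop := forall t v, w t v < b.
Definition bw b (x : nat -> nat) : Prop := forall t, x t < b.

Definition upd (w : nat -> nat -> nat) v (x : nat -> nat) : nat -> nat -> nat :=
  fun t v' => if v' == v then x t else w t v'.

Lemma bnd_upd b w v x : bnd b w -> bw b x -> bnd b (upd w v x).
Proof. by move=> bw' bx t v'; rewrite /upd; case: ifP. Qed.

Lemma updE w v x t : upd w v x t v = x t.
Proof. by rewrite /upd eqxx. Qed.

Lemma updN w v x t v' : v' != v -> upd w v x t v' = w t v'.
Proof. by rewrite /upd => /negbTE ->. Qed.

Definition updw (u : seq (nat -> nat)) v (y : seq nat) : seq (nat -> nat) :=
  [seq (fun v' => if v' == v then p.2 else p.1 v') | p <- zip u y].

Lemma fac_upd w v x a b : fac (upd w v x) a b = updw (fac w a b) v (fac x a b).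
Proof. by rewrite /fac /updw; elim: (index_iota a b) => //= t s ->. Qed.

Lemma updw_cat u u' v y y' : size u = size y ->
  updw (u ++ u') v (y ++ y') = updw u v y ++ updw u' v y'.
Proof. by move=> e; rewrite /updw zip_cat // map_cat. Qed.

Definition congruence (T : Type) (h : seq (nat -> nat) -> T) : Prop :=
  forall u u' v v', h u = h u' -> h v = h v' -> h (u ++ v) = h (u' ++ v').

(** The two words may be cut at different positions; only the sequences of block colours have to
    agree. *)
Definition saturates b (T : Type) (h : seq (nat -> nat) -> T)
    (R : (nat -> nat -> nat) -> Prop) : Prop :=
  forall w w' c c', bnd b w -> bnd b w' -> cuts c -> cuts c' ->
    (forall i, h (fac w (c i) (c i.+1)) = h (fac w' (c' i) (c' i.+1))) ->
    R w -> R w'.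

(** Of the congruence only the bound [K] is kept; pumping bounds and the number of centres are
    computed from it. *)
Definition recog b K (R : (nat -> nat -> nat) -> Prop) : Prop :=
  exists (T : finType) (h : seq (nat -> nat) -> T),
    [/\ #|T| <= K, congruence h & saturates b h R].

Lemma recog_iff b K R R' : (forall w, bnd b w -> (R w <-> R' w)) ->
  recog b K R -> recog b K R'.
Proof.
move=> e [T [h [cT ch sh]]]; exists T, h; split=> // w w' c c' bw bw' Hc Hc' eq /(e _ bw) Rw.
by apply/(e _ bw'); apply: (sh w w' c c').
Qed.

(** Colours are multiplied by concatenating chosen preimages. Outside the image of [h] the product
    is arbitrary, so associativity can only be used on the image. *)
Lemma congruence_op (T : Type) (h : seq (nat -> nat) -> T) : congruence h ->
  exists op : T -> T -> T, forall u v, h (u ++ v) = op (h u) (h v).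
Proof.
move=> ch.
have rep t : exists u, forall u', h u' = t -> h u = t.
  have [[u Hu]|NE] := pselect (exists u, h u = t); first by exists u.
  by exists [::] => u' Hu'; case: NE; exists u'.
have [r Hr] := choice rep.
exists (fun s t => h (r s ++ r t)) => u v.
by apply: ch; apply/esym; [apply: (Hr _ u) | apply: (Hr _ v)].
Qed.

(** Saturation is symmetric in the two words, so the same congruence serves the complement. *)
Lemma recog_not b K R : recog b K R -> recog b K (fun w => ~ R w).
Proof.
move=> [T [h [cT ch sh]]]; exists T, h; split=> // w w' c c' bw bw' Hc Hc' e NR Rw'.
by apply: NR; apply: (sh w' w c' c) Rw'.
Qed.

Lemma recog_and b K K' R R' : recog b K R -> recog b K' R' ->
  recog b (K * K') (fun w => R w /\ R' w).
Proof.
move=> [T [h [cT ch sh]]] [T' [h' [cT' ch' sh']]].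
exists (T * T')%type, (fun u => (h u, h' u)); split.
- by rewrite card_prod leq_mul.
- by move=> u u' v v' [e1 e2] [e3 e4]; rewrite (ch _ _ _ _ e1 e3) (ch' _ _ _ _ e2 e4).
- move=> w w' c c' bw bw' Hc Hc' e [Rw R'w]; split.
    by apply: (sh w w' c c') => // i; have [] := e i.
  by apply: (sh' w w' c c') => // i; have [] := e i.
Qed.

Fixpoint words b n : seq (seq nat) :=
  if n is k.+1 then [seq a :: l | a <- iota 0 b, l <- words b k] else [:: [::]].

Lemma mem_words b n l : (l \in words b n) = (size l == n) && all (fun a => a < b) l.
Proof.
elim: n l => [|n IH] l; first by case: l.
apply/allpairsP/idP => [[[a l'] /= [la ll ->]]|].
  by move: la ll; rewrite mem_iota IH /= eqSS add0n => -> /andP[-> ->].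
case: l => //= a l /andP[sl /andP[la al]]; exists (a, l); split=> //=.
  by rewrite mem_iota.
by rewrite IH -eqSS sl.
Qed.

Lemma uniq_words b n : uniq (words b n).
Proof.
elim: n => //= n IH; apply: allpairs_uniq => //; first exact: iota_uniq.
by move=> [a l] [a' l'] _ _ [-> ->].
Qed.

Lemma big_words_cat b n m (F : seq nat -> nat) :
  \sum_(l <- words b (n + m)) F l =
  \sum_(l1 <- words b n) \sum_(l2 <- words b m) F (l1 ++ l2).
Proof.
elim: n F => [|n IH] F; first by rewrite /= big_seq1.
rewrite /= !big_allpairs_dep /=; apply: eq_bigr => a _.
exact: (IH (fun l => F (a :: l))).
Qed.

Lemma fac_words b x a c : bw b x -> fac x a c \in words b (c - a).
Proof. by move=> bx; rewrite mem_words size_fac eqxx; apply/all_fac. Qed.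

(** * Projection along a track *)

Section Projection.
Variables (b v : nat) (T : finType) (h : seq (nat -> nat) -> T).
Hypothesis ch : congruence h.

(** Multiplicities are kept: the existential quantifier uses only whether the number is positive,
    the counting quantifier also its residue. *)
Definition ncol u s := \sum_(l <- words b (size u)) (h (updw u v l) == s).

Lemma ncol_gt0 u s : 0 < ncol u s <->
  exists2 l, l \in words b (size u) & h (updw u v l) = s.
Proof.
rewrite /ncol lt0n sum_nat_seq_neq0; split=> [/hasP [l ll /=]|[l ll E]].
  by rewrite eqb0 negbK => /eqP E; exists l.
by apply/hasP; exists l => //=; rewrite E eqxx.
Qed.

Lemma ncol_gt0_cat u u' v1 v1' :
  (forall s, (0 < ncol u s) = (0 < ncol u' s)) ->
  (forall s, (0 < ncol v1 s) = (0 < ncol v1' s)) ->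
  forall s, 0 < ncol (u ++ v1) s -> 0 < ncol (u' ++ v1') s.
Proof.
move=> eu ev s /ncol_gt0 [l]; rewrite mem_words size_cat => /andP[/eqP sl al] E.
have [l1' ll1 E1] : exists2 l1, l1 \in words b (size u') &
    h (updw u' v l1) = h (updw u v (take (size u) l)).
  apply/ncol_gt0; rewrite -eu; apply/ncol_gt0; exists (take (size u) l) => //.
  rewrite mem_words size_take sl; apply/andP; split; first by apply/eqP; case: ltnP; lia.
  by apply/allP => a /mem_take; move: a; apply/allP.
have [l2' ll2 E2] : exists2 l2, l2 \in words b (size v1') &
    h (updw v1' v l2) = h (updw v1 v (drop (size u) l)).
  apply/ncol_gt0; rewrite -ev; apply/ncol_gt0; exists (drop (size u) l) => //.
  rewrite mem_words size_drop sl addKn eqxx.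
  by apply/allP => a /mem_drop; move: a; apply/allP.
apply/ncol_gt0; exists (l1' ++ l2').
  by move: ll1 ll2; rewrite !mem_words !size_cat all_cat => /andP[/eqP -> ->] /andP[/eqP -> ->]; rewrite eqxx.
move: ll1; rewrite mem_words => /andP[/eqP sl1 _].
rewrite updw_cat // -E -{1}(cat_take_drop (size u) l) updw_cat.
  exact: ch.
by rewrite size_takel // sl leq_addr.
Qed.

Lemma sum_words_ncol u (F : T -> nat) :
  \sum_(l <- words b (size u)) F (h (updw u v l)) = \sum_s ncol u s * F s.
Proof.
under [RHS]eq_bigr => s _ do rewrite /ncol big_distrl.
rewrite exchange_big /=; apply: eq_bigr => l _.
rewrite (bigD1 (h (updw u v l))) //= eqxx mul1n big1 ?addn0 // => s ns.
by rewrite eq_sym (negbTE ns).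
Qed.

(** A labelling of a concatenation is a pair of labellings, so the counts multiply by convolution
    over [op]; this is why residues of counts are compatible with concatenation. *)
Lemma ncol_cat op u u' s : (forall u v, h (u ++ v) = op (h u) (h v)) ->
  ncol (u ++ u') s = \sum_s1 ncol u s1 * \sum_s2 ncol u' s2 * (op s1 s2 == s).
Proof.
move=> hop.
rewrite -(sum_words_ncol _ (fun s1 => \sum_s2 ncol u' s2 * (op s1 s2 == s))).
rewrite /ncol size_cat big_words_cat big_seq [RHS]big_seq.
apply: eq_bigr => l1; rewrite mem_words => /andP[/eqP sl1 _].
rewrite -(sum_words_ncol _ (fun s2 => (op _ s2 == s) : nat)).
by apply: eq_bigr => l2 _; rewrite updw_cat ?sl1 // hop.
Qed.

(** The colours of [x] are copied on all blocks but the first, whose labelling [l'] is prescribed;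
    counting needs this freedom, as it fixes prefixes one by one. *)
Lemma lift_blocks w w' c c' x l' : cuts c -> cuts c' ->
  (forall i s, 0 < ncol (fac w (c i.+1) (c i.+2)) s ->
               0 < ncol (fac w' (c' i.+1) (c' i.+2)) s) ->
  bw b x -> l' \in words b (c' 1) ->
  exists x', [/\ bw b x', fac x' 0 (c' 1) = l' &
    forall i, h (fac (upd w v x) (c i.+1) (c i.+2)) =
              h (fac (upd w' v x') (c' i.+1) (c' i.+2))].
Proof.
move=> Hc Hc' Hn bx ll'.
have cdl i : exists l, l \in words b (c' i.+2 - c' i.+1) /\
     h (fac (upd w v x) (c i.+1) (c i.+2)) = h (updw (fac w' (c' i.+1) (c' i.+2)) v l).
  have /Hn /ncol_gt0 [l] : 0 < ncol (fac w (c i.+1) (c i.+2)) (h (fac (upd w v x) (c i.+1) (c i.+2))).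
    apply/ncol_gt0; exists (fac x (c i.+1) (c i.+2)); last by rewrite fac_upd.
    by rewrite size_fac fac_words.
  by rewrite size_fac => ll E; exists l.
have [f Hf] := choice cdl.
pose bl i := if i is j.+1 then f j else l'.
have [c0' _] := Hc'.
have sbl i : bl i \in words b (c' i.+1 - c' i).
  by case: i => [|i] /=; [rewrite c0' subn0 | case: (Hf i)].
have sbl' i : size (bl i) = c' i.+1 - c' i.
  by have := sbl i; rewrite mem_words => /andP[/eqP].
have [x' [Hx' Hv]] := glue 0 Hc' sbl'.
exists x'; split.
- move=> t; have [i [k [lk ->]]] := Hv t.
  by have := sbl i; rewrite mem_words => /andP[_ /all_nthP]; apply.
- by have := Hx' 0; rewrite c0'.
- by move=> i; have [_ ->] := Hf i; rewrite fac_upd Hx'.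
Qed.

End Projection.

Lemma recog_ex b (v : nat) K R : recog b K R ->
  recog b (2 ^ K) (fun w => exists2 x, bw b x & R (upd w v x)).
Proof.
move=> [T [h [cT ch sh]]].
exists {set T}, (fun u => [set s | 0 < ncol b v h u s]); split.
- by rewrite -cardsT -powersetT card_powerset cardsT leq_exp2l.
- move=> u u' v1 v1' /setP eu /setP ev.
  have {}eu s : (0 < ncol b v h u s) = (0 < ncol b v h u' s) by have := eu s; rewrite !inE.
  have {}ev s : (0 < ncol b v h v1 s) = (0 < ncol b v h v1' s) by have := ev s; rewrite !inE.
  by apply/setP => s; rewrite !inE; apply/idP/idP; apply: ncol_gt0_cat.
- move=> w w' c c' bw bw' Hc Hc' e [x bx Rx].
  have en i s : (0 < ncol b v h (fac w (c i) (c i.+1)) s) =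
                (0 < ncol b v h (fac w' (c' i) (c' i.+1)) s).
    by have /setP/(_ s) := e i; rewrite !inE.
  have [c0 _] := Hc; have [c0' _] := Hc'.
  have : 0 < ncol b v h (fac w (c 0) (c 1)) (h (fac (upd w v x) (c 0) (c 1))).
    apply/ncol_gt0; exists (fac x (c 0) (c 1)); last by rewrite fac_upd.
    by rewrite size_fac fac_words.
  rewrite en => /ncol_gt0 [l]; rewrite size_fac {1}c0' subn0 => ll El.
  have [|x' [bx' Hx' Hb]] := @lift_blocks b v T h w w' c c' x l Hc Hc' _ bx ll; first by move=> i s; rewrite en.
  exists x' => //; apply: (sh (upd w v x) _ c c') => //; try exact: bnd_upd.
  case=> [|i]; last exact: Hb.
  by rewrite -El [in RHS]fac_upd c0' Hx'.
Qed.

(** * Counting finite sets of solutions modulo a number *)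

Definition determined (X : (nat -> nat) -> Prop) N : Prop :=
  forall x y, X x -> X y -> fac x 0 N = fac y 0 N -> x = y.

Lemma determined_le X N M : N <= M -> determined X N -> determined X M.
Proof.
move=> lN HX x y Xx Xy E; apply: HX => //; apply: fac_ext => t lt.
by apply: (fac_inv E); lia.
Qed.

Lemma finite_determined (X : set (nat -> nat)) : finite_set X ->
  exists N, determined X N.
Proof.
move=> /finite_seqP [s ->].
have dif (p : (nat -> nat) * (nat -> nat)) : exists t, p.1 <> p.2 -> p.1 t <> p.2 t.
  have [->|ne] := eqVneq p.1 p.2; first by exists 0.
  have [t Ht] : exists t, p.1 t <> p.2 t by apply/existsNP => e; move/eqP: ne; apply; apply/funext.
  by exists t.
have [D HD] := choice dif.
exists (\max_(x <- s) \max_(y <- s) (D (x, y)).+1) => x y /= xs ys E.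
apply: contrapT => /(HD (x, y)); apply; apply: (fac_inv E) => /=.
apply: leq_trans (leq_bigmax_seq _ xs _) => //.
by apply: leq_trans (leq_bigmax_seq _ ys _).
Qed.

Lemma card_determined b (X : set (nat -> nat)) N : (forall x, X x -> bw b x) ->
  determined X N ->
  (X #= `I_(count (fun l => `[< exists2 x, X x & fac x 0 N = l >]) (words b N)))%card.
Proof.
move=> bX dX; rewrite -size_filter; set s := filter _ _.
have inS x : X x -> fac x 0 N \in s.
  move=> Xx; rewrite mem_filter; apply/andP; split; first by apply/asboolP; exists x.
  by have := fac_words 0 N (bX _ Xx); rewrite subn0.
apply/card_set_bijP; exists (fun x => index (fac x 0 N) s); split.
- by move=> x Xx /=; rewrite index_mem inS.
- move=> x y /set_mem Xx /set_mem Xy E; apply: dX => //.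
  by rewrite -(nth_index [::] (inS x Xx)) E nth_index // inS.
- move=> i /= li; have : nth [::] s i \in s by rewrite mem_nth.
  rewrite {1}mem_filter => /andP[/asboolP [x Xx E] _]; exists x => //.
  by rewrite E index_uniq // filter_uniq // uniq_words.
Qed.

Definition modcard (X : set (nat -> nat)) r m : Prop :=
  exists c, (X #= `I_c)%card /\ c = r %[mod m].

(** The first [M] blocks are merged into one. *)
Lemma cuts_shift c M : 0 < M -> cuts c -> cuts (fun i => if i is k.+1 then c (M + k) else 0).
Proof.
move=> M0 Hc; split=> // -[|i]; last by rewrite addnS; case: Hc.
by rewrite addn0; apply: leq_trans (cuts_ge _ Hc).
Qed.

Lemma congruence_prefix (T : Type) (h : seq (nat -> nat) -> T) w w' c c' i :
  congruence h -> cuts c -> cuts c' ->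
  (forall i, h (fac w (c i) (c i.+1)) = h (fac w' (c' i) (c' i.+1))) ->
  h (fac w 0 (c i)) = h (fac w' 0 (c' i)).
Proof.
move=> ch Hc Hc' e; elim: i => [|i IH]; first by rewrite (proj1 Hc) (proj1 Hc') !fac_nil.
have l1 := cuts_le Hc (leqnSn i); have l2 := cuts_le Hc' (leqnSn i).
by rewrite (fac_cat w (leq0n _) l1) (fac_cat w' (leq0n _) l2); apply: ch.
Qed.


Section ModColour.
Variables (b v m : nat) (T : finType) (h : seq (nat -> nat) -> T).
Hypotheses (ch : congruence h) (m_gt0 : 0 < m).

(** A residue does not tell whether a colour has any extension at all, so positivity is recorded
    beside it. *)
Definition modcol u : {ffun T -> 'I_m.+1 * bool} :=
  [ffun s => (inord (ncol b v h u s %% m), 0 < ncol b v h u s)].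

Lemma modcolP u u' : modcol u = modcol u' <-> forall s,
  ncol b v h u s = ncol b v h u' s %[mod m] /\
  (0 < ncol b v h u s) = (0 < ncol b v h u' s).
Proof.
split=> [/ffunP e s|e]; last first.
  by apply/ffunP => s; rewrite !ffunE; have [-> ->] := e s.
have := e s; rewrite !ffunE => -[e1 e2]; split=> //.
by have := congr1 val e1; rewrite /= !inordK // ltnW // ltnS ltn_pmod.
Qed.

Lemma modcol_congruence : congruence modcol.
Proof.
have [op hop] := congruence_op ch.
move=> u u' v1 v1' /modcolP eu /modcolP ev; apply/modcolP => s; split.
  rewrite !(ncol_cat _ _ _ _ _ hop).
  rewrite -modn_summ -[in RHS]modn_summ; congr (_ %% m); apply: eq_bigr => s1 _.
  rewrite -modnMm -[in RHS]modnMm; congr (_ * _ %% m); first by case: (eu s1).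
  rewrite -modn_summ -[in RHS]modn_summ; congr (_ %% m); apply: eq_bigr => s2 _.
  by rewrite -modnMml -[in RHS]modnMml; case: (ev s2) => ->.
by apply/idP/idP; apply: ncol_gt0_cat => // s'; [case: (eu s')|case: (ev s')|case: (eu s')|case: (ev s')].
Qed.

End ModColour.

(* For a finite set of solutions, all of them branch before some cut; the
   number of solutions is then a sum over the colours [s] of the prefix of the
   number of prefixes of colour [s], restricted to the extendable colours. *)
Lemma recog_mod b (v r m : nat) K R : 0 < m -> recog b K R ->
  (forall w, bnd b w -> finite_set [set x | bw b x /\ R (upd w v x)]%classic) ->
  recog b ((2 * m.+1) ^ K) (fun w => modcard [set x | bw b x /\ R (upd w v x)]%classic r m).
Proof.
move=> m0 [T [h [cT ch sh]]] fR.
exists {ffun T -> 'I_m.+1 * bool}, (modcol b v m h); split.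
- by rewrite card_ffun card_prod card_ord card_bool mulnC leq_exp2l //; lia.
- exact: modcol_congruence.
move=> w w' c c' bdw bdw' Hc Hc' e [n [Xn nr]].
have [N1 d1] := finite_determined (fR w bdw).
have [N2 d2] := finite_determined (fR w' bdw').
set X := [set x | _]%classic in Xn d1; set X' := [set x | _]%classic in d2 *.
(* From the [M]-th cut on, the solutions over either word are told apart by their prefixes. The
   successor makes [M] positive, as merging the first blocks requires. *)
pose M := (maxn N1 N2).+1.
have dX : determined X (c M) by apply: determined_le d1; have := cuts_ge M Hc; lia.
have dX' : determined X' (c' M) by apply: determined_le d2; have := cuts_ge M Hc'; lia.
have /(modcolP _ _ _ m0) eM := congruence_prefix M (modcol_congruence ch m0) Hc Hc' e.
have transfer w1 c1 w2 c2 x l : bnd b w1 -> bnd b w2 -> cuts c1 -> cuts c2 ->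
    (forall i s, 0 < ncol b v h (fac w1 (c1 i) (c1 i.+1)) s ->
                 0 < ncol b v h (fac w2 (c2 i) (c2 i.+1)) s) ->
    bw b x -> R (upd w1 v x) -> l \in words b (c2 M) ->
    h (updw (fac w2 0 (c2 M)) v l) = h (updw (fac w1 0 (c1 M)) v (fac x 0 (c1 M))) ->
    exists2 x', bw b x' /\ R (upd w2 v x') & fac x' 0 (c2 M) = l.
  move=> bd1 bd2 Hc1 Hc2 Hn bx Rx ll El.
  have Hs1 := cuts_shift (ltn0Sn _ : 0 < M) Hc1.
  have Hs2 := cuts_shift (ltn0Sn _ : 0 < M) Hc2.
  have [||x' [bx' Hx' Hb]] := @lift_blocks b v T h w1 w2 _ _ x l Hs1 Hs2 _ bx _.
  - by move=> i s; rewrite !addnS; apply: Hn.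
  - by rewrite addn0.
  rewrite addn0 in Hx'; exists x' => //; split=> //.
  apply: (sh (upd w1 v x) _ _ _ _ _ Hs1 Hs2) => //; try exact: bnd_upd.
  by case=> [|i]; [rewrite !addn0 !fac_upd Hx' El | apply: Hb].
have en i s : (0 < ncol b v h (fac w (c i) (c i.+1)) s) =
              (0 < ncol b v h (fac w' (c' i) (c' i.+1)) s).
  by have /(modcolP _ _ _ m0)/(_ s) [] := e i.
(* By [transfer], whether a prefix extends to a solution depends only on its colour; [D] is the
   indicator of the extendable colours. *)
pose D w0 (c0 : nat -> nat) s : nat := `[< exists2 x, bw b x /\ R (upd w0 v x) &
      h (updw (fac w0 0 (c0 M)) v (fac x 0 (c0 M))) = s >].
have cnt w0 c0 : bnd b w0 -> cuts c0 ->
    count (fun l => `[< exists2 x, bw b x /\ R (upd w0 v x) & fac x 0 (c0 M) = l >])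
      (words b (c0 M)) = \sum_s ncol b v h (fac w0 0 (c0 M)) s * D w0 c0 s.
  move=> bd0 Hc0; rewrite -sum_words_ncol size_fac subn0 -sum1_count big_mkcond /=.
  rewrite big_seq [RHS]big_seq; apply: eq_bigr => l ll.
  have -> : D w0 c0 (h (updw (fac w0 0 (c0 M)) v l)) =
      `[< exists2 x, bw b x /\ R (upd w0 v x) & fac x 0 (c0 M) = l >].
    congr nat_of_bool; apply/asboolP/asboolP => [[x [bx Rx] El]|[x [bx Rx] <-]].
      exact: (transfer w0 c0 w0 c0 x).
    by exists x.
  by case: ifP.
have DD w1 c1 w2 c2 s : bnd b w1 -> bnd b w2 -> cuts c1 -> cuts c2 ->
    (forall i s, 0 < ncol b v h (fac w1 (c1 i) (c1 i.+1)) s ->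
                 0 < ncol b v h (fac w2 (c2 i) (c2 i.+1)) s) ->
    (0 < ncol b v h (fac w1 0 (c1 M)) s -> 0 < ncol b v h (fac w2 0 (c2 M)) s) ->
    D w1 c1 s <= D w2 c2 s.
  move=> bd1 bd2 Hc1 Hc2 Hn Hp; rewrite /D.
  case: asboolP => // -[x [bx Rx] E].
  have /Hp /ncol_gt0 [l] : 0 < ncol b v h (fac w1 0 (c1 M)) s.
    by apply/ncol_gt0; exists (fac x 0 (c1 M)); rewrite ?size_fac // fac_words.
  rewrite size_fac subn0 => ll El.
  have [|x' [bx' Rx'] Ex'] := transfer w1 c1 w2 c2 x l bd1 bd2 Hc1 Hc2 Hn bx Rx ll.
    by rewrite El E.
  by case: asboolP => // -[]; exists x'; rewrite // Ex' El.
have De s : D w c s = D w' c' s.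
  have [_ ep] := eM s.
  apply/eqP; rewrite eqn_leq !DD //; try by rewrite ep.
    by move=> i s'; rewrite en.
  by move=> i s'; rewrite en.
have bX x : X x -> bw b x by case.
have bX' x : X' x -> bw b x by case.
exists (count (fun l => `[< exists2 x, X' x & fac x 0 (c' M) = l >]) (words b (c' M))).
split; first exact: card_determined.
have /card_eq_II nE : (`I_n #= `I_(count (fun l => `[< exists2 x, X x & fac x 0 (c M) = l >]) (words b (c M))))%card.
  by apply: card_eq_trans (card_determined bX dX); rewrite card_eq_sym.
rewrite -nr nE !cnt // -modn_summ -[in RHS]modn_summ; congr (_ %% m).
apply: eq_bigr => s _; rewrite De -modnMml -[in RHS]modnMml.
by case: (eM s) => ->.
Qed.

(** * Atomic relations *)

Lemma recog_loc b K (P : pred (nat -> nat)) : 2 <= K ->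
  recog b K (fun w => forall t, P (w t)).
Proof.
move=> lK; exists bool, (all P); split; first by rewrite card_bool.
  by move=> u u' v v'; rewrite !all_cat => -> ->.
move=> w w' c c' _ _ Hc Hc' e Pw t.
have : all P (fac w (c (cut_idx c' t)) (c (cut_idx c' t).+1)).
  by apply/all_fac => s _; apply: Pw.
by rewrite e => /all_fac; apply; apply: cut_idxP.
Qed.

(** The empty block needs a colour of its own, since prepending it must not hide the first letter of
    what follows. *)
Lemma recog_first b K (P : pred (nat -> nat)) : 3 <= K ->
  recog b K (fun w => P (w 0)).
Proof.
move=> lK.
exists (option bool), (fun u => if u is a :: _ then Some (P a) else None); split.
- by rewrite card_option card_bool.
- by move=> [|a u] [|a' u'] [|d v] [|d' v'] //=.
- move=> w w' c c' _ _ [c0 Hc] [c0' Hc'] e; have := e 0; rewrite c0 c0'.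
  have := Hc 0; have := Hc' 0; rewrite c0 c0' => l1 l2.
  rewrite (@fac_cat _ w 0 1) // (@fac_cat _ w' 0 1) //.
  by rewrite !fac1 /= => -[->].
Qed.

Lemma recog_inf b K (P : pred (nat -> nat)) : 2 <= K ->
  recog b K (fun w => inf_often (fun t => P (w t))).
Proof.
move=> lK; exists bool, (has P); split; first by rewrite card_bool.
  by move=> u u' v v'; rewrite !has_cat => -> ->.
move=> w w' c c' _ _ Hc Hc' e Pw n.
have [m lm Pm] := Pw (c n).
have : has P (fac w (c (cut_idx c m)) (c (cut_idx c m).+1)).
  by apply/has_fac; exists m => //; apply: cut_idxP.
rewrite e => /has_fac [t lt Pt]; exists t => //.
have ln : n <= cut_idx c m.
  rewrite leqNgt; apply/negP => /(cuts_le Hc) l.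
  by have := cut_idxP m Hc; lia.
by have := cuts_ge n Hc'; have := cuts_le Hc' ln; lia.
Qed.

(** The colour of a nonempty block records whether the condition holds inside it and the two letters
    that take part in conditions across its borders. *)
Lemma recog_shift b K v1 v2 : (2 * b.+1 ^ 2).+1 <= K ->
  recog b K (fun w => forall t, w t v2 = w t.+1 v1).
Proof.
move=> lK.
pose cl (n : nat) : 'I_b.+1 := inord n.
pose E (a a' : nat -> nat) := cl (a v2) == cl (a' v1).
pose h (u : seq (nat -> nat)) : option (bool * ('I_b.+1 * 'I_b.+1)) :=
  if u is a :: s then Some (path E a s, (cl (a v1), cl (last a s v2))) else None.
have ch : congruence h.
  move=> [|a u] [|a' u'] [|d v] [|d' v'] //=; rewrite ?cats0 //.
  move=> [e1 e2 e3] [e4 e5 e6]; rewrite /h /= !cat_path !last_cat /= e1 e2 e4 e6.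
  by rewrite /E e3 e5.
exists (option (bool * ('I_b.+1 * 'I_b.+1)))%type, h; split=> //.
  by rewrite card_option !card_prod card_bool card_ord mulnn.
move=> w w' c c' bdw bdw' Hc Hc' e Rw t.
(* The condition at [t] involves [t] and [t.+1], both before the cut number [t.+2]; comparing whole
   prefixes also covers pairs that straddle a cut. *)
have := congruence_prefix t.+2 ch Hc Hc' e.
have := cuts_ge t.+2 Hc'; have := cuts_ge t.+2 Hc => l1 l2.
have : sorted E (fac w 0 (c t.+2)).
  apply/(sortedP (fun _ => 0)) => i; rewrite size_fac => li.
  by rewrite !nth_fac ?add0n /E ?Rw //; lia.
have : sorted E (fac w' 0 (c' t.+2)) -> w' t v2 = w' t.+1 v1.
  move/(sortedP (fun _ => 0)) => /(_ t); rewrite size_fac => /(_ ltac:(lia)).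
  rewrite !nth_fac ?add0n; try lia.
  by move=> /eqP /(congr1 val) /=; rewrite !inordK // ltnS ltnW.
case: (fac w 0 _) (size_fac w 0 (c t.+2)) => [|a u]; first by rewrite /=; lia.
move=> _; case: (fac w' 0 _) (size_fac w' 0 (c' t.+2)) => [|a' u'] //=.
by rewrite /h => _ H p [p' _ _]; apply: H; rewrite -p'.
Qed.

(** * Recognisable equivalences with countably many classes *)

Definition tail_eq (x y : nat -> nat) : Prop := exists n, forall t, n <= t -> x t = y t.

(** The number, in heap order with root 1, of the node at depth [n] on the branch [a] of the binary
    tree. *)
Fixpoint heap (a : nat -> bool) n : nat := if n is k.+1 then (heap a k).*2 + a k else 1.

Lemma heap_bounds a n : 2 ^ n <= heap a n < 2 ^ n.+1.
Proof. by elim: n => //= n; rewrite !expnS; case: (a n); lia. Qed.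

(** The set of nodes of a branch. Doubling leaves a free position between any two nodes; it will
    supply the factor [e] between the colours read at them. *)
Definition heap_code a k : bool := `[< exists n, k = (heap a n).*2.+1 >].

Lemma heap_eq a a' d : (forall i, i < d -> a i = a' i) ->
  forall n, n <= d -> heap a n = heap a' n.
Proof.
move=> e; elim=> [//|n IH] ln /=; rewrite IH ?e //; exact: ltnW.
Qed.

Section HeapPair.
Variables (a a' : nat -> bool) (d : nat).
Hypotheses (e : forall i, i < d -> a i = a' i) (ad : a d = false) (ad' : a' d = true).

Definition hl i := heap a (d.+1 + i).
Definition hr i := heap a' (d.+1 + i).

(** Below the split the left branch stays to the left on every level. As deeper levels carry larger
    numbers, the nodes of the two branches then alternate. *)
Lemma hl_hr i : hl i < hr i.
Proof.
rewrite /hl /hr; elim: i => [|i IH].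
  by rewrite addn0 /= ad ad' (heap_eq e) //; lia.
rewrite !addnS [heap a _]/= [heap a' _]/=.
by have := leq_b1 (a (d.+1 + i)); move: IH; rewrite /=; lia.
Qed.

Lemma hr_hl i : hr i < hl i.+1.
Proof.
have := heap_bounds a (d.+1 + i.+1); have := heap_bounds a' (d.+1 + i).
by rewrite /hl /hr addnS; lia.
Qed.

Lemma hl_mono i j : i <= j -> hl i <= hl j.
Proof.
elim: j => [|j IH]; first by rewrite leqn0 => /eqP ->.
rewrite leq_eqVlt => /predU1P[->//|/IH l]; have := hl_hr j; have := hr_hl j; lia.
Qed.

Lemma hr_mono i j : i <= j -> hr i <= hr j.
Proof.
elim: j => [|j IH]; first by rewrite leqn0 => /eqP ->.
rewrite leq_eqVlt => /predU1P[->//|/IH l]; have := hl_hr j.+1; have := hr_hl j; lia.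
Qed.

Lemma heap_code_eq k : (forall i, k <> (hl i).*2.+1) -> (forall i, k <> (hr i).*2.+1) ->
  heap_code a k = heap_code a' k.
Proof.
move=> nl nr; apply/asboolP/asboolP => -[n E]; exists n.
  case: (leqP n d) => l; first by rewrite -(heap_eq e).
  by case: (nl (n - d.+1)); rewrite /hl subnKC.
case: (leqP n d) => l; first by rewrite (heap_eq e).
by case: (nr (n - d.+1)); rewrite /hr subnKC.
Qed.

Lemma heap_code_hl i : heap_code a (hl i).*2.+1 = true /\ heap_code a' (hl i).*2.+1 = false.
Proof.
split; first by apply/asboolP; exists (d.+1 + i).
apply/asboolP => -[n E]; have {}E : hl i = heap a' n by lia.
case: (leqP n d) => l.
  have := heap_bounds a' n; have := heap_bounds a (d.+1 + i).
  have : 2 ^ n.+1 <= 2 ^ (d.+1 + i) by rewrite leq_exp2l //; lia.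
  by rewrite -/(hl i); lia.
have : heap a' n = hr (n - d.+1) by rewrite /hr subnKC.
case: (leqP i (n - d.+1)) => l' E'.
  by have := hl_hr i; have := hr_mono l'; lia.
have := hr_hl (n - d.+1); have := hl_mono l'; lia.
Qed.

Lemma heap_code_hr i : heap_code a (hr i).*2.+1 = false /\ heap_code a' (hr i).*2.+1 = true.
Proof.
split; last by apply/asboolP; exists (d.+1 + i).
apply/asboolP => -[n E]; have {}E : hr i = heap a n by lia.
case: (leqP n d) => l.
  have := heap_bounds a n; have := heap_bounds a' (d.+1 + i).
  have : 2 ^ n.+1 <= 2 ^ (d.+1 + i) by rewrite leq_exp2l //; lia.
  by rewrite -/(hr i); lia.
have : heap a n = hl (n - d.+1) by rewrite /hl subnKC.
case: (leqP (n - d.+1) i) => l' E'.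
  by have := hl_hr i; have := hl_mono l'; lia.
have := hr_hl i; have := hl_mono l'; lia.
Qed.

End HeapPair.

Lemma first_difference (a a' : nat -> bool) : a <> a' ->
  exists d, (forall i, i < d -> a i = a' i) /\ a d <> a' d.
Proof.
move=> ne.
have ex : exists d, a d != a' d.
  have [i Hi] : exists i, a i <> a' i by apply/existsNP => e; apply: ne; apply/funext.
  by exists i; apply/eqP.
case: (ex_minnP ex) => d /eqP nd dmin; exists d; split=> // i li.
by apply/eqP; apply: contraT => /dmin; lia.
Qed.

Lemma cantor_bool (k : (nat -> bool) -> nat) : ~ injective k.
Proof.
move=> inj; pose diag n := ~~ `[< exists a, k a = n /\ a n >].
have : diag (k diag) = ~~ diag (k diag).
  rewrite {1}/diag; congr negb; apply/asboolP/idP => [[a [/inj -> //]]|H].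
  by exists diag.
by case: (diag _).
Qed.

(** * Mixing two words block by block *)

Section Mix.
Variables (b : nat) (T : finType) (h : seq (nat -> nat) -> T) (R : (nat -> nat -> nat) -> Prop).
Variables (w : nat -> nat -> nat) (vx vy : nat).
Hypotheses (ch : congruence h) (sh : saturates b h R) (bdw : bnd b w).

Definition pairenv x y := upd (upd w vx x) vy y.
Definition pairrel x y : Prop := R (pairenv x y).

Hypothesis Esym : forall x y, bw b x -> bw b y -> pairrel x y -> pairrel y x.
Hypothesis Etrans : forall x y z, bw b x -> bw b y -> bw b z ->
  pairrel x y -> pairrel y z -> pairrel x z.

Variables (x y : nat -> nat) (n : nat -> nat) (e f g : T).
Hypotheses (bx : bw b x) (by_ : bw b y) (n_lt : forall i, n i < n i.+1).
Let pcol u v i j := h (fac (pairenv u v) i j).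
Hypotheses (cxx : forall i j, i < j -> pcol x x (n i) (n j) = e)
           (cyy : forall i j, i < j -> pcol y y (n i) (n j) = e)
           (cxy : forall i j, i < j -> pcol x y (n i) (n j) = f)
           (cyx : forall i j, i < j -> pcol y x (n i) (n j) = g).
Hypothesis Eyy : pairrel y y.
Hypothesis count_classes : exists rho : nat -> nat -> nat,
  (forall k, bw b (rho k)) /\ forall z, bw b z -> pairrel z z -> exists k, pairrel (rho k) z.
Hypothesis no_tail : forall z, bw b z -> pairrel y z -> ~ tail_eq z x.

Let nc i := n i - n 0.

Let n_le i j : i <= j -> n i <= n j.
Proof.
elim: j => [|j IH]; first by rewrite leqn0 => /eqP ->.
rewrite leq_eqVlt => /predU1P[->//|/IH l]; exact: leq_trans l (ltnW (n_lt j)).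
Qed.

Let cuts_nc : cuts nc.
Proof.
by split=> [|i]; rewrite /nc ?subnn //; have := n_lt i; have := n_le (leq0n i); lia.
Qed.

(** All mixtures share the prefix of [y] before [n 0]; afterwards [be] selects [y] (true) or [x]
    (false) on each block of the homogeneous factorisation. *)
Definition mix (be : nat -> bool) t :=
  if t < n 0 then y t else if be (cut_idx nc (t - n 0)) then y t else x t.

Let bmix be : bw b (mix be).
Proof. by move=> t; rewrite /mix; case: ifP => // _; case: ifP. Qed.

Let mixE be k t : n k <= t < n k.+1 -> mix be t = if be k then y t else x t.
Proof.
move=> lt; have l0 := n_le (leq0n k); rewrite /mix ifN; last by lia.
by rewrite (@cut_idx_uniq nc _ k) // /nc; lia.
Qed.

Let cl (p q : bool) : T := if p then if q then e else g else if q then f else e.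

Let pcol_ext u v u' v' i j : (forall t, i <= t < j -> u t = u' t /\ v t = v' t) ->
  pcol u v i j = pcol u' v' i j.
Proof.
move=> E; rewrite /pcol; congr h; apply: fac_ext => t /E [E1 E2].
by apply/funext => v0; rewrite /pairenv /upd E1 E2.
Qed.

Let hh be ga i j := pcol (mix be) (mix ga) (n i) (n j).

Let hh1 be ga i : hh be ga i i.+1 = cl (be i) (ga i).
Proof.
rewrite /hh (@pcol_ext _ _ (if be i then y else x) (if ga i then y else x)).
  by rewrite /cl; case: (be i); case: (ga i); rewrite ?cxx ?cyy ?cxy ?cyx.
by move=> t lt; rewrite !(mixE _ lt); case: (be i); case: (ga i).
Qed.

Variable op : T -> T -> T.
Hypothesis hop : forall u v, h (u ++ v) = op (h u) (h v).

Let hh_cat be ga i j k : i <= j -> j <= k -> hh be ga i k = op (hh be ga i j) (hh be ga j k).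
Proof. by move=> l1 l2; rewrite /hh /pcol (fac_cat _ (n_le l1) (n_le l2)) hop. Qed.

Let hhS be ga i j : i <= j -> hh be ga i j.+1 = op (hh be ga i j) (cl (be j) (ga j)).
Proof. by move=> l; rewrite (hh_cat _ _ l (leqnSn j)) hh1. Qed.

Let pcol_cat u v i j k : i <= j -> j <= k -> pcol u v i k = op (pcol u v i j) (pcol u v j k).
Proof. by move=> l1 l2; rewrite /pcol (fac_cat _ l1 l2) hop. Qed.

(** In a homogeneous factorisation two consecutive blocks and their union have the same colour. *)
Let idem p q : op (cl p q) (cl p q) = cl p q.
Proof.
have l1 := n_le (leqnSn 0); have l2 := n_le (leqnSn 1).
rewrite /cl; case: p; case: q.
- by have := pcol_cat y y l1 l2; rewrite !cyy.
- by have := pcol_cat y x l1 l2; rewrite !cyx.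
- by have := pcol_cat x y l1 l2; rewrite !cxy.
- by have := pcol_cat x x l1 l2; rewrite !cxx.
Qed.

Let hh_const be ga i j q : i < j -> op q q = q ->
  (forall k, i <= k < j -> cl (be k) (ga k) = q) -> hh be ga i j = q.
Proof.
move=> + Hq; elim: j => // j IH; rewrite ltnS leq_eqVlt => /predU1P[<-|lij] H.
  by rewrite hh1; apply: H; rewrite leqnn ltnSn.
rewrite hhS; last exact: ltnW.
rewrite IH // => [|k lk]; last by apply: H; lia.
by rewrite H // leqnn andbT ltnW.
Qed.

Let ee : op e e = e := idem true true.

Let hh_e be ga i j : i < j -> (forall k, i <= k < j -> be k = ga k) -> hh be ga i j = e.
Proof.
by move=> l H; apply: hh_const => // k /H ->; rewrite /cl; case: (ga k).
Qed.

(** Saturation for mixtures: the cuts count blocks, and the common prefix before [n 0] is absorbed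
    into the first block. *)
Let transfer be ga be' ga' c c' q : cuts c -> cuts c' ->
  (forall i, hh be ga (c i) (c i.+1) = q) ->
  (forall i, hh be' ga' (c' i) (c' i.+1) = q) ->
  pairrel (mix be) (mix ga) -> pairrel (mix be') (mix ga').
Proof.
move=> Hc Hc' H H'.
have cC d : cuts d -> cuts (fun i => if i is k.+1 then n (d k.+1) else 0).
  move=> Hd; split=> // -[|i].
    by have := cuts_lt Hd (ltnSn 0); rewrite (proj1 Hd); case: (d 1) => // k _; apply: leq_ltn_trans (n_lt k).
  have := cuts_lt Hd (ltnSn i.+1); case: (d i.+2) => // k; rewrite ltnS => /n_le l.
  exact: leq_ltn_trans (n_lt k).
apply: (sh _ _ (cC _ Hc) (cC _ Hc')); try by apply: bnd_upd => //; apply: bnd_upd.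
case=> [|i]; last by rewrite [LHS](H i.+1) [RHS](H' i.+1).
have first_block be0 ga0 d : cuts d -> hh be0 ga0 (d 0) (d 1) = q ->
    h (fac (pairenv (mix be0) (mix ga0)) 0 (n (d 1))) = op (pcol y y 0 (n 0)) q.
  rewrite /= => Hd; rewrite (proj1 Hd) => Hq; rewrite [LHS](pcol_cat _ _ (leq0n _) (n_le (leq0n (d 1)))).
  rewrite -/(hh be0 ga0 0 (d 1)) Hq; congr op.
  by apply: pcol_ext => t /= lt; rewrite /mix lt.
by rewrite !first_block.
Qed.

Let all1 (k : nat) := true.
Let first1 (k : nat) := k == 0.
Let alt1 (k : nat) := ~~ odd k.

Let mix_all1 : mix all1 = y.
Proof. by apply/funext => t; rewrite /mix /=; case: ifP. Qed.

(** [mix first1] agrees with [x] from [n 1] on, and [mix all1] is [y], so this is what [no_tail]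
    excludes. *)
Let not_first : ~ pairrel (mix first1) (mix all1).
Proof.
move/Esym => /(_ (bmix _) (bmix _)); rewrite mix_all1 => /no_tail; apply=> //.
exists (n 1) => t lt; rewrite /mix ifN; last by have := n_lt 0; lia.
case: ifP => // /eqP E; have := cut_idxP (t - n 0) cuts_nc.
by rewrite E /nc subnn; have := n_lt 0; lia.
Qed.

Let cuts_mul k : 0 < k -> cuts (fun i => i * k).
Proof. by move=> k0; split=> // i; rewrite mulSn; lia. Qed.

Let alt_blocks i : hh alt1 all1 (i * 2) (i.+1 * 2) = op e f.
Proof.
rewrite mulSn addnC addn2 hhS // hh1 /all1 /alt1 /=.
by rewrite (_ : odd (i * 2) = false) //; lia.
Qed.

Let hh2 be ga k : hh be ga k k.+2 = op (cl (be k) (ga k)) (cl (be k.+1) (ga k.+1)).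
Proof. by rewrite hhS ?hh1. Qed.

Let hh3 be ga k : hh be ga k k.+3 =
  op (op (cl (be k) (ga k)) (cl (be k.+1) (ga k.+1))) (cl (be k.+2) (ga k.+2)).
Proof. by rewrite hhS ?hh2 //; lia. Qed.

Let hh5 be ga k : hh be ga k k.+4.+1 =
  op (op (op (op (cl (be k) (ga k)) (cl (be k.+1) (ga k.+1))) (cl (be k.+2) (ga k.+2)))
     (cl (be k.+3) (ga k.+3))) (cl (be k.+4) (ga k.+4)).
Proof. by do 2!(rewrite hhS; last by lia); rewrite hh3. Qed.

(** Like the pair ([alt1], [all1]), the pair ([first1], [alt1]) factors into blocks of colour
    [op e f]. If the former were related, the latter would be too, and transitivity would relate
    [first1] to [all1]. *)
Let not_alt : ~ pairrel (mix alt1) (mix all1).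
Proof.
move=> H; apply: not_first; apply: Etrans (H) => //.
(* The first block has length 3 and reads e e f; the later ones have length 2 and read e f. *)
have Hc : cuts (fun i => if i is k.+1 then k.+1.*2.+1 else 0) by split=> // -[|i]; lia.
apply: (transfer (cuts_mul (isT : 0 < 2)) Hc alt_blocks _ H).
case=> [|i]; first by rewrite hh3 /cl /= ee.
rewrite (_ : i.+2.*2.+1 = i.+1.*2.+1.+2); last by lia.
by rewrite hh2 /first1 /alt1 /cl /= odd_double.
Qed.

Let img s := exists u, h u = s.
Let opA s t r : img s -> img t -> img r -> op (op s t) r = op s (op t r).
Proof. by move=> [u <-] [v <-] [z <-]; rewrite -!hop catA. Qed.
Let img_op s t : img s -> img t -> img (op s t).
Proof. by move=> [u <-] [v <-]; exists (u ++ v). Qed.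
Let ie : img e. Proof. by rewrite -(cxx (ltnSn 0)); eexists. Qed.
Let ig : img g. Proof. by rewrite -(cyx (ltnSn 0)); eexists. Qed.

(** Chosen so that in one period the pair ([c5], [b5]) reads e g g e f and ([c5], [d5]) reads e g e
    e f, both with product e g e f, while ([b5], [d5]) reads e e f e e and regroups into blocks e
    f. *)
Let b5 (k : nat) := k %% 5 == 4.
Let c5 (k : nat) := (k %% 5 == 1) || (k %% 5 == 2).
Let d5 (k : nat) := (k %% 5 == 2) || (k %% 5 == 4).

Let egef : T := op (op (op e g) e) f.

Let res5 i : [/\ (i * 5) %% 5 = 0, (i * 5).+1 %% 5 = 1, (i * 5).+2 %% 5 = 2,
  (i * 5).+3 %% 5 = 3 & (i * 5).+4 %% 5 = 4].
Proof. by split; lia. Qed.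

Let cb_blocks i : hh c5 b5 (i * 5) (i.+1 * 5) = egef.
Proof.
rewrite (_ : i.+1 * 5 = (i * 5).+4.+1); last by lia.
rewrite hh5 /c5 /b5; have [-> -> -> -> ->] := res5 i; rewrite /cl /= /egef.
by rewrite (opA ie ig ig) (idem true false).
Qed.

Let cd_blocks i : hh c5 d5 (i * 5) (i.+1 * 5) = egef.
Proof.
rewrite (_ : i.+1 * 5 = (i * 5).+4.+1); last by lia.
rewrite hh5 /c5 /d5; have [-> -> -> -> ->] := res5 i; rewrite /cl /= /egef.
by rewrite (opA (img_op ie ig) ie ie) ee.
Qed.

(** Otherwise [c5] would also be related to [d5], hence [b5] to [d5]; that pair has the block
    colours of ([alt1], [all1]). *)
Let not_cb : ~ pairrel (mix c5) (mix b5).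
Proof.
move=> H; have H1 : pairrel (mix b5) (mix c5) by apply: Esym.
have Hm := cuts_mul (isT : 0 < 5).
have H2 : pairrel (mix c5) (mix d5) by apply: (transfer (q := egef) Hm Hm _ _ H) => i; [apply: cb_blocks | apply: cd_blocks].
have H3 : pairrel (mix b5) (mix d5) by apply: Etrans H1 H2.
apply: not_alt.
have Hc : cuts (fun i => if i is k.+1 then (k * 5).+3 else 0) by split=> // -[|i]; lia.
apply: (transfer Hc (cuts_mul (isT : 0 < 2)) _ alt_blocks H3).
case=> [|i]; first by rewrite hh3 /cl /= ee.
rewrite (_ : (i.+1 * 5).+3 = (i * 5).+3.+4.+1); last by lia.
rewrite hh5 /b5 /d5.
have [_ _ _ -> ->] := res5 i; have [] := res5 i.+1.
rewrite (_ : i.+1 * 5 = (i * 5).+4.+1); last by lia.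
by move=> -> -> -> _ _; rewrite /cl /= !ee.
Qed.

(** The pair reads g at the nodes of the left branch after the split, f at those of the right one,
    and e elsewhere. Since these nodes alternate, it factors into blocks e g e f, the colours of
    ([c5], [b5]). *)
Let not_heap a a' : a <> a' -> ~ pairrel (mix (heap_code a)) (mix (heap_code a')).
Proof.
move=> /first_difference [d [Hd nd]].
wlog ad : a a' Hd nd / a d = false.
  move=> W; case ad : (a d); last exact: W.
  move=> /Esym H; apply: (W a' a _ _ _ (H (bmix _) (bmix _))).
  - by move=> i /Hd ->.
  - exact/nesym.
  - by move: nd; rewrite ad; case: (a' d).
have ad' : a' d = true by move: nd; rewrite ad; case: (a' d).
have lr := hl_hr Hd ad ad'; have rl := hr_hl ad ad'.
have lm := hl_mono Hd ad ad'; have rm := hr_mono Hd ad ad'.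
(* Each block ends just after a node of the right branch and contains exactly one node of the left
   branch below the split. *)
pose c i := if i is k.+1 then (hr a' d k).*2.+2 else 0.
have Hc : cuts c.
  by split=> // -[|i] //=; have := lr i.+1; have := rl i; lia.
move=> H; apply: not_cb; apply: (transfer Hc (cuts_mul (isT : 0 < 5)) _ cb_blocks H) => i.
have l1 : c i < (hl a d i).*2.+1 by case: i => //= i; have := rl i; lia.
have l2 : (hl a d i).*2.+2 < (hr a' d i).*2.+1 by have := lr i; lia.
rewrite [c i.+1]/= hhS; last by lia.
rewrite (@hh_cat _ _ _ (hl a d i).*2.+2); [|by lia..].
rewrite hhS; last by lia.
have [-> ->] := heap_code_hl Hd ad ad' i; have [-> ->] := heap_code_hr Hd ad ad' i.
rewrite !hh_e //.
- move=> k lk; apply: (heap_code_eq Hd) => j E.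
    case: (leqP j i) => lj; first by have := lm _ _ lj; lia.
    by have := rm _ _ (ltnW lj); have := rl i; have := lm _ _ lj; lia.
  case: (leqP i j) => lj; first by have := rm _ _ lj; lia.
  by have := rl j; have := lm _ _ lj; lia.
- move=> k lk; apply: (heap_code_eq Hd) => j E.
    case: (leqP i j) => lj; first by have := lm _ _ lj; lia.
    case: i lj lk l1 l2 => // i; rewrite ltnS => lj /= lk l1 l2.
    by have := lr j; have := rm _ _ lj; lia.
  case: (leqP i j) => lj; first by have := rm _ _ lj; have := lr i; lia.
  case: i lj lk l1 l2 => // i; rewrite ltnS => lj /= lk l1 l2.
  by have := rm _ _ lj; lia.
Qed.

(** Each mixture is related to itself, all diagonal blocks having colour [e]; mapping a branch to an
    index of its class would inject the branches into [nat]. *)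
Lemma mix_absurd : False.
Proof.
have self a : pairrel (mix (heap_code a)) (mix (heap_code a)).
  have H1 := cuts_mul (isT : 0 < 1).
  have H : pairrel (mix all1) (mix all1) by rewrite mix_all1.
  by apply: (transfer (q := e) H1 H1 _ _ H) => i; apply: hh_e => //; lia.
have [rho [brho Hrho]] := count_classes.
have ex a : exists k, pairrel (rho k) (mix (heap_code a)) by apply: Hrho.
have [k Hk] := choice ex; apply: (@cantor_bool k) => a a' E.
apply: contrapT => /not_heap; apply; apply: (@Etrans _ (rho (k a))) => //.
  exact: Esym.
by rewrite E.
Qed.

End Mix.

(** [E] is only a partial equivalence: [E x x] will mean that [x] names an element of the set under
    consideration. *)
Theorem countable_tails b K R w vx vy : recog b K R -> bnd b w ->
  let E x y := R (upd (upd w vx x) vy y) in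
  (forall x y, bw b x -> bw b y -> E x y -> E y x) ->
  (forall x y z, bw b x -> bw b y -> bw b z -> E x y -> E y z -> E x z) ->
  (exists rho : nat -> nat -> nat, (forall k, bw b (rho k)) /\
     forall z, bw b z -> E z z -> exists k, E (rho k) z) ->
  exists zs : seq (nat -> nat), [/\ size zs <= K, forall z, z \in zs -> bw b z &
    forall x, bw b x -> E x x -> exists y, [/\ bw b y, E x y &
      exists2 z, z \in zs & tail_eq y z]].
Proof.
move=> [T [h [cT ch sh]]] bdw E Es Et Ec; apply: contrapT => NE.
have ex (zs : seq (nat -> nat)) : exists x, size zs <= K -> (forall z, z \in zs -> bw b z) ->
    [/\ bw b x, E x x & forall y, bw b y -> E x y -> forall z, z \in zs -> ~ tail_eq y z].
  have [[sz bz]|N] := pselect (size zs <= K /\ forall z, z \in zs -> bw b z); last first.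
    by exists (fun=> 0) => sz bz; case: N.
  apply: contrapT => /forallNP N; apply: NE; exists zs; split=> // x bx Exx.
  apply: contrapT => N'; apply: (N x) => _ _; split=> // y by_ Exy z zz tyz.
  by apply: N'; exists y; split=> //; exists z.
have [F HF] := choice ex.
pose zs k := nrec [::] (fun _ s => rcons s (F s)) k; pose z k := F (zs k).
have szs k : size (zs k) = k by elim: k => //= k IH; rewrite size_rcons; congr _.+1.
have bzs k : k <= K.+1 -> forall x, x \in zs k -> bw b x.
  elim: k => //= k IH lk x; rewrite mem_rcons inE => /predU1P[->|]; last first.
    by apply: IH; apply: ltnW.
  by have [||] := HF (zs k); [rewrite szs | apply: IH; apply: ltnW |].
have zP k : k <= K -> [/\ bw b (z k), E (z k) (z k) &
   forall y, bw b y -> E (z k) y -> forall i, i < k -> ~ tail_eq y (z i)].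
  move=> lk; have [||H1 H2 H3] := HF (zs k); [by rewrite szs | by apply: bzs; lia |].
  split=> // y by_ Ezy i li; apply: H3 => //.
  elim: k li {lk H1 H2 Ezy} => //= k IH; rewrite ltnS leq_eqVlt mem_rcons inE.
  by case/predU1P => [->|/IH ->]; rewrite ?eqxx ?orbT.
(* One application of Ramsey's theorem makes all pairs of the chosen words homogeneous along the
   same cuts; the [K.+1] diagonal colours then cannot be distinct. *)
have [e0 [n [n_lt He]]] := ramsey (fun a c => [ffun p : 'I_K.+1 * 'I_K.+1 =>
   h (fac (upd (upd w vx (z p.1)) vy (z p.2)) a c)]).
have [i [j [lij eij]]] : exists i j : 'I_K.+1, i < j /\ e0 (i, i) = e0 (j, j).
  apply: contrapT => N.
  have inj : injective (fun i : 'I_K.+1 => e0 (i, i)).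
    move=> i j eij; apply/val_inj; case: (ltngtP i j) => // l; case: N.
      by exists i, j.
    by exists j, i.
  by have := leq_card _ inj; rewrite card_ord; lia.
have col (i' j' : 'I_K.+1) a c : a < c ->
    h (fac (upd (upd w vx (z i')) vy (z j')) (n a) (n c)) = e0 (i', j').
  by move=> /He/ffunP/(_ (i', j')); rewrite ffunE.
have [op hop] := congruence_op ch.
have [bi _ _] := zP i (ltn_ord i); have [bj Ejj Hj] := zP j (ltn_ord j).
apply: (@mix_absurd b T h R w vx vy sh bdw Es Et (z i) (z j) n
  (e0 (i, i)) (e0 (i, j)) (e0 (j, i)) bi bj n_lt _ _ _ _ Ejj Ec _ op hop).
- by move=> a c; apply: col.
- by move=> a c; rewrite eij; apply: col.
- by move=> a c; apply: col.
- by move=> a c; apply: col.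
- by move=> y by_ Ey; apply: (Hj y by_ Ey i lij).
Qed.

(** * A logic of infinite words *)

(* Variables are names of tracks.  In the first three atoms the letters carried
   at one time by the tracks [vs] are compared with the rows of a table: at all
   times, at time 0, and infinitely often.  [IShift v1 v2]: track [v2] is
   track [v1] read one step ahead. *)
Inductive iform : Type :=
| ILoc (vs : seq nat) (tab : seq (seq nat))
| IFirst (vs : seq nat) (tab : seq (seq nat))
| IInf (vs : seq nat) (tab : seq (seq nat))
| IShift (v1 v2 : nat)
| INot (p : iform)
| IAnd (p q : iform)
| IEx (v : nat) (p : iform)
| IMod (v r m : nat) (p : iform).

Fixpoint isat b (p : iform) (w : nat -> nat -> nat) : Prop :=
  match p with
  | ILoc vs tab => forall t, [seq w t v | v <- vs] \in tab
  | IFirst vs tab => [seq w 0 v | v <- vs] \in tab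
  | IInf vs tab => inf_often (fun t => [seq w t v | v <- vs] \in tab)
  | IShift v1 v2 => forall t, w t v2 = w t.+1 v1
  | INot p => ~ isat b p w
  | IAnd p q => isat b p w /\ isat b q w
  | IEx v p => exists2 x, bw b x & isat b p (upd w v x)
  | IMod v r m p => modcard [set x | bw b x /\ isat b p (upd w v x)]%classic r m
  end.

(** The sizes of the congruences built for the connectives; all atoms get the bound of the shift. *)
Fixpoint Kb b (p : iform) : nat :=
  match p with
  | INot p => Kb b p
  | IAnd p q => Kb b p * Kb b q
  | IEx v p => 2 ^ Kb b p
  | IMod v r m p => (2 * m.+1) ^ Kb b p
  | _ => (2 * b.+1 ^ 2).+1
  end.

(* A counting quantifier is only used for words that agree with one of finitely
   many tracks outside the finite support of a track [nu]. *)
Fixpoint good b (p : iform) : Prop :=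
  match p with
  | INot p => good b p
  | IAnd p q => good b p /\ good b q
  | IEx v p => good b p
  | IMod v r m p => [/\ 0 < m, good b p & exists nu (js : seq nat), forall w x, bnd b w ->
      bw b x -> isat b p (upd w v x) ->
      (exists n, forall t, n <= t -> w t nu = 0) /\
      exists2 j, j \in js & forall t, w t nu = 0 -> x t = w t j]
  | _ => True
  end.

Lemma good_finite b v r m p w : good b (IMod v r m p) -> bnd b w ->
  finite_set [set x | bw b x /\ isat b p (upd w v x)]%classic.
Proof.
move=> [_ _ [nu [js H]]] bdw; set X := [set x | _]%classic.
have [[n Hn]|N] := pselect (exists n, forall t, n <= t -> w t nu = 0); last first.
  rewrite (_ : X = set0) //; apply/seteqP; split=> // x [bx px].
  by have [] := H w x bdw bx px.
pose s := [seq (fun t => if t < n then nth 0 l t else w t j) | j <- js, l <- words b n].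
apply: (@sub_finite_set _ _ [set` s]%classic); last by apply/finite_seqP; exists s.
move=> x [bx px] /=; have [_ [j jj Hj]] := H w x bdw bx px.
apply/allpairsP; exists (j, fac x 0 n); split=> //=.
  by have := fac_words 0 n bx; rewrite subn0.
apply/funext => t; case: ltnP => lt; first by rewrite nth_fac // subn0.
by apply: Hj; apply: Hn.
Qed.

Lemma recog_isat b p : good b p -> recog b (Kb b p) (isat b p).
Proof.
have lK : 3 <= (2 * b.+1 ^ 2).+1 by rewrite expnS; lia.
elim: p => [vs tab|vs tab|vs tab|v1 v2|p IH|p IHp q IHq|v p IH|v r m p IH] /=.
- by move=> _; apply: (recog_loc _ (fun a => [seq a v | v <- vs] \in tab)); lia.
- by move=> _; apply: (recog_first _ (fun a => [seq a v | v <- vs] \in tab)).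
- by move=> _; apply: (recog_inf _ (fun a => [seq a v | v <- vs] \in tab)); lia.
- by move=> _; apply: recog_shift.
- by move=> /IH; apply: recog_not.
- by move=> [/IHp rp /IHq rq]; apply: recog_and.
- by move=> /IH; apply: recog_ex.
- move=> gp; have [m0 /IH rp _] := gp; apply: recog_mod => // w.
  exact: (@good_finite _ _ r m).
Qed.

(** * Ultimately periodic words *)

Definition upw P Q (l : seq nat) t : nat := nth 0 l (if t < P then t else P + (t - P) %% Q).
Definition is_up P Q (x : nat -> nat) : Prop := forall t, P <= t -> x (t + Q) = x t.

Lemma is_up_mul P Q x k t : is_up P Q x -> P <= t -> x (t + k * Q) = x t.
Proof.
move=> up lt; elim: k => [|k IH]; first by rewrite addn0.
by rewrite mulSn (addnC Q) addnA up ?IH //; lia.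
Qed.

Lemma is_up_mono P Q P' Q' x : is_up P Q x -> P <= P' -> Q %| Q' -> is_up P' Q' x.
Proof.
by move=> up lP /dvdnP [k ->] t lt; rewrite (is_up_mul _ up) //; apply: leq_trans lt.
Qed.

Lemma upw_up P Q l : is_up P Q (upw P Q l).
Proof.
move=> t lt; rewrite /upw !ltnNge lt (leq_trans lt (leq_addr _ _)) /=.
by rewrite -addnBAC // modnDr.
Qed.

Lemma up_repr P Q x : 0 < Q -> is_up P Q x -> x = upw P Q (fac x 0 (P + Q)).
Proof.
move=> Q0 up; apply/funext => t; rewrite /upw; case: ltnP => lt.
  by rewrite nth_fac //; lia.
have := ltn_pmod (t - P) Q0 => lm; rewrite nth_fac; last by lia.
rewrite add0n -(@is_up_mul _ _ _ ((t - P) %/ Q) (P + (t - P) %% Q) up) ?leq_addr //.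
by congr x; have := divn_eq (t - P) Q; lia.
Qed.

Lemma fac_upw P Q l : size l = P + Q -> fac (upw P Q l) 0 (P + Q) = l.
Proof.
move=> sl; apply: (@eq_from_nth _ 0); rewrite size_fac subn0 // => i li.
rewrite nth_fac ?subn0 // add0n /upw; case: ltnP => // lP.
by rewrite modn_small ?subnKC //; lia.
Qed.

Lemma upw_bw b P Q l : 0 < b -> all (fun a => a < b) l -> bw b (upw P Q l).
Proof.
move=> b0 al t; rewrite /upw; set i := (if _ then _ else _).
case: (ltnP i (size l)) => li; last by rewrite nth_default.
exact: (all_nthP 0 al).
Qed.

Section Pumping.
Variables (b P Q v : nat) (T : finType) (h : seq (nat -> nat) -> T) (w : nat -> nat -> nat).
Hypotheses (ch : congruence h) (Q_gt0 : 0 < Q) (w_up : forall t, P <= t -> w (t + Q) = w t).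

Let w_upM k t : P <= t -> w (t + k * Q) = w t.
Proof.
move=> lt; elim: k => [|k IH]; first by rewrite addn0.
by rewrite mulSn (addnC Q) addnA w_up ?IH //; lia.
Qed.

Lemma fac_period a k d : P <= a -> fac w (a + k * Q) (a + k * Q + d) = fac w a (a + d).
Proof.
move=> la; apply: (@eq_from_nth _ (fun=> 0)); rewrite !size_fac !addKn // => i li.
by rewrite !nth_fac ?addKn // -addnA (addnC (k * Q)) addnA w_upM //; lia.
Qed.

(** Among the prefixes ending at positions P + a * Q two have the same colour, and what lies between
    them can be cut out: its length is a multiple of the period of [w], so the rest of [w] still
    fits. *)
Lemma shorten o lo i l : o <= P -> lo <= i -> l \in words b (P + i * Q - o) ->
  exists i' l', [/\ lo <= i' <= lo + #|T|, l' \in words b (P + i' * Q - o) &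
    h (updw (fac w o (P + i' * Q)) v l') = h (updw (fac w o (P + i * Q)) v l)].
Proof.
move=> lo_; elim/ltn_ind: i l => i IH l li ll.
case: (leqP i (lo + #|T|)) => lT; first by exists i, l; rewrite li.
pose pre a := updw (fac w o (P + a * Q)) v (take (P + a * Q - o) l).
move: ll; rewrite mem_words => /andP[/eqP sl al].
have [a [a' [la1 la2 la3 ea]]] : exists a a', [/\ lo <= a, a < a', a' <= i & h (pre a) = h (pre a')].
  apply: contrapT => N.
  have inj : injective (fun a : 'I_(#|T|.+1) => h (pre (lo + a))).
    move=> a a' e; apply/val_inj; have := ltn_ord a; have := ltn_ord a'.
    case: (ltngtP a a') => // l' _ _; case: N.
      by exists (lo + a), (lo + a'); split=> //; have := ltn_ord a'; lia.
    by exists (lo + a'), (lo + a); split=> //; have := ltn_ord a; lia.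
  by have := leq_card _ inj; rewrite card_ord ltnn.
have lQ : a * Q <= a' * Q by rewrite leq_mul2r ltnW ?orbT.
have lQ' : a' * Q <= i * Q by rewrite leq_mul2r la3 orbT.
have eQ : (i - (a' - a)) * Q = i * Q - a' * Q + a * Q by rewrite !mulnBl; lia.
have s1 : size (take (P + a * Q - o) l) = P + a * Q - o by rewrite size_takel // sl; lia.
have s2 : size (take (P + a' * Q - o) l) = P + a' * Q - o by rewrite size_takel // sl; lia.
pose l1 := take (P + a * Q - o) l ++ drop (P + a' * Q - o) l.
have [|||i' [l' [H1 H2 H3]]] := IH (i - (a' - a)) _ l1; first by lia.
- by lia.
- rewrite mem_words size_cat s1 size_drop sl eQ; apply/andP; split; first by apply/eqP; lia.
  by rewrite all_cat; apply/andP; split; apply/allP => c; [move/mem_take|move/mem_drop]; move: c; apply/allP.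
exists i', l'; split=> //; rewrite H3 eQ /l1.
rewrite (@fac_cat _ w o (P + a * Q)); [|by lia..].
rewrite updw_cat; last by rewrite size_fac s1.
rewrite (@fac_cat _ w o (P + a' * Q) (P + i * Q)); [|by lia..].
rewrite -[in RHS](cat_take_drop (P + a' * Q - o) l) updw_cat; last by rewrite size_fac s2.
apply: ch => //; congr (h (updw _ v _)).
have -> : P + (i * Q - a' * Q + a * Q) = P + a * Q + (i * Q - a' * Q) by lia.
have -> : P + i * Q = P + a' * Q + (i * Q - a' * Q) by lia.
by rewrite !fac_period.
Qed.

End Pumping.

Lemma up_ex b K R w v P Q x : recog b K R -> bnd b w -> 0 < Q ->
  (forall t, P <= t -> w (t + Q) = w t) -> bw b x -> R (upd w v x) ->
  exists x', [/\ bw b x', is_up (P + K.+1 * Q) (K.+1`! * Q) x' & R (upd w v x')].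
Proof.
move=> [T [h [cT ch sh]]] bdw Q0 wup bx Rx.
pose pos a := P + a * Q.
have [e [n [n_lt He]]] := ramsey (fun a c => h (fac (upd w v x) (pos a) (pos c))).
have pos_lt a c : a < c -> pos a < pos c by move=> l; rewrite ltn_add2l ltn_mul2r Q0.
have n1 : 0 < n 1 by apply: leq_ltn_trans (n_lt 0).
have ll1 : fac x 0 (pos (n 1)) \in words b (pos (n 1) - 0) by apply: fac_words.
(* The lower bound 1 in both shortenings makes the prefix and the repeated block nonempty. By
   periodicity of [w] the second block may be treated as if it started at [P]. *)
have [i [l1 [li ll1' E1]]] := shorten v ch Q0 wup (leq0n P) n1 ll1.
have [j0 j0E] : exists j, n 2 = n 1 + j.+1.
  by exists (n 2 - (n 1).+1); have := n_lt 1; lia.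
have ll2 : fac x (pos (n 1)) (pos (n 2)) \in words b (P + j0.+1 * Q - P).
  have := fac_words (pos (n 1)) (pos (n 2)) bx.
  by rewrite (_ : _ - _ = P + j0.+1 * Q - P) // /pos j0E mulnDl; lia.
have [j [l2 [lj ll2' E2]]] := shorten v ch Q0 wup (leqnn P) (ltn0Sn j0) ll2.
have jQ : 0 < j * Q by rewrite muln_gt0 Q0 andbT; lia.
have posi : 0 < pos i by rewrite /pos; have : 0 < i * Q by [rewrite muln_gt0 Q0 andbT; lia]; lia.
rewrite subn0 in ll1'; rewrite addKn in ll2'.
have [sl1 al1] : size l1 = pos i /\ all (fun a => a < b) l1.
  by move: ll1'; rewrite mem_words => /andP[/eqP].
have [sl2 al2] : size l2 = j * Q /\ all (fun a => a < b) l2.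
  by move: ll2'; rewrite mem_words => /andP[/eqP].
pose x' t := if t < pos i then nth 0 l1 t else nth 0 l2 ((t - pos i) %% (j * Q)).
have bx' : bw b x'.
  move=> t; rewrite /x'; case: (ltnP t (pos i)) => lt; first by have /(all_nthP 0) := al1; apply; rewrite sl1.
  by have /(all_nthP 0) := al2; apply; rewrite sl2 ltn_pmod.
have upx' : is_up (pos i) (j * Q) x'.
  move=> t lt; rewrite /x' !ltnNge lt (leq_trans lt (leq_addr _ _)) /=.
  by rewrite -addnBAC // modnDr.
exists x'; split=> //.
  (* Both lengths are at most K.+1 periods of [w]; the factorial is a common multiple of all periods
     that may occur. *)
  apply: is_up_mono upx' _ _.
    by rewrite leq_add2l leq_mul2r; apply/orP; right; lia.
  by rewrite dvdn_pmul2r //; apply: dvdn_fact; lia.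
have Hc : cuts (fun k => if k is k'.+1 then pos (n k) else 0).
  split=> // -[|k]; last exact: pos_lt.
  by apply: leq_ltn_trans (leq0n _) (pos_lt 0 _ n1).
have Hc' : cuts (fun k => if k is k'.+1 then pos i + k' * (j * Q) else 0).
  by split=> // -[|k]; rewrite ?mul0n ?addn0 // mulSn; lia.
apply: (sh _ _ _ _ _ _ Hc Hc' _ Rx); try exact: bnd_upd.
case=> [|k].
  rewrite mul0n addn0 !fac_upd -E1; congr (h (updw _ v _)).
  apply/esym; apply: (@eq_from_nth _ 0); rewrite size_fac subn0 ?sl1 // => r lr.
  by rewrite nth_fac ?subn0 // add0n /x' lr.
rewrite (He k.+1 k.+2 (ltnSn _)) -(He 1 2 (ltnSn _)) !fac_upd.
have -> : fac x' (pos i + k * (j * Q)) (pos i + k.+1 * (j * Q)) = l2.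
  have sz : pos i + k.+1 * (j * Q) - (pos i + k * (j * Q)) = j * Q by rewrite mulSn; lia.
  apply: (@eq_from_nth _ 0); rewrite size_fac sz ?sl2 // => r lr.
  rewrite nth_fac ?sz // /x' ltnNge -addnA leq_addr /= addKn modnMDl modn_small //.
have -> : fac w (pos i + k * (j * Q)) (pos i + k.+1 * (j * Q)) = fac w P (P + j * Q).
  rewrite (_ : pos i + k * (j * Q) = P + (i + k * j) * Q); last by rewrite /pos; lia.
  rewrite (_ : pos i + k.+1 * (j * Q) = P + (i + k * j) * Q + j * Q); last by rewrite /pos; lia.
  by rewrite (fac_period Q0 wup).
rewrite E2; congr (h (updw _ v _)).
by rewrite {1}/pos j0E /pos mulnDl addnA (fac_period Q0 wup).
Qed.

Definition envl P Q (E : seq (seq nat)) : nat -> nat -> nat :=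
  fun t v => upw P Q (nth [::] E v) t.

Definition expand P Q P' Q' (l : seq nat) : seq nat := [seq upw P Q l t | t <- iota 0 (P' + Q')].

(** An existential witness is sought with the preperiod and period given by pumping. For [IMod] no
    enlargement is made: under [good], the words counted already have the preperiod and period of
    the environment. *)
Fixpoint ev b p P Q E : bool :=
  match p with
  | ILoc vs tab => all (fun t => [seq envl P Q E t v | v <- vs] \in tab) (iota 0 (P + Q))
  | IFirst vs tab => [seq envl P Q E 0 v | v <- vs] \in tab
  | IInf vs tab => has (fun t => [seq envl P Q E t v | v <- vs] \in tab) (iota P Q)
  | IShift v1 v2 => all (fun t => envl P Q E t v2 == envl P Q E t.+1 v1) (iota 0 (P + Q))
  | INot p => ~~ ev b p P Q E
  | IAnd p q => ev b p P Q E && ev b q P Q E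
  | IEx v p =>
      let P' := P + (Kb b p).+1 * Q in
      let Q' := (Kb b p).+1`! * Q in
      has (fun x => ev b p P' Q' (set_nth [::] [seq expand P Q P' Q' l | l <- E] v x))
        (words b (P' + Q'))
  | IMod v r m p =>
      count (fun x => ev b p P Q (set_nth [::] E v x)) (words b (P + Q)) %% m == r %% m
  end.

Lemma envl_set P Q E v x : envl P Q (set_nth [::] E v x) = upd (envl P Q E) v (upw P Q x).
Proof.
by apply/funext => t; apply/funext => v'; rewrite /envl /upd nth_set_nth /=; case: eqP.
Qed.

Lemma envl_up P Q E t : P <= t -> envl P Q E (t + Q) = envl P Q E t.
Proof. by move=> lt; apply/funext => v; apply: upw_up. Qed.

Lemma envl_expand P Q P' Q' E : 0 < Q -> 0 < Q' -> P <= P' -> Q %| Q' ->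
  envl P' Q' [seq expand P Q P' Q' l | l <- E] = envl P Q E.
Proof.
move=> Q0 Q0' lP dQ; apply/funext => t; apply/funext => v; rewrite /envl.
have ex l : upw P' Q' (expand P Q P' Q' l) = upw P Q l.
  rewrite [RHS](@up_repr P' Q') //; last exact: is_up_mono (@upw_up P Q l) lP dQ.
  by rewrite /expand /fac /index_iota subn0.
case: (ltnP v (size E)) => lv; first by rewrite (nth_map [::]) // ex.
by rewrite !nth_default ?size_map // /upw !nth_nil.
Qed.

Definition bl b (E : seq (seq nat)) : Prop := forall v, all (fun a => a < b) (nth [::] E v).

Lemma bl_set b E v x : bl b E -> all (fun a => a < b) x -> bl b (set_nth [::] E v x).
Proof. by move=> bE bx v'; rewrite nth_set_nth /=; case: eqP. Qed.

Lemma bnd_envl b P Q E : 0 < b -> bl b E -> bnd b (envl P Q E).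
Proof. by move=> b0 bE t v; apply: upw_bw. Qed.

Lemma up_residue P Q t : 0 < Q -> exists2 s, s < P + Q & forall E, envl P Q E t = envl P Q E s /\
  envl P Q E t.+1 = envl P Q E s.+1.
Proof.
move=> Q0; case: (ltnP t P) => lt; first by exists t; rewrite ?ltn_addr.
exists (P + (t - P) %% Q) => [|E]; first by rewrite ltn_add2l ltn_pmod.
have eP s : P <= s -> forall k, envl P Q E (s + k * Q) = envl P Q E s.
  move=> ls k; apply/funext => v; apply: is_up_mul ls; exact: upw_up.
have := divn_eq (t - P) Q => dE; split.
  by rewrite -[RHS](eP _ _ ((t - P) %/ Q)) ?leq_addr //; congr envl; lia.
by rewrite -[RHS](eP _ _ ((t - P) %/ Q)) -?addnS ?leq_addr //; congr envl; lia.
Qed.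

Lemma evP b p P Q E : good b p -> 0 < b -> 0 < Q -> bl b E ->
  reflect (isat b p (envl P Q E)) (ev b p P Q E).
Proof.
move=> + b0; elim: p P Q E => [vs tab|vs tab|vs tab|v1 v2|p IH|p IHp q IHq|v p IH|v r m p IH] P Q E gp Q0 bE.
- apply: (iffP allP) => /= [H t|H t _]; last exact: H.
  have [s ls /(_ E) [-> _]] := up_residue P t Q0; apply: H.
  by rewrite mem_iota.
- exact: idP.
- apply: (iffP hasP) => /= [[t lt Ht] N|H].
    rewrite mem_iota in lt; exists (t + N * Q).
      by apply: leq_trans (leq_addl _ _); rewrite leq_pmulr.
    have -> // : envl P Q E (t + N * Q) = envl P Q E t.
    by apply/funext => v; apply: is_up_mul; [exact: upw_up | case/andP: lt].
  have [t lt Ht] := H P; exists (P + (t - P) %% Q).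
    by rewrite mem_iota leq_addr ltn_add2l ltn_pmod.
  have <- // : envl P Q E t = envl P Q E (P + (t - P) %% Q).
  apply/funext => v; rewrite /envl.
  rewrite -[RHS](is_up_mul ((t - P) %/ Q) (@upw_up P Q _) (leq_addr _ _)).
  by congr upw; have := divn_eq (t - P) Q; lia.
- apply: (iffP allP) => /= [H t|H t _]; last by apply/eqP; apply: H.
  have [s ls /(_ E) [-> ->]] := up_residue P t Q0; apply/eqP; apply: H.
  by rewrite mem_iota.
- by apply: (iffP negP) => /= H; [move=> /(IH P Q E gp Q0 bE) | move=> /(IH P Q E gp Q0 bE)].
- have [gp1 gp2] := gp.
  by apply: (iffP andP) => /= -[/(IHp P Q E gp1 Q0 bE) ? /(IHq P Q E gp2 Q0 bE) ?].
- rewrite /=; set K := Kb b p; set P' := P + _; set Q' := _ * Q.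
  have Q0' : 0 < Q' by rewrite muln_gt0 fact_gt0.
  have lP : P <= P' by apply: leq_addr.
  have dQ : Q %| Q' by apply: dvdn_mull.
  set E' := map _ E.
  have bE' : bl b E'.
    move=> v'; case: (ltnP v' (size E)) => lv; last by rewrite nth_default // size_map.
    by rewrite (nth_map [::]) // all_map; apply/allP => t _; apply: upw_bw.
  have sE x : all (fun a => a < b) x ->
      reflect (isat b p (upd (envl P Q E) v (upw P' Q' x))) (ev b p P' Q' (set_nth [::] E' v x)).
    by move=> bx; rewrite -(envl_expand E Q0 Q0' lP dQ) -envl_set; apply: IH => //; apply: bl_set.
  apply: (iffP hasP) => [[x]|[x bx px]].
    rewrite mem_words => /andP[_ bx] /(sE _ bx) H; exists (upw P' Q' x) => //.
    exact: upw_bw.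
  have [x' [bx' upx' px']] := up_ex (recog_isat (p := p) gp) (bnd_envl P Q b0 bE) Q0 (@envl_up P Q E) bx px.
  have ax : all (fun a => a < b) (fac x' 0 (P' + Q')) by apply/all_fac.
  exists (fac x' 0 (P' + Q')); first by rewrite mem_words size_fac subn0 eqxx.
  by apply/sE => //; rewrite -up_repr.
- rewrite /=; set X := [set x | _]%classic; have [m0 gp' _] := gp.
  have bdw := bnd_envl P Q b0 bE.
  (* The track [nu] is periodic from [P] on and eventually 0, hence 0 from [P] on; there a solution
     coincides with one of the tracks [js]. *)
  have Xup x : X x -> is_up P Q x.
    move=> [bx px]; have [_ _ [nu [js Hgp]]] := gp; have [[N HN] [j jj Hj]] := Hgp _ _ bdw bx px.
    have z t : P <= t -> x t = envl P Q E t j.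
      move=> lt; apply: Hj; rewrite -(HN (t + N * Q)).
        by apply/esym; apply: is_up_mul lt; apply: upw_up.
      by apply: leq_trans (leq_addl _ _); rewrite leq_pmulr.
    by move=> t lt; rewrite !z ?envl_up //; apply: leq_trans (leq_addr _ _).
  have dX : determined X (P + Q).
    by move=> x y /Xup ux /Xup uy e; rewrite (up_repr Q0 ux) e -(up_repr Q0 uy).
  have cX := card_determined (b := b) (fun x (Xx : X x) => proj1 Xx) dX.
  have eC : count (fun l => `[< exists2 x, X x & fac x 0 (P + Q) = l >]) (words b (P + Q)) =
            count (fun x => ev b p P Q (set_nth [::] E v x)) (words b (P + Q)).
    apply: eq_in_count => l; rewrite mem_words => /andP[/eqP sl al].
    have rl := IH P Q (set_nth [::] E v l) gp' Q0 (bl_set v bE al).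
    rewrite envl_set in rl.
    apply/asboolP/rl => [[x Xx El]|H].
      by have [_ px] := Xx; rewrite -El -(up_repr Q0 (Xup x Xx)).
    exists (upw P Q l); last exact: fac_upw.
    by split=> //; apply: upw_bw.
  rewrite eC in cX; apply: (iffP eqP) => [H|[c [cc <-]]].
    by exists (count (fun x => ev b p P Q (set_nth [::] E v x)) (words b (P + Q))).
  congr (_ %% m); apply/card_eq_II; apply: card_eq_trans cc.
  by rewrite card_eq_sym.
Qed.

(** * Definable relations on words *)

Definition IOr p q := INot (IAnd (INot p) (INot q)).
Definition IImp p q := INot (IAnd p (INot q)).
Definition IAll v p := INot (IEx v (INot p)).
Definition IFalse := INot (ILoc [::] [:: [::]]).

Lemma isat_or b p q w : isat b (IOr p q) w <-> isat b p w \/ isat b q w.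
Proof. by rewrite /= -not_orE notK; split. Qed.

Lemma isat_imp b p q w : isat b (IImp p q) w <-> (isat b p w -> isat b q w).
Proof.
split=> /= [H Hp|H [Hp Hq]]; last exact: Hq (H Hp).
by apply: contrapT => Hq; apply: H.
Qed.

Lemma isat_all b v p w : isat b (IAll v p) w <-> forall x, bw b x -> isat b p (upd w v x).
Proof.
split=> /= [H x bx|H [x bx Hx]]; last exact: Hx (H x bx).
by apply: contrapT => Hp; apply: H; exists x.
Qed.

Lemma isat_and b p q w : isat b (IAnd p q) w <-> isat b p w /\ isat b q w.
Proof. by []. Qed.

Lemma isat_false b w : ~ isat b IFalse w.
Proof. by move=> H; apply: H => t /=; rewrite inE. Qed.

Definition exs (vs : seq nat) p := foldr IEx p vs.

Definition updall (w : nat -> nat -> nat) (vs : seq nat) (F : nat -> nat -> nat) :=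
  fun t v => if v \in vs then F v t else w t v.

Lemma bnd_updall b w vs F : bnd b w -> (forall v, bw b (F v)) -> bnd b (updall w vs F).
Proof. by move=> bdw bF t v; rewrite /updall; case: ifP => // _; apply: bF. Qed.

Lemma isat_exs b vs p w : bnd b w ->
  isat b (exs vs p) w <-> exists2 F, forall v, bw b (F v) & isat b p (updall w vs F).
Proof.
elim: vs w => [|v0 vs IH] w bdw /=.
  split=> [H|[F _]]; last by [].
  by exists (fun v t => w t v) => // v t; apply: bdw.
split=> [[x bx /(IH _ (bnd_upd _ bdw bx)) [F bF H]]|[F bF H]].
  exists (fun v => if v \in vs then F v else x) => [v|]; first by case: ifP.
  congr (isat b p _): H; apply/funext => t; apply/funext => v.
  by rewrite /updall /upd inE; case: (v \in vs); rewrite ?orbT // orbF; case: eqP.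
exists (F v0) => //; apply/IH; first exact: bnd_upd.
exists F => //; congr (isat b p _): H; apply/funext => t; apply/funext => v.
by rewrite /updall /upd inE; case: (v \in vs); rewrite ?orbT // orbF; case: eqP => // ->.
Qed.

(** The run is an existential track [r], so its states must lie below [b]. The copy [r.+1], one step
    ahead, makes the transition relation a condition on single times. *)
Definition autF (init : seq nat) (trans : seq (seq nat)) (acc vs : seq nat) r : iform :=
  IEx r (IEx r.+1 (IAnd (IFirst [:: r] [seq [:: q] | q <- init])
    (IAnd (IShift r r.+1) (IAnd (ILoc (r :: rcons vs r.+1) trans)
                                (IInf [:: r] [seq [:: q] | q <- acc]))))).

Lemma isat_aut b init trans acc vs r w : (forall v, v \in vs -> v < r) ->
  isat b (autF init trans acc vs r) w <-> exists rho, [/\ bw b rho, rho 0 \in init,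
     forall t, rho t :: rcons [seq w t v | v <- vs] (rho t.+1) \in trans &
     inf_often (fun t => rho t \in acc)].
Proof.
move=> lvs.
have inj : injective (fun q : nat => [:: q]) by move=> q q' [].
have vsE x x' t : [seq upd (upd w r x) r.+1 x' t v | v <- vs] = [seq w t v | v <- vs].
  by apply/eq_in_map => v /lvs lv; rewrite /upd !ifN //; lia.
have rE x x' t : upd (upd w r x) r.+1 x' t r = x t by rewrite updN ?updE //; lia.
split=> [[x bx [x' bx' /= [H1 [H2 [H3 H4]]]]]|[x [bx H1 H2 H3]]].
  have x'E t : x' t = x t.+1 by have := H2 t; rewrite updE rE.
  exists x; split=> // [|t|N].
  - by rewrite rE mem_map in H1.
  - by have := H3 t; rewrite rE map_rcons vsE updE x'E.
  - by have [t lt] := H4 N; rewrite rE mem_map // => Ht; exists t.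
exists x => //; exists (fun t => x t.+1) => [t|]; first exact: bx.
split; first by rewrite /= rE mem_map.
split; first by move=> t; rewrite updE rE.
split; first by move=> t; rewrite /= rE map_rcons vsE updE.
by move=> N; have [t lt Ht] := H3 N; exists t; rewrite //= rE mem_map.
Qed.

Definition finF b nu := INot (IInf [:: nu] [seq [:: a] | a <- iota 1 b.-1]).

Lemma isat_fin b nu w : bnd b w ->
  isat b (finF b nu) w <-> exists n, forall t, n <= t -> w t nu = 0.
Proof.
move=> bdw; have inj : injective (fun q : nat => [:: q]) by move=> q q' [].
have E t : ([seq w t v | v <- [:: nu]] \in [seq [:: a] | a <- iota 1 b.-1]) = (w t nu != 0).
  by rewrite /= mem_map // mem_iota; have := bdw t nu; lia.
split=> [H|[n Hn] H].
  apply: contrapT => /forallNP N; apply: H => n.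
  apply: contrapT => N'; apply: (N n) => t lt; apply: contrapT => /eqP nz.
  by apply: N'; exists t; rewrite // E.
by have [t lt] := H n; rewrite E Hn.
Qed.

Definition agreeF b nu y x := ILoc [:: nu; y; x]
  [seq l <- words b 3 | (nth 0 l 0 == 0) ==> (nth 0 l 1 == nth 0 l 2)].

Lemma isat_agree b nu y x w : bnd b w ->
  isat b (agreeF b nu y x) w <-> forall t, w t nu = 0 -> w t y = w t x.
Proof.
move=> bdw; have E t : ([seq w t v | v <- [:: nu; y; x]] \in
    [seq l <- words b 3 | (nth 0 l 0 == 0) ==> (nth 0 l 1 == nth 0 l 2)]) =
    ((w t nu == 0) ==> (w t y == w t x)).
  by rewrite mem_filter mem_words /= !bdw /= andbT.
split=> /= [H t nu0|H t]; first by have := H t; rewrite E nu0 eqxx => /eqP.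
by rewrite E; apply/implyP => /eqP /H ->.
Qed.

Definition tailF b nu y (js : seq nat) := foldr (fun j p => IOr (agreeF b nu y j) p) IFalse js.

Lemma isat_tail b nu y js w : bnd b w ->
  isat b (tailF b nu y js) w <-> exists2 j, j \in js & forall t, w t nu = 0 -> w t y = w t j.
Proof.
move=> bdw; elim: js => [|j js IH]; first by split=> [/isat_false|[]].
rewrite [tailF _ _ _ _]/= isat_or isat_agree // IH; split.
  by case=> [H|[j' jj H]]; [exists j; rewrite ?mem_head | exists j'; rewrite // inE jj orbT].
case=> j'; rewrite inE => /predU1P[->|jj] H; [by left | by right; exists j'].
Qed.

(** State 0 means equal so far, state 1 that the first difference has been seen. Rows list the
    state, the two letters and the next state. *)
Definition lexTab b := [seq l <- words b 4 | let q := nth 0 l 0 in let q' := nth 0 l 3 in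
  let z := nth 0 l 1 in let y := nth 0 l 2 in
  [|| [&& q == 0, z == y & q' == 0], [&& q == 0, z < y & q' == 1] | (q == 1) && (q' == 1)]].
Definition lexF b z y r := autF [:: 0] (lexTab b) [:: 1] [:: z; y] r.

Definition lexlt (x y : nat -> nat) : Prop :=
  exists2 t, x t < y t & forall s, s < t -> x s = y s.

Lemma isat_lex b z y r w : 1 < b -> bnd b w -> z < r -> y < r ->
  isat b (lexF b z y r) w <-> lexlt (fun t => w t z) (fun t => w t y).
Proof.
move=> b1 bdw lz ly; rewrite isat_aut; last by move=> v; rewrite !inE => /orP[] /eqP ->.
split=> [[x [bx x0 xS xI]]|[t lt Ht]].
  have {}x0 : x 0 = 0 by move: x0; rewrite inE => /eqP.
  have [t0 _ x1] := xI 0; have ex : exists t, x t != 0 by exists t0; move: x1; rewrite inE => /eqP ->.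
  case: (ex_minnP ex) => -[|t]; first by rewrite x0.
  move=> xt tmin.
  have z0 s : s <= t -> x s = 0.
    by move=> ls; apply/eqP; apply: contraT => /tmin; lia.
  have step s : s <= t -> (w s z == w s y) && (x s.+1 == 0) || (w s z < w s y).
    move=> ls; have := xS s; rewrite mem_filter /= z0 //= => /andP[].
    by case/orP => [/andP[-> ->]//|/orP[/andP[-> _]|//]]; rewrite orbT.
  exists t => [|s ls].
    by have := step t (leqnn t); rewrite (negbTE xt) andbF.
  have := xS s; rewrite mem_filter /= !z0 //=; last exact: ltnW.
  by rewrite !andbF !orbF andbT => /andP[/eqP].
exists (fun s => (t < s) : nat); split=> //.
- by move=> s; case: (t < s); lia.
- move=> s; rewrite mem_filter mem_words /= !bdw !andbT.
  have -> : (t < s) < b by case: (t < s); lia.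
  have -> : (t < s.+1) < b by case: (t < s.+1); lia.
  rewrite andbT ltnS; case: (ltngtP s t) => [l|l|E]; rewrite ?(Ht s l) ?eqxx //.
  by rewrite E lt orbT.
- by move=> N; exists (maxn N t.+1); rewrite ?leq_maxl // inE (_ : t < _) //; lia.
Qed.

Lemma lexlt_total x y : x <> y -> lexlt x y \/ lexlt y x.
Proof.
move=> ne; have ex : exists t, x t != y t.
  have [t Ht] : exists t, x t <> y t by apply/existsNP => e; apply: ne; apply/funext.
  by exists t; apply/eqP.
case: (ex_minnP ex) => t nt tmin.
have eqs s : s < t -> x s = y s.
  by move=> ls; apply/eqP; apply: contraT => /tmin; lia.
case: (ltngtP (x t) (y t)) nt => // l _; [left | right]; exists t => // s /eqs //.
Qed.

Lemma lexlt_trans y x z : lexlt x y -> lexlt y z -> lexlt x z.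
Proof.
move=> [t lt Ht] [s ls Hs]; case: (ltngtP t s) => l.
- exists t => [|r lr]; first by rewrite -Hs.
  by rewrite Ht // Hs //; lia.
- exists s => [|r lr]; first by rewrite Ht.
  by rewrite Ht ?Hs //; lia.
- rewrite -l in ls Hs; exists t => [|r lr]; first exact: ltn_trans ls.
  by rewrite Ht // Hs.
Qed.

Lemma lexlt_irr x : ~ lexlt x x.
Proof. by move=> [t]; rewrite ltnn. Qed.

(** Finiteness of the list matters: the lexicographic order on infinite words is not
    well-founded. *)
Lemma lex_min (P : (nat -> nat) -> Prop) (s : seq (nat -> nat)) y : y \in s -> P y ->
  exists x, [/\ x \in s, P x & forall z, z \in s -> P z -> ~ lexlt z x].
Proof.
elim: s y => // a s IH y; rewrite inE => ys Py.
have [[y' ys' Py']|N] := pselect (exists2 y', y' \in s & P y'); last first.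
  case/predU1P: ys => [Ea|ys]; last by case: N; exists y.
  exists y; rewrite -Ea mem_head; split=> // z; rewrite inE => /predU1P[-> _|zs Pz].
    exact: lexlt_irr.
  by case: N; exists z.
have [x [xs Px xmin]] := IH y' ys' Py'.
have [[Pa lax]|N] := pselect (P a /\ lexlt a x).
  exists a; rewrite mem_head; split=> // z; rewrite inE => /predU1P[-> _|zs Pz lza].
    exact: lexlt_irr.
  by apply: (xmin z) => //; apply: lexlt_trans lza lax.
exists x; rewrite inE xs orbT; split=> // z; rewrite inE => /predU1P[-> Pa lax|].
  by apply: N.
exact: xmin.
Qed.

(** * Cardinality of definable sets of names *)

Ltac upd_simp := rewrite /upd ?eqxx;
  repeat match goal with |- context [?a == ?b] =>
    (rewrite (_ : (a == b) = false); last by lia) end.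

Section Templates.
Variables (b n : nat) (p eqF : iform) (A : Type) (nm : (nat -> nat) -> A -> Prop).
Variables (X : set A) (w : nat -> nat -> nat).
Hypotheses (b1 : 1 < b) (bdw : bnd b w).
Hypotheses (nm_bw : forall x a, nm x a -> bw b x)
           (nm_fun : forall x a a', nm x a -> nm x a' -> a = a')
           (nm_surj : forall a, exists x, nm x a).
Hypothesis Hp : forall w', bnd b w' -> (forall t v, v < n -> w' t v = w t v) ->
  isat b p w' <-> exists2 a, nm (fun t => w' t n) a & X a.
Hypothesis Heq : forall w', bnd b w' ->
  isat b eqF w' <-> exists2 a, nm (fun t => w' t n) a & nm (fun t => w' t n.+1) a.
Hypotheses (gp : good b p) (geq : good b eqF).

(** The bound for naming the same element of [X]. Track [n] holds a name, [n.+1] a second one,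
    [n.+2] a finite support, and the centres follow. *)
Definition nclasses := Kb b (IAnd p eqF).
Definition centers := iota n.+3 nclasses.
Definition someF := IEx n.+1 (IAnd eqF (tailF b n.+2 n.+1 centers)).
Definition countableF :=
  exs centers (IAll n (IImp p (IEx n.+2 (IAnd (finF b n.+2) someF)))).
(** One support for all elements characterises finite sets; in [countableF] the support is chosen
    after the element. *)
Definition coverF := IAnd (finF b n.+2) (IAll n (IImp p someF)).
Definition finiteF := exs centers (IEx n.+2 coverF).
(** The finiteness of the support is repeated here so that [good] holds in every environment, not
    only in those satisfying [coverF]. The run of [lexF] reuses the tracks of the support and of a
    centre, which is harmless under its own quantifiers. *)
Definition repsF := IAnd p (IAnd (finF b n.+2) (IAnd (tailF b n.+2 n centers)
  (INot (IEx n.+1 (IAnd (tailF b n.+2 n.+1 centers) (IAnd (lexF b n.+1 n n.+2) eqF)))))).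
Definition modF r m := exs centers (IEx n.+2 (IAnd coverF (IMod n r m repsF))).

Definition near nu (F : nat -> nat -> nat) (y : nat -> nat) : Prop :=
  exists2 j, j \in centers & forall t, nu t = 0 -> y t = F j t.
Definition fsupp (nu : nat -> nat) : Prop := exists N, forall t, N <= t -> nu t = 0.

Let w1 F := updall w centers F.

Let bw1 F : (forall v, bw b (F v)) -> bnd b (w1 F).
Proof. exact: bnd_updall. Qed.

Let w1_lo F t v : v < n.+3 -> w1 F t v = w t v.
Proof. by move=> lv; rewrite /w1 /updall mem_iota ifN //; lia. Qed.

Let w1_hi F t v : v \in centers -> w1 F t v = F v t.
Proof. by move=> vc; rewrite /w1 /updall vc. Qed.

Let center_gt v : v \in centers -> n.+2 < v.
Proof. by rewrite mem_iota => /andP[]. Qed.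

Let isat_p F nu x : (forall v, bw b (F v)) -> bw b nu -> bw b x ->
  isat b p (upd (upd (w1 F) n.+2 nu) n x) <-> exists2 a, nm x a & X a.
Proof.
move=> bF bnu bx; rewrite Hp; last 2 first.
- by do 2!apply: bnd_upd => //; apply: bw1.
- by move=> t v lv; upd_simp; apply: w1_lo; lia.
by have -> : (fun t => upd (upd (w1 F) n.+2 nu) n x t n) = x by apply/funext => t; rewrite updE.
Qed.

Let tail_near w' F nu y v : bnd b w' -> (forall t, w' t n.+2 = nu t) ->
  (forall t, w' t v = y t) -> (forall t j, j \in centers -> w' t j = F j t) ->
  isat b (tailF b n.+2 v centers) w' <-> near nu F y.
Proof.
move=> bd Hnu Hy HF; rewrite isat_tail //.
by split=> -[j jc H]; exists j => // t; have := H t; rewrite Hnu Hy HF.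
Qed.

Let isat_some w' F nu x : bnd b w' -> (forall t, w' t n.+2 = nu t) ->
  (forall t, w' t n = x t) -> (forall t j, j \in centers -> w' t j = F j t) ->
  isat b someF w' <-> exists a y, [/\ nm x a, nm y a & near nu F y].
Proof.
move=> bd Hnu Hx HF; rewrite /someF /=; split.
  move=> [y by_ [/(Heq (bnd_upd _ bd by_)) [a na na'] Ht]]; exists a, y; split.
  - by congr (nm _ a): na; apply/funext => t; upd_simp; apply: Hx.
  - by congr (nm _ a): na'; apply/funext => t; rewrite updE.
  - apply: (tail_near _ _ _ _).1 Ht => [|t|t|t j jc]; [exact: bnd_upd| | |].
    + by upd_simp; apply: Hnu.
    + by rewrite updE.
    + by have := center_gt jc => l; upd_simp; apply: HF.
move=> [a [y [nx ny Hn]]]; have by_ := nm_bw ny; exists y => //; split.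
  apply/Heq; first exact: bnd_upd.
  exists a; first by congr (nm _ a): nx; apply/funext => t; upd_simp; rewrite Hx.
  by congr (nm _ a): ny; apply/funext => t; rewrite updE.
apply: (tail_near _ _ _ _).2 Hn => [|t|t|t j jc]; [exact: bnd_upd| | |].
+ by upd_simp; apply: Hnu.
+ by rewrite updE.
+ by have := center_gt jc => l; upd_simp; apply: HF.
Qed.

Lemma near_finite nu F : fsupp nu -> (forall v, bw b (F v)) ->
  exists s : seq (nat -> nat), forall y, bw b y -> near nu F y -> y \in s.
Proof.
move=> [N HN] bF.
exists [seq (fun t => if t < N then nth 0 l t else F j t) | j <- centers, l <- words b N].
move=> y by_ [j jc Hj]; apply/allpairsP; exists (j, fac y 0 N); split=> //=.
  by have := fac_words 0 N by_; rewrite subn0.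
apply/funext => t; case: ltnP => lt; first by rewrite nth_fac // subn0.
by apply: Hj; apply: HN.
Qed.

Lemma isat_countable_sem : isat b countableF w <->
  exists2 F, forall v, bw b (F v) & forall a, X a ->
    exists nu y, [/\ bw b nu, fsupp nu, nm y a & near nu F y].
Proof.
rewrite isat_exs //; split=> -[F bF H]; exists F => //.
  move=> a Xa; have [x nx] := nm_surj a; have bx := nm_bw nx.
  move/isat_all: H => /(_ x bx) /isat_imp H.
  have bwx : bnd b (upd (w1 F) n x) by apply: bnd_upd => //; apply: bw1.
  have [|nu bnu [/= Hf Hs]] := H.
    apply/Hp => //; first by move=> t v lv; upd_simp; apply: w1_lo; lia.
    by exists a => //; congr (nm _ a): nx; apply/funext => t; rewrite updE.
  have bwn : bnd b (upd (upd (w1 F) n x) n.+2 nu) by apply: bnd_upd.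
  move: Hf Hs; rewrite -[X in X -> _]/(isat b (finF b n.+2) _) isat_fin // => Hf.
  rewrite -[X in X -> _]/(isat b someF _) (@isat_some _ F nu x) //.
  - move=> [a' [y [nx' ny Hn]]]; exists nu, y; split=> //.
      by case: Hf => N HN; exists N => t /HN; rewrite updE.
    by rewrite (nm_fun nx nx').
  - by move=> t; rewrite updE.
  - by move=> t; upd_simp.
  - by move=> t j jc; have := center_gt jc => l; upd_simp; apply: w1_hi.
apply/isat_all => x bx; apply/isat_imp.
have bwx : bnd b (upd (w1 F) n x) by apply: bnd_upd => //; apply: bw1.
move/(Hp bwx) => [|a na Xa]; first by move=> t v lv; upd_simp; apply: w1_lo; lia.
have {}na : nm x a by congr (nm _ a): na; apply/funext => t; rewrite updE.
have [nu [y [bnu Hf ny Hn]]] := H a Xa.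
have bwn : bnd b (upd (upd (w1 F) n x) n.+2 nu) by apply: bnd_upd.
exists nu => //; split.
  apply/(isat_fin _ bwn).
  by case: Hf => N HN; exists N => t /HN; rewrite updE.
apply/(@isat_some _ F nu x) => //; last by exists a, y.
- by move=> t; rewrite updE.
- by move=> t; upd_simp.
- by move=> t j jc; have := center_gt jc => l; upd_simp; apply: w1_hi.
Qed.

Lemma isat_cover F nu : (forall v, bw b (F v)) -> bw b nu ->
  isat b coverF (upd (w1 F) n.+2 nu) <->
  fsupp nu /\ forall a, X a -> exists2 y, nm y a & near nu F y.
Proof.
move=> bF bnu; have bwn : bnd b (upd (w1 F) n.+2 nu) by apply: bnd_upd => //; apply: bw1.
have fE : isat b (finF b n.+2) (upd (w1 F) n.+2 nu) <-> fsupp nu.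
  by rewrite isat_fin //; split=> -[N HN]; exists N => t /HN; rewrite updE.
have sE x : bw b x -> isat b someF (upd (upd (w1 F) n.+2 nu) n x) <->
    exists a y, [/\ nm x a, nm y a & near nu F y].
  move=> bx; apply: isat_some; first exact: bnd_upd.
  - by move=> t; upd_simp.
  - by move=> t; rewrite updE.
  - by move=> t j jc; have := center_gt jc => l; upd_simp; apply: w1_hi.
rewrite /coverF isat_and fE.
split=> -[Hf H]; split=> //.
  move=> a Xa; have [x nx] := nm_surj a; have bx := nm_bw nx.
  move/isat_all: H => /(_ x bx) /isat_imp; rewrite isat_p // sE // => -[|a' [y [na' ny Hn]]].
    by exists a.
  by exists y; rewrite // (nm_fun nx na').
apply/isat_all => x bx; apply/isat_imp; rewrite isat_p // sE // => -[a na Xa].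
by have [y ny Hn] := H a Xa; exists a, y.
Qed.

Lemma isat_finite_sem : isat b finiteF w <->
  exists F nu, [/\ forall v, bw b (F v), bw b nu, fsupp nu &
    forall a, X a -> exists2 y, nm y a & near nu F y].
Proof.
rewrite isat_exs //; split.
  by move=> [F bF [nu bnu /(isat_cover bF bnu) [Hf H]]]; exists F, nu.
by move=> [F [nu [bF bnu Hf H]]]; exists F => //; exists nu => //; apply/isat_cover.
Qed.

Lemma countable_cover : countable X -> exists2 F, forall v, bw b (F v) &
  forall a, X a -> exists nu y, [/\ bw b nu, fsupp nu, nm y a & near nu F y].
Proof.
move=> /countable_injP [i0 inj].
have gpe : good b (IAnd p eqF) by [].
pose E x y := isat b (IAnd p eqF) (upd (upd w n x) n.+1 y).
have EE x y : bw b x -> bw b y -> E x y <-> exists a, [/\ nm x a, nm y a & X a].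
  move=> bx by_; have bd : bnd b (upd (upd w n x) n.+1 y) by apply: bnd_upd => //; apply: bnd_upd.
  have e1 : (fun t => upd (upd w n x) n.+1 y t n) = x by apply/funext => t; upd_simp.
  have e2 : (fun t => upd (upd w n x) n.+1 y t n.+1) = y by apply/funext => t; rewrite updE.
  rewrite /E /= Hp // ?Heq // ?e1 ?e2; last by move=> t v lv; upd_simp.
  split=> [[[a na Xa] [a' na' ny]]|[a [nx ny Xa]]]; last by split; exists a.
  by exists a; split=> //; rewrite (nm_fun na na').
have b0 : 0 < b by apply: ltnW.
have [||| zs [szs bzs Hzs]] := countable_tails (w := w) (vx := n) (vy := n.+1) (recog_isat gpe) bdw.
- by move=> x y bx by_ /(EE _ _ bx by_) [a [nx ny Xa]]; apply/EE => //; exists a.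
- move=> x y z bx by_ bz /(EE _ _ bx by_) [a [nx ny Xa]] /(EE _ _ by_ bz) [a' [ny' nz _]].
  by apply/EE => //; exists a; split=> //; rewrite (nm_fun ny ny').
- have ex k : exists x, bw b x /\ forall a, X a -> i0 a = k -> nm x a.
    have [[a [Xa ka]]|N] := pselect (exists a, X a /\ i0 a = k).
      have [x nx] := nm_surj a; exists x; split; first exact: nm_bw nx.
      by move=> a' Xa' ka'; rewrite (inj a' a) ?inE ?ka'.
    by exists (fun=> 0); split=> // a Xa ka; case: N; exists a.
  have [rho Hrho] := choice ex; exists rho; split=> [k|z bz]; first by case: (Hrho k).
  move/(EE _ _ bz bz) => [a [nz _ Xa]]; exists (i0 a).
  have [br Hr] := Hrho (i0 a); apply/EE => //; exists a; split=> //; exact: Hr.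
(* Centre tracks start at n.+3; those beyond the list [zs] are filled with the zero word. *)
exists (fun v => nth (fun=> 0) zs (v - n.+3)) => [v|a Xa].
  case: (ltnP (v - n.+3) (size zs)) => l; first by apply: bzs; rewrite mem_nth.
  by rewrite nth_default // => t.
have [x nx] := nm_surj a; have bx := nm_bw nx.
have [|y [by_ /(EE _ _ bx by_) [a' [na' ny _]] [z zz [N HN]]]] := Hzs x bx.
  by apply/EE => //; exists a.
(* The support is the initial segment before which [y] and the centre may differ; its values 0 and 1
   are letters because [1 < b]. *)
exists (fun t => (t < N) : nat), y; split.
- by move=> t; case: (t < N).
- by exists N => t; rewrite ltnNge => ->.
- by rewrite (nm_fun nx na').
- exists (n.+3 + index z zs).
    rewrite mem_iota leq_addr ltn_add2l; apply: leq_trans szs.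
    by rewrite index_mem.
  by move=> t; rewrite addKn nth_index //; case: ltnP => // lt _; apply: HN.
Qed.

Lemma finite_cover : finite_set X -> exists F nu, [/\ forall v, bw b (F v), bw b nu, fsupp nu &
    forall a, X a -> exists2 y, nm y a & near nu F y].
Proof.
move=> fX; have [F bF HF] := countable_cover (finite_set_countable fX).
have /finite_setP [c /card_set_bijP [i0 [i0c inj _]]] := fX.
have ex k : exists N, forall a, X a -> i0 a = k ->
    exists2 y, nm y a & exists2 j, j \in centers & forall t, N <= t -> y t = F j t.
  have [[a [Xa ka]]|N] := pselect (exists a, X a /\ i0 a = k); last first.
    by exists 0 => a Xa ka; case: N; exists a.
  have [nu [y [_ [N HN] ny [j jc Hj]]]] := HF a Xa.
  exists N => a' Xa' ka'; rewrite (inj a' a) ?inE ?ka' //.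
  by exists y => //; exists j => // t /HN /Hj.
(* Finitely many elements have a common threshold, so one support serves them all. *)
have [N HN] := choice ex; pose M := \max_(k < c) N k.
exists F, (fun t => (t < M) : nat); split=> //.
- by move=> t; case: (t < M); [|apply: ltnW].
- by exists M => t; rewrite ltnNge => ->.
- move=> a Xa; have [y ny [j jc Hj]] := HN (i0 a) a Xa erefl; exists y => //.
  exists j => // t; case: ltnP => // lt _; apply: Hj; apply: leq_trans lt.
  exact: (leq_bigmax (Ordinal (i0c a Xa))).
Qed.

Lemma isat_countable : isat b countableF w <-> countable X.
Proof.
rewrite isat_countable_sem; split=> [[F bF H]|]; last exact: countable_cover.
(* A name close to a centre is given by the centre and a finite prefix; this finite datum enumerates
   [X]. *)
have ex a : exists c : nat * seq nat, X a ->
    nm (fun t => if t < size c.2 then nth 0 c.2 t else F c.1 t) a.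
  have [Xa|N] := pselect (X a); last by exists (0, [::]).
  have [nu [y [_ [N HN] ny [j jc Hj]]]] := H a Xa.
  exists (j, fac y 0 N) => _ /=; congr (nm _ a): ny; apply/funext => t.
  rewrite size_fac subn0; case: ltnP => lt; first by rewrite nth_fac ?subn0.
  exact: Hj (HN t lt).
have [c Hc] := choice ex.
apply/countable_injP; exists (fun a => CodeSeq.code ((c a).1 :: (c a).2)) => a a'.
move=> /set_mem Xa /set_mem Xa' /(can_inj CodeSeq.codeK) [e1 e2].
by apply: nm_fun (Hc a Xa) _; rewrite e1 e2; apply: Hc.
Qed.

Lemma isat_finite : isat b finiteF w <-> finite_set X.
Proof.
rewrite isat_finite_sem; split=> [[F [nu [bF bnu Hf H]]]|]; last exact: finite_cover.
have [[a0 Xa0]|N] := pselect (exists a, X a); last first.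
  by rewrite (_ : X = set0) //; apply/seteqP; split=> // a Xa; case: N; exists a.
have [s Hs] := near_finite Hf bF.
have ex y : exists a, forall a', nm y a' -> a = a'.
  have [[a na]|N] := pselect (exists a, nm y a); last by exists a0 => a' na'; case: N; exists a'.
  by exists a => a'; apply: nm_fun.
have [g Hg] := choice ex.
apply: (@sub_finite_set _ _ (g @` [set` s])%classic).
  move=> a Xa; have [y ny Hn] := H a Xa; exists y; last exact: Hg.
  exact: Hs (nm_bw ny) Hn.
by apply: finite_image; apply/finite_seqP; exists s.
Qed.

Lemma isat_reps F nu : (forall v, bw b (F v)) -> bw b nu -> fsupp nu -> forall y, bw b y ->
  isat b repsF (upd (upd (w1 F) n.+2 nu) n y) <->
  (exists2 a, nm y a & X a) /\ near nu F y /\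
  forall z a, nm z a -> nm y a -> near nu F z -> ~ lexlt z y.
Proof.
move=> bF bnu Hf y by_; set w2 := upd _ n y.
have bw2 : bnd b w2 by do 2!apply: bnd_upd => //; apply: bw1.
have w2nu t : w2 t n.+2 = nu t by rewrite /w2; upd_simp.
have w2n t : w2 t n = y t by rewrite /w2 updE.
have w2c t j : j \in centers -> w2 t j = F j t.
  by move=> jc; have := center_gt jc => l; rewrite /w2; upd_simp; apply: w1_hi.
have fE : isat b (finF b n.+2) w2 by rewrite isat_fin //; case: Hf => N HN; exists N => t /HN; rewrite w2nu.
have z2 z : bw b z -> [/\ bnd b (upd w2 n.+1 z), forall t, upd w2 n.+1 z t n.+2 = nu t,
    forall t, upd w2 n.+1 z t n = y t, forall t, upd w2 n.+1 z t n.+1 = z t &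
    forall t j, j \in centers -> upd w2 n.+1 z t j = F j t].
  move=> bz; split=> [|t|t|t|t j jc]; first exact: bnd_upd.
  - by rewrite updN ?w2nu //; lia.
  - by rewrite updN ?w2n //; lia.
  - by rewrite updE.
  - by have := center_gt jc => l; rewrite updN ?w2c //; lia.
rewrite /repsF !isat_and isat_p // (tail_near (F := F) (nu := nu) (y := y)) //.
split=> [[Ha [_ [Hn H]]]|[Ha [Hn H]]]; split=> //; split=> //.
  move=> z a nz ny Hz lzy; apply: H; have bz := nm_bw nz; exists z => //.
  have [b1' c1 c2 c3 c4] := z2 z bz; split; first exact/(tail_near (F := F) (nu := nu) (y := z)).
  split.
    apply/isat_lex => //.
    by congr lexlt: lzy; apply/funext => t; rewrite ?c2 ?c3.
  by apply/Heq => //; exists a; [congr (nm _ a): ny | congr (nm _ a): nz]; apply/funext => t; rewrite ?c2 ?c3.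
split=> // -[z bz [Hz [Hl He]]]; have [b1' c1 c2 c3 c4] := z2 z bz.
move/(tail_near (F := F) (nu := nu) (y := z) b1' c1 c3 c4): Hz => Hz.
move: Hl; rewrite -[X in X -> _]/(isat b (lexF b n.+1 n n.+2) _) isat_lex // => Hl.
move/(Heq b1'): He => [a ny nz].
apply: (H z a) => //.
- by congr (nm _ a): nz; apply/funext => t; rewrite c3.
- by congr (nm _ a): ny; apply/funext => t; rewrite c2.
- by congr lexlt: Hl; apply/funext => t; rewrite ?c2 ?c3.
Qed.

(** With a finite support only finitely many words are near a centre, so each element has a unique
    least name among them. *)
Lemma card_reps F nu : (forall v, bw b (F v)) -> bw b nu -> fsupp nu ->
  (forall a, X a -> exists2 y, nm y a & near nu F y) ->
  (X #= [set y | bw b y /\ isat b repsF (upd (upd (w1 F) n.+2 nu) n y)])%card.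
Proof.
move=> bF bnu Hf Hcov; have [s Hs] := near_finite Hf bF.
have ex a : exists y, X a -> [/\ nm y a, near nu F y &
    forall z, nm z a -> near nu F z -> ~ lexlt z y].
  have [Xa|N] := pselect (X a); last by exists (fun=> 0).
  have [y ny Hn] := Hcov a Xa.
  have [x [xs [nx Hx] xmin]] := @lex_min (fun y => nm y a /\ near nu F y) s y (Hs _ (nm_bw ny) Hn) (conj ny Hn).
  exists x => _; split=> // z nz Hz; apply: xmin => //; exact: Hs (nm_bw nz) Hz.
have [g Hg] := choice ex; apply/card_set_bijP; exists g; split.
- move=> a Xa; have [ng Hn gmin] := Hg a Xa; have bg := nm_bw ng; split=> //.
  apply/isat_reps => //; split; first by exists a.
  by split=> // z a' nz ng'; apply: gmin; rewrite (nm_fun ng ng').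
- move=> a a' /set_mem Xa /set_mem Xa' e.
  have [ng _ _] := Hg a Xa; have [ng' _ _] := Hg a' Xa'.
  by apply: nm_fun ng _; rewrite e.
- move=> y [by_ /(isat_reps bF bnu Hf by_) [[a na Xa] [Hn ymin]]]; exists a => //.
  have [ng Hgn gmin] := Hg a Xa; apply: contrapT => /lexlt_total [l|l].
    exact: (ymin (g a) a).
  exact: (gmin y).
Qed.

Lemma isat_mod r m : isat b (modF r m) w <-> exists c, (X #= `I_c)%card /\ c = r %[mod m].
Proof.
rewrite isat_exs //; split.
  move=> [F bF [nu bnu [/(isat_cover bF bnu) [Hf Hcov] [c [cc cr]]]]].
  by exists c; split=> //; apply: card_eq_trans (card_reps bF bnu Hf Hcov) cc.
move=> [c [cc cr]]; have fX : finite_set X by apply/finite_setP; exists c.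
have [F [nu [bF bnu Hf Hcov]]] := finite_cover fX; exists F => //; exists nu => //.
split; first by apply/isat_cover.
exists c; split=> //; apply: card_eq_trans cc; rewrite card_eq_sym.
exact: card_reps.
Qed.

End Templates.

Lemma good_exs b vs p : good b (exs vs p) <-> good b p.
Proof. by elim: vs. Qed.

Lemma good_tail b nu y js : good b (tailF b nu y js).
Proof. by elim: js. Qed.

Lemma good_some b n p eqF : good b eqF -> good b (someF b n p eqF).
Proof. by move=> ge /=; split=> //; apply: good_tail. Qed.

Lemma good_countable b n p eqF : good b p -> good b eqF -> good b (countableF b n p eqF).
Proof. by move=> gp ge; apply/good_exs; do 2!split=> //; apply: good_some. Qed.

Lemma good_finite_set b n p eqF : good b p -> good b eqF -> good b (finiteF b n p eqF).
Proof. by move=> gp ge; apply/good_exs; do 2!split=> //; apply: good_some. Qed.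

Lemma good_mod b n p eqF r m : 0 < m -> good b p -> good b eqF -> good b (modF b n p eqF r m).
Proof.
move=> m0 gp ge; apply/good_exs; split; first by do 2!split=> //; apply: good_some.
split=> //; first by do 3!split=> //; [apply: good_tail | split; [apply: good_tail | split]].
exists n.+2, (centers b n p eqF) => w x bdw bx [_ [Hf [Ht _]]].
have bd : bnd b (upd w n x) by apply: bnd_upd.
split.
  by move/(isat_fin _ bd): Hf => [N HN]; exists N => t /HN; upd_simp.
move/(isat_tail _ _ _ bd): Ht => [j jc Hj]; exists j => // t nu0.
have lj : n.+2 < j by move: jc; rewrite mem_iota => /andP[].
by have := Hj t; rewrite /upd eqxx !ifN; [apply | lia | lia].
Qed.

(** * Automata and formulas *)

Section NbaFormula.
Variables (L : eqType) (cl : L -> seq nat) (B : nba L).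

Definition nbaF vs r := autF [seq val q | q <- nba_init B]
  [seq val t.1.1 :: rcons (cl t.1.2) (val t.2) | t <- nba_trans B]
  [seq val q | q <- nba_acc B] vs r.

Lemma isat_nba b vs r w : nba_size B <= b -> (forall v, v \in vs -> v < r) ->
  isat b (nbaF vs r) w <->
  exists u : word L, (forall t, cl (u t) = [seq w t v | v <- vs]) /\ accepts B u.
Proof.
move=> lb lvs; rewrite isat_aut //; split.
  move=> [rho [brho r0 rS rI]].
  have ex t : exists x : 'I_(nba_size B) * L * 'I_(nba_size B), [/\ x \in nba_trans B,
      val x.1.1 = rho t, cl x.1.2 = [seq w t v | v <- vs] & val x.2 = rho t.+1].
    have /mapP [x xB [e1 /rcons_inj [e2 e3]]] := rS t.
    by exists x; split; rewrite //= ?e1 ?e2 ?e3.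
  have [x Hx] := choice ex; exists (fun t => (x t).1.2).
  split=> [t|]; first by case: (Hx t).
  exists (fun t => (x t).1.1); split=> [|t|N].
  - by have [_ e1 _ _] := Hx 0; rewrite -(mem_map val_inj) e1.
  - have [xB _ _ e2] := Hx t; have [_ e1 _ _] := Hx t.+1.
    have -> : (x t.+1).1.1 = (x t).2 by apply/val_inj; rewrite e1 e2.
    by case: (x t) xB => -[].
  - have [t lt rt] := rI N; exists t => //.
    by have [_ e1 _ _] := Hx t; rewrite -(mem_map val_inj) e1.
move=> [u [Hu [r' [r0 rS rI]]]]; exists (fun t => val (r' t)); split.
- by move=> t; apply: leq_trans (ltn_ord _) lb.
- by rewrite mem_map //; apply: val_inj.
- by move=> t; rewrite -Hu; apply/mapP; exists (r' t, u t, r' t.+1).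
- by move=> N; have [t lt rt] := rI N; exists t => //; rewrite mem_map //; apply: val_inj.
Qed.

End NbaFormula.

Definition letter_code (one : bool) (c : nat) : seq nat := if one then [:: c] else CodeSeq.decode c.

(* [one] tells whether letters are coded as numbers or as codes of tuples. *)
Definition autC one c vs r : iform :=
  let l := CodeSeq.decode c in
  autF (CodeSeq.decode (nth 0 l 1))
    [seq nth 0 (CodeSeq.decode t) 0 ::
         rcons (letter_code one (nth 0 (CodeSeq.decode t) 1)) (nth 0 (CodeSeq.decode t) 2)
    | t <- CodeSeq.decode (nth 0 l 2)]
    (CodeSeq.decode (nth 0 l 3)) vs r.

Lemma autC_nba (L : eqType) one (cl : L -> nat) (B : nba L) vs r :
  autC one (code_nba cl B) vs r = nbaF (fun a => letter_code one (cl a)) B vs r.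
Proof.
rewrite /autC /code_nba /nbaF CodeSeq.codeK; congr autF; [exact: CodeSeq.codeK | | exact: CodeSeq.codeK].
rewrite -[nth 0 _ 2]/(CodeSeq.code _) CodeSeq.codeK -map_comp.
by apply: eq_map => t; rewrite /ssrfun.comp CodeSeq.codeK.
Qed.

Lemma good_autC b one c vs r : good b (autC one c vs r).
Proof. by []. Qed.

Definition domC cd v r := autC true (nth 0 (CodeSeq.decode cd) 2) [:: v] r.
Definition eqC cd x y r := autC false (nth 0 (CodeSeq.decode cd) 3) [:: x; y] r.
Definition relC cd i vs r :=
  autC false (nth 0 (CodeSeq.decode (nth 0 (CodeSeq.decode cd) 4)) i) vs r.

Lemma good_and b p q : good b p -> good b q -> good b (IAnd p q).
Proof. by []. Qed.

Lemma good_domC b cd v r : good b (domC cd v r).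
Proof. exact: good_autC. Qed.

Lemma good_eqC b cd x y r : good b (eqC cd x y r).
Proof. exact: good_autC. Qed.

(* In a formula with [n] free variables, the de Bruijn index [i] becomes the
   track named [n - i.+1], so that a quantifier binds the track [n]. *)
Fixpoint trf cd b (sg : signature) n (phi : formula sg n) : iform :=
  match phi with
  | FEq n x y => eqC cd (n - x.+1) (n - y.+1) n
  | FRel n i xs => relC cd i [seq n - (val x).+1 | x <- xs] n
  | FNot n phi => INot (trf cd b phi)
  | FAnd n phi psi => IAnd (trf cd b phi) (trf cd b psi)
  | FEx n phi => IEx n (IAnd (domC cd n n.+1) (trf cd b phi))
  | FMod n r m _ phi =>
      modF b n (IAnd (domC cd n n.+1) (trf cd b phi)) (eqC cd n n.+1 n.+2) r m
  | FInf n phi =>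
      INot (finiteF b n (IAnd (domC cd n n.+1) (trf cd b phi)) (eqC cd n n.+1 n.+2))
  | FCountable n phi =>
      countableF b n (IAnd (domC cd n n.+1) (trf cd b phi)) (eqC cd n n.+1 n.+2)
  | FUncountable n phi =>
      INot (countableF b n (IAnd (domC cd n n.+1) (trf cd b phi)) (eqC cd n n.+1 n.+2))
  end.

Lemma good_trf cd b sg n (phi : formula sg n) : good b (trf cd b phi).
Proof.
elim: phi => {n} [n x y|n i xs|n phi IH|n phi IHp psi IHq|n phi IH|n r m m0 phi IH|n phi IH|n phi IH|n phi IH].
- by [].
- by [].
- exact: IH.
- exact: good_and IHp IHq.
- exact: (good_and (good_domC _ _ _ _) IH).
- exact: good_mod m0 (good_and (good_domC _ _ _ _) IH) (good_eqC _ _ _ _ _).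
- exact: (good_finite_set _ (good_and (good_domC _ _ _ _) IH) (good_eqC _ _ _ _ _)).
- exact: (good_countable _ (good_and (good_domC _ _ _ _) IH) (good_eqC _ _ _ _ _)).
- exact: (good_countable _ (good_and (good_domC _ _ _ _) IH) (good_eqC _ _ _ _ _)).
Qed.

Section Translation.
Variables (sg : signature) (A : structure sg) (d : presentation sg) (f : lang (dom_aut d) -> A).
Hypothesis Hf : is_presentation f.
Variable b : nat.
Hypotheses (b1 : 1 < b) (alph_b : alph d <= b) (dom_b : nba_size (dom_aut d) <= b)
  (eq_b : nba_size (eq_aut d) <= b) (rel_b : forall i, nba_size (rel_aut d i) <= b).

Definition nm (x : nat -> nat) (a : A) : Prop :=
  exists u : lang (dom_aut d), (forall t, x t = val (sval u t)) /\ f u = a.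

Lemma nm_bw x a : nm x a -> bw b x.
Proof. by move=> [u [Hu _]] t; rewrite Hu; apply: leq_trans (ltn_ord _) alph_b. Qed.

Lemma nm_fun x a a' : nm x a -> nm x a' -> a = a'.
Proof.
move=> [u [Hu <-]] [u' [Hu' <-]]; congr f.
case: u u' Hu Hu' => [u pu] [u' pu'] /= Hu Hu'; apply: eq_exist; apply/funext => t.
by apply/val_inj; rewrite /= -Hu -Hu'.
Qed.

Lemma nm_surj a : exists x, nm x a.
Proof.
case: Hf => /(_ a) [u Hu] _ _; exists (fun t => val (sval u t)); exists u.
by split.
Qed.

Let cd := code_presentation d.

Lemma domC_P v r w : v < r ->
  isat b (domC cd v r) w <-> exists a, nm (fun t => w t v) a.
Proof.
move=> lv; rewrite /domC /cd /code_presentation CodeSeq.codeK [nth _ _ _]/= autC_nba.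
rewrite isat_nba //; last by move=> v'; rewrite inE => /eqP ->.
split=> [[u [Hu pu]]|[a [u [Hu _]]]].
  by exists (f (exist _ u pu)); exists (exist _ u pu); split=> // t /=; have [] := Hu t.
by exists (sval u); split=> [t|]; [rewrite /= Hu | case: u {Hu}].
Qed.

Lemma isat_rel k (B : nba (k.-tuple 'I_(alph d))) (R : ('I_k -> A) -> Prop) vs r w :
  recognises B (preimage_rel f R) -> nba_size B <= b -> size vs = k ->
  (forall v, v \in vs -> v < r) ->
  isat b (autC false (code_nba (@code_letter _ _) B) vs r) w <->
  exists2 a : 'I_k -> A, forall i : 'I_k, nm (fun t => w t (nth 0 vs i)) (a i) & R a.
Proof.
move=> HB lb sv lv; rewrite autC_nba isat_nba //.
have clE (t : k.-tuple 'I_(alph d)) : letter_code false (code_letter t) = [seq val x | x <- t].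
  by rewrite /letter_code /code_letter /code_ords CodeSeq.codeK.
split.
  move=> [u [Hu pu]]; pose ws (i : 'I_k) : word 'I_(alph d) := fun t => tnth (u t) i.
  have uE : u = convolution ws.
    apply/funext => t; apply: eq_from_tnth => i; by rewrite tnth_mktuple.
  move: pu; rewrite uE => /HB [us [Hus Ra]]; exists (fun i => f (us i)) => // i.
  exists (us i); split=> // t; rewrite Hus /ws.
  have := congr1 (fun s => nth 0 s i) (Hu t); rewrite clE.
  rewrite (nth_map 0) ?sv // => <-.
  have z0 := tnth (u t) i.
  by rewrite (nth_map z0) ?size_tuple // (tnth_nth z0).
move=> [a Ha Ra]; have [us Hus] := choice Ha.
exists (convolution (fun i => sval (us i))); split.
  move=> t; rewrite clE; set T := convolution _ _.
  have sz : size [seq val x | x <- T] = k by rewrite size_map size_tuple.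
  apply: (@eq_from_nth _ 0); rewrite sz ?size_map ?sv // => i li; rewrite [RHS] (nth_map 0) ?sv //.
  have [Hu _] := Hus (Ordinal li); have := Hu t => /= ->.
  have z0 := sval (us (Ordinal li)) t.
  rewrite (nth_map z0) ?size_tuple ?card_ord //.
  by rewrite (nth_map (Ordinal li)) ?size_enum_ord // (nth_ord_enum _ (Ordinal li)).
apply/HB; exists us; split=> //.
by congr R: Ra; apply/funext => i; have [_ <-] := Hus i.
Qed.

Lemma eqC_P x y r w : x < r -> y < r ->
  isat b (eqC cd x y r) w <-> exists2 a, nm (fun t => w t x) a & nm (fun t => w t y) a.
Proof.
move=> lx ly; rewrite /eqC /cd /code_presentation CodeSeq.codeK [nth _ _ _]/=.
case: Hf => _ He _; rewrite (isat_rel _ He) //; last by move=> v; rewrite !inE => /orP[] /eqP ->.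
split=> [[a Ha E]|[a nx ny]].
  by exists (a ord0); [apply: (Ha ord0) | rewrite E; apply: (Ha ord_max)].
by exists (fun=> a) => // i; case: i => -[|[|//]].
Qed.

Lemma relC_P i vs r w : size vs = arity sg i -> (forall v, v \in vs -> v < r) ->
  isat b (relC cd i vs r) w <->
  exists2 a : 'I_(arity sg i) -> A, forall j : 'I_(arity sg i), nm (fun t => w t (nth 0 vs j)) (a j) & interp a.
Proof.
move=> sv lv; rewrite /relC /cd /code_presentation CodeSeq.codeK [nth _ [:: _; _; _; _; _] _]/=.
rewrite CodeSeq.codeK (nth_map i) ?size_enum_ord // nth_ord_enum.
by case: Hf => _ _ Hr; apply: isat_rel.
Qed.

Lemma nm_env_cons n (e : 'I_n -> A) w a : nm (fun t => w t n) a ->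
  (forall i : 'I_n, nm (fun t => w t (n - i.+1)) (e i)) ->
  forall i : 'I_n.+1, nm (fun t => w t (n.+1 - i.+1)) (env_cons a e i).
Proof.
move=> na He i; rewrite /env_cons; case: unliftP => [j ->|->]; last by rewrite subn1.
by rewrite /= /bump leq0n add1n subSS; apply: He.
Qed.

Lemma trf_correct n (phi : formula sg n) (e : 'I_n -> A) w : bnd b w ->
  (forall i : 'I_n, nm (fun t => w t (n - i.+1)) (e i)) ->
  isat b (trf cd b phi) w <-> sat phi e.
Proof.
have lt_n m (i : 'I_m) : m - i.+1 < m by have := ltn_ord i; lia.
have dom_imp m (psi : formula sg m.+1) (e' : 'I_m -> A) w' :
    (forall e w, bnd b w -> (forall i : 'I_m.+1, nm (fun t => w t (m.+1 - i.+1)) (e i)) ->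
       isat b (trf cd b psi) w <-> sat psi e) ->
    bnd b w' -> (forall i : 'I_m, nm (fun t => w' t (m - i.+1)) (e' i)) ->
    isat b (IAnd (domC cd m m.+1) (trf cd b psi)) w' <->
    exists2 a, nm (fun t => w' t m) a & sat psi (env_cons a e').
  move=> IH bd He; rewrite isat_and domC_P //; split=> [[[a na] H]|[a na H]].
    by exists a => //; apply/(IH _ w') => //; apply: nm_env_cons.
  by split; [exists a | apply/(IH (env_cons a e')) => //; apply: nm_env_cons].
(* The templates change only tracks from [m] on, while the free variables occupy the tracks below
   [m]. *)
have tmpl m (psi : formula sg m.+1) (e' : 'I_m -> A) w0 :
    (forall e w, bnd b w -> (forall i : 'I_m.+1, nm (fun t => w t (m.+1 - i.+1)) (e i)) ->
       isat b (trf cd b psi) w <-> sat psi e) ->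
    bnd b w0 -> (forall i : 'I_m, nm (fun t => w0 t (m - i.+1)) (e' i)) ->
    forall w', bnd b w' -> (forall t v, v < m -> w' t v = w0 t v) ->
    isat b (IAnd (domC cd m m.+1) (trf cd b psi)) w' <->
    exists2 a, nm (fun t => w' t m) a & [set a | sat psi (env_cons a e')]%classic a.
  move=> IH bd0 He w' bd' Hw; apply: dom_imp => // i.
  have -> // : (fun t => w' t (m - i.+1)) = (fun t => w0 t (m - i.+1)).
  by apply/funext => t; apply: Hw.
have gd m (psi : formula sg m) k : good b (IAnd (domC cd k k.+1) (trf cd b psi)).
  exact: (good_and (good_domC _ _ _ _) (good_trf _ _ _)).
have eqm m w' : bnd b w' -> isat b (eqC cd m m.+1 m.+2) w' <->
    exists2 a, nm (fun t => w' t m) a & nm (fun t => w' t m.+1) a.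
  by move=> _; apply: eqC_P; lia.
elim: phi e w => {n} [n x y|n i xs|n phi IH|n phi IHp psi IHq|n phi IH|n r m m0 phi IH|n phi IH|n phi IH|n phi IH] e w bd He.
- rewrite [trf _ _ _]/= eqC_P //=; split=> [[a nx ny]|E].
    by rewrite (nm_fun (He x) nx) (nm_fun (He y) ny).
  by exists (e x); [apply: He | rewrite E; apply: He].
- rewrite [trf _ _ _]/= relC_P; last 2 first.
  + by rewrite size_map size_tuple.
  + by move=> v /mapP [x _ ->].
  have nE (j : 'I_(arity sg i)) : nth 0 [seq n - (val x).+1 | x <- xs] j = n - (tnth xs j).+1.
    by rewrite (nth_map (tnth xs j)) ?size_tuple // -tnth_nth.
  rewrite [sat _ _]/=; split=> [[a Ha Ra]|Ra].
    by congr interp: Ra; apply/funext => j; apply: nm_fun (Ha j) _; rewrite nE; apply: He.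
  by exists (fun j => e (tnth xs j)) => // j; rewrite nE; apply: He.
- by rewrite /= (IH e).
- by rewrite /= (IHp e) // (IHq e).
- rewrite [trf _ _ _]/= [isat _ _ _]/=; split.
    move=> [x bx H]; have /dom_imp : isat b (IAnd (domC cd n n.+1) (trf cd b phi)) (upd w n x) by [].
    move=> /(_ e IH (bnd_upd _ bd bx)) [|a na Ha]; last by exists a.
    by move=> i; have := He i; congr nm; apply/funext => t; rewrite updN //; have := lt_n _ i; lia.
  move=> [a Ha]; have [x nx] := nm_surj a; have bx := nm_bw nx; exists x => //.
  apply: (dom_imp n phi e (upd w n x) IH (bnd_upd _ bd bx) _).2.
    by move=> i; have := He i; congr nm; apply/funext => t; rewrite updN //; have := lt_n _ i; lia.
  by exists a => //; congr (nm _ a): nx; apply/funext => t; rewrite updE.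
- exact: (isat_mod b1 bd nm_bw nm_fun nm_surj (tmpl n phi e w IH bd He) (eqm n) (gd _ phi n) (good_eqC _ _ _ _ _)).
- rewrite [trf _ _ _]/= [isat _ _ _]/= -[isat _ (exs _ _) _]/(isat b (finiteF _ _ _ _) w).
  by rewrite (isat_finite b1 bd nm_bw nm_fun nm_surj (tmpl n phi e w IH bd He) (eqm n) (gd _ phi n) (good_eqC _ _ _ _ _)).
- exact: (isat_countable b1 bd nm_bw nm_fun nm_surj (tmpl n phi e w IH bd He) (eqm n) (gd _ phi n) (good_eqC _ _ _ _ _)).
- rewrite [trf _ _ _]/= [isat _ _ _]/=.
  by rewrite (isat_countable b1 bd nm_bw nm_fun nm_surj (tmpl n phi e w IH bd He) (eqm n) (gd _ phi n) (good_eqC _ _ _ _ _)).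
Qed.

End Translation.

(** * Büchi automata from finite congruences *)

Lemma mk_nba (L Q : finType) (init acc : pred Q) (tr : Q -> L -> Q -> bool) :
  exists B : nba L, forall u, accepts B u <-> exists r : nat -> Q,
    [/\ init (r 0), forall i, tr (r i) (u i) (r i.+1) &
        forall i, exists2 j, i <= j & acc (r j)].
Proof.
exists (@Nba L #|Q| [seq enum_rank q | q <- enum init]
  [seq (enum_rank x.1.1, x.1.2, enum_rank x.2) | x <- enum [pred x : Q * L * Q | tr x.1.1 x.1.2 x.2]]
  [seq enum_rank q | q <- enum acc]) => u.
split=> [[r [/= r0 rS rI]]|[r [r0 rS rI]]].
  have E (p : pred Q) q : (q \in [seq enum_rank q | q <- enum p]) = p (enum_val q).
    by rewrite -{1}(enum_valK q) mem_map; [rewrite mem_enum | apply: enum_rank_inj].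
  exists (fun i => enum_val (r i)); split=> [|i|i]; first by rewrite -E.
    have /mapP [x] := rS i; rewrite mem_enum inE => Hx [-> -> ->].
    by rewrite !enum_rankK.
  by have [j lj] := rI i; rewrite E => aj; exists j.
exists (fun i => enum_rank (r i)); split=> [|i|i] /=.
- by apply: map_f; rewrite mem_enum.
- apply/mapP; exists (r i, u i, r i.+1) => //; rewrite mem_enum inE; exact: rS.
- by have [j lj aj] := rI i; exists j => //; apply: map_f; rewrite mem_enum.
Qed.

(* The automaton guesses a pair of colours [(s, e)] and a factorisation of its
   input into a block of colour [s] followed by blocks of colour [e]. *)
Lemma recog_nba (L : finType) (col : L -> nat -> nat) b K R : recog b K R ->
  (forall a v, col a v < b) ->
  exists B : nba L, forall u, accepts B u <-> R (fun t => col (u t)).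
Proof.
move=> [T [h [cT ch sh]]] bcol; have [op hop] := congruence_op ch.
(* A guess is admissible if some word in [R] factors with these colours; saturation then puts every
   word with such a factorisation in [R]. *)
pose ok (se : T * T) := `[< exists w c, [/\ bnd b w, cuts c, h (fac w (c 0) (c 1)) = se.1,
   forall i, h (fac w (c i.+1) (c i.+2)) = se.2 & R w] >].
(* A state holds the guess, the colour of the current block read so far, whether this block is the
   first one, and a mark set when a block has just been closed. Marked states are accepting. *)
pose Q : finType := ((T * T) * T * (bool * bool))%type.
pose tgt (se : T * T) (fst : bool) := if fst then se.1 else se.2.
pose init (q : Q) := [&& ok q.1.1, q.1.2 == h [::], q.2.1 & ~~ q.2.2].
pose tr (q : Q) a (q' : Q) := let t := op q.1.2 (h [:: col a]) in
  (q' == (q.1.1, t, (q.2.1, false))) ||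
  (t == tgt q.1.1 q.2.1) && (q' == (q.1.1, h [::], (false, true))).
have [B HB] := mk_nba init (fun q : Q => q.2.2) tr; exists B => u; rewrite HB.
set W := fun t => col (u t).
have bW : bnd b W by move=> t v; apply: bcol.
have facS i j : i <= j -> h (fac W i j.+1) = op (h (fac W i j)) (h [:: col (u j)]).
  by move=> l; rewrite (fac_cat W l (leqnSn j)) hop fac1.
split.
  move=> [r [/and4P [ok0 /eqP t0 f0 m0] rS rI]].
  have seE i : (r i).1.1 = (r 0).1.1.
    by elim: i => // i IH; have := rS i; rewrite /tr IH => /orP[/eqP ->|/andP[_ /eqP ->]].
  have nx i : exists j, (i < j) && (r j).2.2 by have [j lj mj] := rI i.+1; exists j; rewrite lj.
  pose nxt i := ex_minn (nx i).
  pose c k := iter k nxt 0.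
  have Hc : cuts c by split=> // i /=; rewrite /nxt; case: ex_minnP => j /andP[].
  have inv k j : c k <= j < c k.+1 ->
      (r j).1.2 = h (fac W (c k) j) /\ (r j).2.1 = (k == 0).
    have mk : k != 0 -> (r (c k)).2.2.
      by case: k => // k _ /=; rewrite /nxt; case: ex_minnP => j' /andP[].
    have nomark i : c k < i < c k.+1 -> (r i).2.2 = false.
      move=> /andP[l1]; rewrite /= /nxt; case: ex_minnP => j' _ jmin lj.
      by apply/negP => mi; have := jmin i; rewrite l1 mi => /(_ isT); lia.
    elim: j => [|j IH] lj.
      have k0 : k = 0 by have := cuts_ge k Hc; lia.
      by rewrite k0 [c 0]/= fac_nil t0 f0.
    case: (ltngtP j.+1 (c k)) => l; first by lia.
      have [IH1 IH2] := IH ltac:(lia).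
      have := rS j; rewrite /tr => /orP[/eqP ->|/andP[_ /eqP E]].
        by rewrite /= IH1 IH2 facS //; lia.
      by have := nomark j.+1 ltac:(lia); rewrite E.
    have k0 : k != 0 by apply/eqP => k0; rewrite k0 in l.
    have := rS j; rewrite /tr => /orP[/eqP E|/andP[_ /eqP ->]].
      by have := mk k0; rewrite -l E.
    by rewrite /= -l fac_nil (negbTE k0).
  have blk k : h (fac W (c k) (c k.+1)) = tgt (r 0).1.1 (k == 0).
    have lk := cuts_lt Hc (ltnSn k).
    have [j Ej] : exists j, c k.+1 = j.+1 by case: (c k.+1) lk => // j; exists j.
    have [|I1 I2] := inv k j; first by lia.
    have mk : (r (c k.+1)).2.2 by rewrite /= /nxt; case: ex_minnP => j' /andP[].
    have := rS j; rewrite /tr -Ej => /orP[/eqP E|/andP[/eqP E _]]; first by rewrite E in mk.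
    by rewrite Ej facS; [rewrite -I1 E seE I2 | lia].
  move/asboolP: ok0 => [w [c' [bw' Hc' E1 E2 Rw]]].
  apply: (sh w W c' c bw' bW Hc' Hc) Rw; case=> [|i]; first by rewrite E1 blk.
  by rewrite E2 blk.
(* Conversely, a homogeneous factorisation of the input is the guess of an accepting run. *)
move=> RW; have [e [n [n_lt He]]] := ramsey (fun a c => h (fac W a c)).
pose c i := if i is k.+1 then n k.+1 else 0.
have Hc : cuts c.
  split=> // -[|i]; last exact: n_lt.
  by apply: leq_ltn_trans (n_lt 0).
pose se := (h (fac W 0 (c 1)), e).
have okse : ok se by apply/asboolP; exists W, c; split=> // i; apply: He.
have blk k : h (fac W (c k) (c k.+1)) = tgt se (k == 0) by case: k => [|k] //=; apply: He.
exists (fun t => (se, h (fac W (c (cut_idx c t)) t), (cut_idx c t == 0, (0 < t) && (t == c (cut_idx c t))))).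
split=> [|t|N].
- by rewrite /init /= okse fac_nil eqxx.
- have lt := cut_idxP t Hc; rewrite /tr [(_, _).1.2]/= -facS; last by lia.
  rewrite [cut_idx c t.+1]/=; case: (eqVneq (c (cut_idx c t).+1) t.+1) => [E|NE].
    apply/orP; right; apply/andP; split; first by rewrite -E blk.
    by apply/eqP; rewrite -E fac_nil eqxx [in 0 < _]E.
  rewrite (_ : (t.+1 == c (cut_idx c t)) = false) ?andbF ?eqxx //; lia.
- exists (c N.+1); first by have := cuts_ge N.+1 Hc; lia.
  rewrite (@cut_idx_uniq c _ N.+1) //= ?eqxx ?andbT; last first.
    by have := cuts_lt Hc (ltnSn N.+1); rewrite /=; lia.
  by have := cuts_ge N.+1 Hc; rewrite /=; lia.
Qed.

(** * Programs *)

Section CompApp.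
Context {G A B C D E : Type} {EG : Enc G} {EA : Enc A} {EB : Enc B} {EC : Enc C}
  {ED : Enc D} {EE : Enc E}.

Lemma comp_app2 (F : A -> B -> C) : computable (fun p : A * B => F p.1 p.2) ->
  forall (f : G -> A) (g : G -> B), computable f -> computable g -> computable (fun x => F (f x) (g x)).
Proof. by move=> cF f g cf cg; apply: (comp_app cF (g := fun x => (f x, g x))); apply: comp_pair. Qed.

Lemma comp_app3 (F : A -> B -> C -> D) : computable (fun p : A * B * C => F p.1.1 p.1.2 p.2) ->
  forall (f : G -> A) (g : G -> B) (h : G -> C), computable f -> computable g -> computable h ->
  computable (fun x => F (f x) (g x) (h x)).
Proof.
move=> cF f g h cf cg chh; apply: (comp_app cF (g := fun x => (f x, g x, h x))).
by do 2!apply: comp_pair => //.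
Qed.

Lemma comp_app4 (F : A -> B -> C -> D -> E) :
  computable (fun p : A * B * C * D => F p.1.1.1 p.1.1.2 p.1.2 p.2) ->
  forall (f : G -> A) (g : G -> B) (h : G -> C) (k : G -> D), computable f -> computable g -> computable h ->
  computable k -> computable (fun x => F (f x) (g x) (h x) (k x)).
Proof.
move=> cF f g h k cf cg chh ck; apply: (comp_app cF (g := fun x => (f x, g x, h x, k x))).
by do 3!apply: comp_pair => //.
Qed.

End CompApp.

(* Dispatching on the head symbol keeps unification from unfolding definitions. *)
Ltac head_of t := lazymatch t with ?f _ => head_of f | _ => t end.
Ltac comp_user h := fail.
Ltac comp_head h := lazymatch h with
  | @fst => apply: comp_fst | @snd => apply: comp_snd | @pair => apply: comp_pair
  | @cons => apply: comp_cons | @rcons => apply: comp_rcons | @cat => apply: comp_cat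
  | @map => apply: comp_map | @filter => apply: comp_filter | @all => apply: comp_all
  | @has => apply: comp_has | @count => apply: comp_count | @flatten => apply: comp_flatten
  | @iota => apply: comp_iota | @size => apply: comp_size | @nth => apply: comp_nth
  | @in_mem => apply: comp_mem | @eq_op => apply: comp_eq | @leq => apply: comp_leq
  | @negb => apply: comp_negb | @andb => apply: comp_andb | @orb => apply: comp_orb
  | @CodeSeq.decode => apply: comp_decode | @CodeSeq.code => apply: comp_code
  | S => apply: comp_succ | @predn => apply: comp_pred | @addn => apply: comp_add
  | @subn => apply: comp_sub | @muln => apply: comp_mul | @modn => apply: comp_modn
  | @expn => apply: comp_exp | @factorial => apply: comp_fact | @enc => apply: comp_enc
  | _ => comp_user h
  end.
Ltac comp_step := cbv beta zeta; first
  [ assumption | exact: comp_const | exact: comp_id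
  | lazymatch goal with |- @computable ?A _ _ _ ?F =>
      let r := constr:(fun x : A =>
        ltac:(let y := eval cbv beta in (F x) in let h := head_of y in exact h)) in
      lazymatch r with fun _ => ?h => comp_head h | _ => apply: comp_if end
    end ].
Ltac comp_tac := repeat comp_step.

Lemma comp_words G {EG : Enc G} (b n : G -> nat) : computable b -> computable n ->
  computable (fun g => words (b g) (n g)).
Proof.
apply: (comp_app2 (F := words)).
apply: (comp_ext (f := fun p : nat * nat => nrec [:: [::]]
  (fun _ W => flatten [seq [seq a :: l | l <- W] | a <- iota 0 p.1]) p.2)).
  by move=> [c k] /=; elim: k => //= k ->.
apply: (@comp_nrec _ _ _ _ (fun p : nat * nat => p.2) (fun _ => [:: [::]])
  (fun p _ W => flatten [seq [seq a :: l | l <- W] | a <- iota 0 p.1])); comp_tac.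
Qed.

Lemma comp_set_nth G A {EG : Enc G} {EA : Enc A} (d : A) (s : G -> seq A) (n : G -> nat) (y : G -> A) :
  computable s -> computable n -> computable y -> computable (fun g => set_nth d (s g) (n g) (y g)).
Proof.
apply: (comp_app3 (F := fun s n y => set_nth d s n y)).
apply: (comp_ext (f := fun p : seq A * nat * A =>
  [seq if i == p.1.2 then p.2 else nth d p.1.1 i | i <- iota 0 (p.1.2.+1 + (size p.1.1 - p.1.2.+1))])).
  move=> [[t k] a]; apply: (@eq_from_nth _ d).
    by rewrite size_map size_iota size_set_nth /maxn /fst /snd; case: ltnP; lia.
  move=> i; rewrite size_map size_iota => li.
  by rewrite (nth_map 0) ?size_iota // nth_iota // add0n nth_set_nth.
comp_tac.
Qed.

(** * Word formulas as computable data *)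

Fixpoint icode (p : iform) : nat :=
  match p with
  | ILoc vs tab => CodeSeq.code [:: 0; enc vs; enc tab]
  | IFirst vs tab => CodeSeq.code [:: 1; enc vs; enc tab]
  | IInf vs tab => CodeSeq.code [:: 2; enc vs; enc tab]
  | IShift v1 v2 => CodeSeq.code [:: 3; v1; v2]
  | INot p => CodeSeq.code [:: 4; icode p]
  | IAnd p q => CodeSeq.code [:: 5; icode p; icode q]
  | IEx v p => CodeSeq.code [:: 6; v; icode p]
  | IMod v r m p => CodeSeq.code [:: 7; v; r; m; icode p]
  end.

Lemma icode_inj : injective icode.
Proof.
elim=> [vs tab|vs tab|vs tab|v1 v2|p IH|p IHp q IHq|v p IH|v r m p IH];
  case=> [vs' tab'|vs' tab'|vs' tab'|v1' v2'|p'|p' q'|v' p'|v' r' m' p'];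
  move/(can_inj CodeSeq.codeK) => // -[].
- by move=> /enc_list_inj -> /enc_list_inj ->.
- by move=> /enc_list_inj -> /enc_list_inj ->.
- by move=> /enc_list_inj -> /enc_list_inj ->.
- by move=> -> ->.
- by move=> /IH ->.
- by move=> /IHp -> /IHq ->.
- by move=> -> /IH ->.
- by move=> -> -> -> /IH ->.
Qed.

#[global] Instance enc_iform : Enc iform := {| enc := icode; enc_inj := icode_inj |}.
HB.instance Definition _ := Equality.copy iform (inj_type icode_inj).

Section IformComp.
Context {G : Type} {EG : Enc G}.

Lemma comp_of_code A {EA : Enc A} (f : G -> A) c : (forall g, enc (f g) = c g) ->
  computable c -> computable f.
Proof. by move=> e [q Hq]; exists q => g; rewrite e. Qed.

Lemma comp_ILoc (vs : G -> seq nat) tab : computable vs -> computable tab -> computable (fun g => ILoc (vs g) (tab g)).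
Proof. by move=> c1 c2; apply: (comp_of_code (c := fun g => CodeSeq.code [:: 0; enc (vs g); enc (tab g)])) => //; comp_tac. Qed.
Lemma comp_IFirst (vs : G -> seq nat) tab : computable vs -> computable tab -> computable (fun g => IFirst (vs g) (tab g)).
Proof. by move=> c1 c2; apply: (comp_of_code (c := fun g => CodeSeq.code [:: 1; enc (vs g); enc (tab g)])) => //; comp_tac. Qed.
Lemma comp_IInf (vs : G -> seq nat) tab : computable vs -> computable tab -> computable (fun g => IInf (vs g) (tab g)).
Proof. by move=> c1 c2; apply: (comp_of_code (c := fun g => CodeSeq.code [:: 2; enc (vs g); enc (tab g)])) => //; comp_tac. Qed.
Lemma comp_IShift (v1 v2 : G -> nat) : computable v1 -> computable v2 -> computable (fun g => IShift (v1 g) (v2 g)).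
Proof. by move=> c1 c2; apply: (comp_of_code (c := fun g => CodeSeq.code [:: 3; v1 g; v2 g])) => //; comp_tac. Qed.
Lemma comp_INot (p : G -> iform) : computable p -> computable (fun g => INot (p g)).
Proof. by move=> c1; apply: (comp_of_code (c := fun g => CodeSeq.code [:: 4; enc (p g)])) => //; comp_tac. Qed.
Lemma comp_IAnd (p q : G -> iform) : computable p -> computable q -> computable (fun g => IAnd (p g) (q g)).
Proof. by move=> c1 c2; apply: (comp_of_code (c := fun g => CodeSeq.code [:: 5; enc (p g); enc (q g)])) => //; comp_tac. Qed.
Lemma comp_IEx (v : G -> nat) (p : G -> iform) : computable v -> computable p -> computable (fun g => IEx (v g) (p g)).
Proof. by move=> c1 c2; apply: (comp_of_code (c := fun g => CodeSeq.code [:: 6; v g; enc (p g)])) => //; comp_tac. Qed.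
Lemma comp_IMod (v r m : G -> nat) (p : G -> iform) : computable v -> computable r -> computable m -> computable p ->
  computable (fun g => IMod (v g) (r g) (m g) (p g)).
Proof. by move=> c1 c2 c3 c4; apply: (comp_of_code (c := fun g => CodeSeq.code [:: 7; v g; r g; m g; enc (p g)])) => //; comp_tac. Qed.

End IformComp.

Ltac comp_user1 h := lazymatch h with
  | @INot => apply: comp_INot
  | @IAnd => apply: comp_IAnd
  | @IEx => apply: comp_IEx
  | @IMod => apply: comp_IMod
  | @ILoc => apply: comp_ILoc
  | @IFirst => apply: comp_IFirst
  | @IInf => apply: comp_IInf
  | @IShift => apply: comp_IShift
  | @words => apply: comp_words
  | @set_nth => apply: comp_set_nth
  end.
Ltac comp_user h ::= comp_user1 h.

Definition iargs (p : iform) : seq nat := CodeSeq.decode (enc p).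
Definition iarg (p : iform) k : nat := nth 0 (iargs p) k.
Definition ivars (p : iform) : seq nat := CodeSeq.decode (iarg p 1).
Definition itab (p : iform) : seq (seq nat) := [seq CodeSeq.decode l | l <- CodeSeq.decode (iarg p 2)].
Definition isubs (p : iform) : seq iform :=
  match p with
  | INot p => [:: p] | IAnd p q => [:: p; q] | IEx _ p => [:: p] | IMod _ _ _ p => [:: p]
  | _ => [::]
  end.

Section IformDestr.
Context {G : Type} {EG : Enc G}.

Lemma comp_iargs (p : G -> iform) : computable p -> computable (fun g => iargs (p g)).
Proof. by move=> cp; apply: comp_decode; apply: comp_enc. Qed.

Lemma comp_iarg (p : G -> iform) k : computable p -> computable (fun g => iarg (p g) k).
Proof. by move=> cp; apply: comp_nth; [exact: comp_const | apply: comp_iargs | exact: comp_const]. Qed.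

Lemma comp_ivars (p : G -> iform) : computable p -> computable (fun g => ivars (p g)).
Proof. by move=> cp; apply: comp_decode; apply: comp_iarg. Qed.

Lemma comp_itab (p : G -> iform) : computable p -> computable (fun g => itab (p g)).
Proof.
move=> cp; apply: comp_map; first by apply: comp_decode; comp_tac.
by apply: comp_decode; apply: comp_iarg.
Qed.

Lemma comp_isubs (p : G -> iform) : computable p -> computable (fun g => isubs (p g)).
Proof.
move=> cp; apply: (comp_of_code (c := fun g => CodeSeq.code
  (if iarg (p g) 0 == 4 then [:: iarg (p g) 1] else
   if iarg (p g) 0 == 5 then [:: iarg (p g) 1; iarg (p g) 2] else
   if iarg (p g) 0 == 6 then [:: iarg (p g) 2] else
   if iarg (p g) 0 == 7 then [:: iarg (p g) 4] else [::]))).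
  by move=> g; rewrite /iarg /iargs; case: (p g) => *; rewrite CodeSeq.codeK.
have ca k : computable (fun g => iarg (p g) k) := comp_iarg k cp.
apply: comp_code.
by repeat first [apply: comp_if | apply: comp_eq | apply: comp_cons | exact: comp_nil | exact: ca | exact: comp_const].
Qed.

End IformDestr.

Lemma lt_code s k : k \in s -> k < CodeSeq.code s.
Proof. by move=> ks; apply: (allP (CodeSeq.ltn_code s)). Qed.

Definition Kb_comb b p (rs : seq nat) : nat :=
  if iarg p 0 == 4 then nth 0 rs 0 else
  if iarg p 0 == 5 then nth 0 rs 0 * nth 0 rs 1 else
  if iarg p 0 == 6 then 2 ^ nth 0 rs 0 else
  if iarg p 0 == 7 then (2 * (iarg p 3).+1) ^ nth 0 rs 0 else (2 * b.+1 ^ 2).+1.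

Lemma icode_gt0 p : 0 < icode p.
Proof. by case: p => *; apply: leq_ltn_trans (leq0n _) (lt_code (mem_head _ _)). Qed.

Lemma Kb_treerec b p n : icode p <= n -> treerec isubs (Kb_comb b) n p = Kb b p.
Proof.
elim: p n => [vs tab|vs tab|vs tab|v1 v2|p IH|p IHp q IHq|v p IH|v r m p IH] n ln.
all: have : 0 < n by apply: leq_trans ln; apply: icode_gt0.
all: case: n ln => // n ln _.
all: rewrite [treerec _ _ _ _]/= /Kb_comb /iarg /iargs CodeSeq.codeK //=.
- by rewrite IH //; rewrite -ltnS; apply: leq_trans ln; apply: lt_code; rewrite !inE eqxx orbT.
- by rewrite IHp ?IHq //; rewrite -ltnS; apply: leq_trans ln; apply: lt_code; rewrite !inE eqxx !orbT.
- by rewrite IH //; rewrite -ltnS; apply: leq_trans ln; apply: lt_code; rewrite !inE eqxx !orbT.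
- by rewrite IH //; rewrite -ltnS; apply: leq_trans ln; apply: lt_code; rewrite !inE eqxx !orbT.
Qed.

Ltac comp_user2 h := lazymatch h with
  | @iarg => apply: comp_iarg
  | @ivars => apply: comp_ivars
  | @itab => apply: comp_itab
  | @isubs => apply: comp_isubs
  | _ => comp_user1 h
  end.
Ltac comp_user h ::= comp_user2 h.

Lemma comp_Kb G {EG : Enc G} b p : computable b -> computable p -> computable (fun g : G => Kb (b g) (p g)).
Proof.
apply: (comp_app2 (F := Kb)).
apply: (comp_ext (f := fun q : nat * iform => treerec isubs (Kb_comb q.1) (enc q.2) q.2)).
  by move=> [b0 p0]; apply: Kb_treerec.
apply: (@comp_treerec _ _ _ _ _ _ (fun _ => isubs) (fun q => Kb_comb q.1)
  (fun q : nat * iform => enc q.2) (fun q => q.2)); rewrite /Kb_comb; comp_tac.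
Qed.

(** A call of the evaluator, apart from the fixed bound: formula, preperiod and period,
    environment. *)
Definition qy : Type := iform * (nat * nat) * seq (seq nat).

Definition sub0 (p : iform) : iform := nth (IShift 0 0) (isubs p) 0.

Definition ev_sub b (q : qy) : seq qy :=
  let p := q.1.1 in let P := q.1.2.1 in let Q := q.1.2.2 in let E := q.2 in
  if iarg p 0 == 6 then
    let K := (Kb b (sub0 p)).+1 in
    [seq (sub0 p, (P + K * Q, K`! * Q),
          set_nth [::] [seq expand P Q (P + K * Q) (K`! * Q) l | l <- E] (iarg p 1) x)
    | x <- words b (P + K * Q + K`! * Q)]
  else if iarg p 0 == 7 then
    [seq (sub0 p, (P, Q), set_nth [::] E (iarg p 1) x) | x <- words b (P + Q)]
  else [seq (p', (P, Q), E) | p' <- isubs p].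

Definition ev_comb (q : qy) (rs : seq bool) : bool :=
  let p := q.1.1 in let P := q.1.2.1 in let Q := q.1.2.2 in let E := q.2 in
  let row t := [seq upw P Q (nth [::] E v) t | v <- ivars p] in
  if iarg p 0 == 0 then all (fun t => row t \in itab p) (iota 0 (P + Q)) else
  if iarg p 0 == 1 then row 0 \in itab p else
  if iarg p 0 == 2 then has (fun t => row t \in itab p) (iota P Q) else
  if iarg p 0 == 3 then all (fun t => upw P Q (nth [::] E (iarg p 2)) t ==
     upw P Q (nth [::] E (iarg p 1)) t.+1) (iota 0 (P + Q)) else
  if iarg p 0 == 4 then ~~ nth false rs 0 else
  if iarg p 0 == 5 then nth false rs 0 && nth false rs 1 else
  if iarg p 0 == 6 then has id rs else
  count id rs %% iarg p 3 == iarg p 2 %% iarg p 3.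

Lemma treerecS A B (sub : A -> seq A) (comb : A -> seq B -> B) n a :
  treerec sub comb n.+1 a = comb a [seq treerec sub comb n x | x <- sub a].
Proof. by []. Qed.

Lemma decode_enc (vs : seq nat) : CodeSeq.decode (enc vs) = vs.
Proof. by rewrite enc_code CodeSeq.codeK. Qed.

Lemma decode_enc2 (tab : seq (seq nat)) : [seq CodeSeq.decode l | l <- CodeSeq.decode (enc tab)] = tab.
Proof.
rewrite /enc /= /enc_list CodeSeq.codeK -map_comp (@eq_map _ _ _ id) ?map_id // => l.
exact: decode_enc.
Qed.

Lemma iargsE p : iargs p =
  match p with
  | ILoc vs tab => [:: 0; enc vs; enc tab]
  | IFirst vs tab => [:: 1; enc vs; enc tab]
  | IInf vs tab => [:: 2; enc vs; enc tab]
  | IShift v1 v2 => [:: 3; v1; v2]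
  | INot p => [:: 4; icode p]
  | IAnd p q => [:: 5; icode p; icode q]
  | IEx v p => [:: 6; v; icode p]
  | IMod v r m p => [:: 7; v; r; m; icode p]
  end.
Proof. by case: p => *; apply: CodeSeq.codeK. Qed.

Lemma ivarsE p : ivars p =
  match p with ILoc vs _ | IFirst vs _ | IInf vs _ => vs | _ => ivars p end.
Proof. by case: p => // *; rewrite /ivars /iarg iargsE; apply: decode_enc. Qed.

Lemma itabE p : itab p =
  match p with ILoc _ tab | IFirst _ tab | IInf _ tab => tab | _ => itab p end.
Proof. by case: p => // *; rewrite /itab /iarg iargsE; apply: decode_enc2. Qed.

Lemma ev_treerec b p n P Q E : icode p <= n ->
  treerec (ev_sub b) ev_comb n (p, (P, Q), E) = ev b p P Q E.
Proof.
elim: p n P Q E => [vs tab|vs tab|vs tab|v1 v2|p IH|p IHp q IHq|v p IH|v r m p IH] n P Q E ln.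
all: have : 0 < n by apply: leq_trans ln; apply: icode_gt0.
all: case: n ln => // n ln _.
all: rewrite treerecS.
- by rewrite /ev_comb ivarsE itabE /iarg iargsE.
- by rewrite /ev_comb ivarsE itabE /iarg iargsE.
- by rewrite /ev_comb ivarsE itabE /iarg iargsE.
- by rewrite /ev_comb /iarg iargsE.
- rewrite /ev_comb /ev_sub /iarg iargsE [LHS]/= IH // -ltnS.
  by apply: leq_trans ln; apply: lt_code; rewrite !inE eqxx orbT.
- rewrite /ev_comb /ev_sub /iarg iargsE [LHS]/= IHp ?IHq // -ltnS;
  by apply: leq_trans ln; apply: lt_code; rewrite !inE eqxx !orbT.
- have lp : icode p <= n.
    by rewrite -ltnS; apply: leq_trans ln; apply: lt_code; rewrite !inE eqxx !orbT.
  rewrite /ev_comb /ev_sub /iarg iargsE -map_comp.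
  rewrite [nth 0 _ 0]/= [nth 0 _ 1]/= /sub0 [isubs _]/= [nth _ [:: p] 0]/= [ev b _ P Q E]/=.
  by rewrite [LHS]has_map; apply: eq_has => x; apply: IH.
- have lp : icode p <= n.
    by rewrite -ltnS; apply: leq_trans ln; apply: lt_code; rewrite !inE eqxx !orbT.
  rewrite /ev_comb /ev_sub /iarg iargsE -map_comp.
  rewrite [nth 0 _ 0]/= [nth 0 _ 1]/= /sub0 [isubs _]/= [nth _ [:: p] 0]/= [ev b _ P Q E]/=.
  rewrite [X in X %% _ == _]count_map [nth 0 _ 2]/= [nth 0 _ 3]/=.
  by congr (_ %% _ == _); apply: eq_count => x; apply: IH.
Qed.

Lemma comp_upw G {EG : Enc G} (P Q : G -> nat) l t : computable P -> computable Q -> computable l -> computable t ->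
  computable (fun g => upw (P g) (Q g) (l g) (t g)).
Proof. by apply: (comp_app4 (F := upw)); rewrite /upw; comp_tac. Qed.

Ltac comp_user3 h := lazymatch h with
  | @Kb => apply: comp_Kb
  | @upw => apply: comp_upw
  | _ => comp_user2 h
  end.
Ltac comp_user h ::= comp_user3 h.

Lemma comp_ev G {EG : Enc G} b p P Q E : computable b -> computable p -> computable P -> computable Q -> computable E ->
  computable (fun g : G => ev (b g) (p g) (P g) (Q g) (E g)).
Proof.
move=> cb cp cP cQ cE.
have c4 : computable (fun q : nat * qy => ev q.1 q.2.1.1 q.2.1.2.1 q.2.1.2.2 q.2.2).
  apply: (comp_ext (f := fun q : nat * qy => treerec (ev_sub q.1) ev_comb (enc q.2.1.1) q.2)).
    by move=> [b0 [[p0 [P0 Q0]] E0]]; apply: ev_treerec.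
  apply: (@comp_treerec _ _ _ _ _ _ (fun q => ev_sub q.1) (fun _ => ev_comb)
    (fun q : nat * qy => enc q.2.1.1) (fun q => q.2)).
  - by rewrite /ev_sub /sub0 /expand; comp_tac.
  - by rewrite /ev_comb; comp_tac.
  - by comp_tac.
  - by comp_tac.
apply: (comp_app c4 (g := fun g => (b g, (p g, (P g, Q g), E g)))); comp_tac.
Qed.

Section CompTemplates.
Context {G : Type} {EG : Enc G}.

Lemma comp_autF (init : G -> seq nat) trans acc vs r : computable init -> computable trans -> computable acc ->
  computable vs -> computable r -> computable (fun g => autF (init g) (trans g) (acc g) (vs g) (r g)).
Proof.
move=> c1 c2 c3 c4 c5; rewrite /autF.
have c : computable (fun q : seq nat * seq (seq nat) * seq nat * seq nat * nat =>
   autF q.1.1.1.1 q.1.1.1.2 q.1.1.2 q.1.2 q.2) by rewrite /autF; comp_tac.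
apply: (comp_app c (g := fun g => (init g, trans g, acc g, vs g, r g))); comp_tac.
Qed.

Lemma comp_exs (vs : G -> seq nat) p : computable vs -> computable p -> computable (fun g => exs (vs g) (p g)).
Proof.
move=> c1 c2; apply: (@comp_foldr _ _ _ _ _ _ vs p (fun _ => IEx)) => //.
by apply: comp_IEx; comp_tac.
Qed.

Lemma comp_tailF (b nu y : G -> nat) js : computable b -> computable nu -> computable y -> computable js ->
  computable (fun g => tailF (b g) (nu g) (y g) (js g)).
Proof.
apply: (comp_app4 (F := tailF)); rewrite /tailF.
apply: (@comp_foldr _ _ _ _ _ _ (fun q : nat * nat * nat * seq nat => q.2) (fun _ => IFalse)
  (fun q j p => IOr (agreeF q.1.1.1 q.1.1.2 q.1.2 j) p)); rewrite /IOr /agreeF; comp_tac.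
rewrite (_ : (fun p => _) = (fun p : nat * nat * nat * seq nat * (nat * iform) * seq nat => ~~ (nth 0 p.2 0 == 0) || (nth 0 p.2 1 == nth 0 p.2 2))).
  by comp_tac.
by apply/funext => q; rewrite implybE.
Qed.

End CompTemplates.

Ltac comp_user4 h := lazymatch h with
  | @autF => apply: comp_autF
  | @exs => apply: comp_exs
  | @tailF => apply: comp_tailF
  | _ => comp_user3 h
  end.
Ltac comp_user h ::= comp_user4 h.

Section CompTemplates2.
Context {G : Type} {EG : Enc G}.

Lemma comp_centers (b n : G -> nat) p e : computable b -> computable n -> computable p -> computable e ->
  computable (fun g => centers (b g) (n g) (p g) (e g)).
Proof. by apply: (comp_app4 (F := centers)); rewrite /centers /nclasses; comp_tac. Qed.

Lemma comp_autC one (c : G -> nat) vs r : computable c -> computable vs -> computable r ->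
  computable (fun g => autC one (c g) (vs g) (r g)).
Proof.
apply: (comp_app3 (F := autC one)); rewrite /autC /letter_code; case: one; comp_tac.
Qed.

End CompTemplates2.

Ltac comp_user5 h := lazymatch h with
  | @centers => apply: comp_centers
  | @autC => apply: comp_autC
  | _ => comp_user4 h
  end.
Ltac comp_user h ::= comp_user5 h.

Section CompTemplates3.
Context {G : Type} {EG : Enc G}.

Lemma comp_countableF (b n : G -> nat) p e : computable b -> computable n -> computable p -> computable e ->
  computable (fun g => countableF (b g) (n g) (p g) (e g)).
Proof.
by apply: (comp_app4 (F := countableF)); rewrite /countableF /IAll /IImp /finF /someF; comp_tac.
Qed.

Lemma comp_coverF (b n : G -> nat) p e : computable b -> computable n -> computable p -> computable e ->
  computable (fun g => coverF (b g) (n g) (p g) (e g)).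
Proof.
by apply: (comp_app4 (F := coverF)); rewrite /coverF /IAll /IImp /finF /someF; comp_tac.
Qed.

Lemma comp_finiteF (b n : G -> nat) p e : computable b -> computable n -> computable p -> computable e ->
  computable (fun g => finiteF (b g) (n g) (p g) (e g)).
Proof.
by apply: (comp_app4 (F := finiteF)); rewrite /finiteF /coverF /IAll /IImp /finF /someF; comp_tac.
Qed.

Lemma comp_repsF (b n : G -> nat) p e : computable b -> computable n -> computable p -> computable e ->
  computable (fun g => repsF (b g) (n g) (p g) (e g)).
Proof.
by apply: (comp_app4 (F := repsF)); rewrite /repsF /lexF /lexTab /finF; comp_tac.
Qed.

End CompTemplates3.

Ltac comp_user6 h := lazymatch h with
  | @countableF => apply: comp_countableF
  | @coverF => apply: comp_coverF
  | @finiteF => apply: comp_finiteF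
  | @repsF => apply: comp_repsF
  | @ev => apply: comp_ev
  | _ => comp_user5 h
  end.
Ltac comp_user h ::= comp_user6 h.

(** * Translation of formulas at the level of codes *)

Definition tr_sub (q : nat * nat) : seq (nat * nat) :=
  let l := CodeSeq.decode q.2 in let tag := nth 0 l 0 in
  if tag <= 1 then [::] else
  if tag == 2 then [:: (q.1, nth 0 l 1)] else
  if tag == 3 then [:: (q.1, nth 0 l 1); (q.1, nth 0 l 2)] else
  if tag == 5 then [:: (q.1.+1, nth 0 l 3)] else [:: (q.1.+1, nth 0 l 1)].

Definition tr_comb cd b (q : nat * nat) (rs : seq iform) : iform :=
  let n := q.1 in let l := CodeSeq.decode q.2 in let tag := nth 0 l 0 in
  let p := nth IFalse rs 0 in let dp := IAnd (domC cd n n.+1) p in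
  let e := eqC cd n n.+1 n.+2 in
  if tag == 0 then eqC cd (n - (nth 0 l 1).+1) (n - (nth 0 l 2).+1) n else
  if tag == 1 then relC cd (nth 0 l 1) [seq n - x.+1 | x <- CodeSeq.decode (nth 0 l 2)] n else
  if tag == 2 then INot p else
  if tag == 3 then IAnd p (nth IFalse rs 1) else
  if tag == 4 then IEx n dp else
  if tag == 5 then exs (centers b n dp e) (IEx n.+2 (IAnd (coverF b n dp e)
     (IMod n (nth 0 l 1) (nth 0 l 2) (repsF b n dp e)))) else
  if tag == 6 then INot (finiteF b n dp e) else
  if tag == 7 then countableF b n dp e else INot (countableF b n dp e).

(** The counterpart of [trf] on codes. Formulas form a family indexed by the signature and the
    number of variables, so the program carries [n] along with the bare code. *)
Definition trp cd b n c : iform := treerec tr_sub (tr_comb cd b) c (n, c).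

Lemma comp_trp G {EG : Enc G} (cd b n c : G -> nat) : computable cd -> computable b -> computable n -> computable c ->
  computable (fun g => trp (cd g) (b g) (n g) (c g)).
Proof.
apply: (comp_app4 (F := trp)); rewrite /trp.
apply: (@comp_treerec _ _ _ _ _ _ (fun _ => tr_sub) (fun q => tr_comb q.1.1.1 q.1.1.2)
   (fun q : nat * nat * nat * nat => q.2) (fun q => (q.1.2, q.2))).
- by rewrite /tr_sub; comp_tac.
- by rewrite /tr_comb /eqC /relC /domC; comp_tac.
- by comp_tac.
- by comp_tac.
Qed.

Lemma decode_formula sg n (phi : formula sg n) : CodeSeq.decode (code_formula phi) =
  match phi with
  | FEq _ x y => [:: 0; val x; val y]
  | FRel _ i xs => [:: 1; val i; code_ords xs]
  | FNot _ phi => [:: 2; code_formula phi]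
  | FAnd _ phi psi => [:: 3; code_formula phi; code_formula psi]
  | FEx _ phi => [:: 4; code_formula phi]
  | FMod _ r m _ phi => [:: 5; r; m; code_formula phi]
  | FInf _ phi => [:: 6; code_formula phi]
  | FCountable _ phi => [:: 7; code_formula phi]
  | FUncountable _ phi => [:: 8; code_formula phi]
  end.
Proof. by case: phi => *; apply: CodeSeq.codeK. Qed.

Lemma trpE cd b sg n (phi : formula sg n) : trp cd b n (code_formula phi) = trf cd b phi.
Proof.
rewrite /trp; have : code_formula phi <= code_formula phi by [].
move: {2 3}(code_formula phi) => m.
elim: phi m => {n} [n x y|n i xs|n phi IH|n phi IHp psi IHq|n phi IH|n r m m0 phi IH|n phi IH|n phi IH|n phi IH] k lk.
all: have k0 : 0 < k by apply: leq_trans lk; apply: leq_ltn_trans (leq0n _) (lt_code (mem_head _ _)).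
all: case: k lk k0 => // k lk _.
all: rewrite treerecS /tr_comb /tr_sub /snd /fst decode_formula.
- by [].
- rewrite [nth 0 _ 1]/= [nth 0 _ 2]/= CodeSeq.codeK -map_comp; by [].
all: rewrite [nth 0 _ 0]/=.
- rewrite [LHS]/= IH // -ltnS; apply: leq_trans lk.
  by apply: lt_code; rewrite !inE eqxx ?orbT.
- by rewrite [LHS]/= IHp ?IHq // -ltnS; apply: leq_trans lk; apply: lt_code; rewrite !inE eqxx ?orbT.
- rewrite [LHS]/= IH // -ltnS; apply: leq_trans lk.
  by apply: lt_code; rewrite !inE eqxx ?orbT.
all: have lp : code_formula phi <= k by
  rewrite -ltnS; apply: leq_trans lk; apply: lt_code; rewrite !inE eqxx ?orbT.
all: by have E := IH k lp; cbn [trf]; rewrite -E.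
Qed.

Definition ITrue := INot IFalse.
Definition conjF (ps : seq iform) := foldr IAnd ITrue ps.

Lemma isat_conj b (T : eqType) (F : T -> iform) s w :
  isat b (conjF [seq F j | j <- s]) w <-> forall j, j \in s -> isat b (F j) w.
Proof.
elim: s => [|j s IH]; first by split=> // _; apply: isat_false.
rewrite [conjF _]/= isat_and IH; split=> [[H1 H2] i|H].
  by rewrite inE => /predU1P[->|/H2].
by split=> [|i si]; apply: H; rewrite inE ?eqxx ?si ?orbT.
Qed.

Lemma good_conj b (T : eqType) (F : T -> iform) s : (forall j, good b (F j)) ->
  good b (conjF [seq F j | j <- s]).
Proof. by move=> gF; elim: s => //= j s IH; split. Qed.

(** * Ultimately periodic parameters *)

(** A deterministic automaton accepting a single word: one state per position of [pre ++ per], all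
    accepting, with a jump from the last one to the start of the period. *)
Definition up_aut (pre per : seq nat) v r :=
  let l := pre ++ per in
  autF [:: 0] [seq [:: i; nth 0 l i; if i.+1 == size l then size pre else i.+1]
              | i <- iota 0 (size l)] (iota 0 (size l)) [:: v] r.

Lemma modnS_eq k q : 0 < q -> k.+1 %% q = if (k %% q).+1 == q then 0 else (k %% q).+1.
Proof.
move=> q0; rewrite -addn1 -modnDml addn1; have := ltn_pmod k q0.
by case: eqP => [->|ne] l; [rewrite modnn | rewrite modn_small //; lia].
Qed.

Lemma isat_up b pre per v r w : v < r -> 0 < size per -> size (pre ++ per) <= b ->
  isat b (up_aut pre per v r) w <->
  forall t, w t v = upw (size pre) (size per) (pre ++ per) t.
Proof.
move=> lv Q0 lb; rewrite isat_aut; last by move=> v'; rewrite inE => /eqP ->.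
set l := pre ++ per; set P := size pre; set Q := size per.
have sl : size l = P + Q by rewrite size_cat.
pose idx t := if t < P then t else P + (t - P) %% Q.
have idx_lt t : idx t < P + Q.
  by rewrite /idx; case: (ltnP t P) => lt; [lia | rewrite ltn_add2l ltn_pmod].
have idxS t : idx t.+1 = if (idx t).+1 == size l then P else (idx t).+1.
  rewrite sl /idx; case: (ltnP t P) => lt.
    have -> : (t.+1 == P + Q) = false by rewrite /Q; lia.
    case: ltnP => // lt'; have -> : t.+1 = P by lia.
    by rewrite subnn mod0n addn0.
  rewrite ltnNge (leq_trans lt (leqnSn _)) /= subSn // modnS_eq // -addnS eqn_add2l.
  by case: ifP => _; rewrite ?addn0.
split=> [[rho [brho r0 rS _]] t|H].
  have row s : exists2 i, i < size l & [/\ rho s = i, w s v = nth 0 l i &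
      rho s.+1 = if i.+1 == size l then P else i.+1].
    by have /mapP [i] := rS s; rewrite mem_iota => li [-> -> ->]; exists i.
  have rE s : rho s = idx s.
    elim: s => [|s IH]; last by have [i _ [Ei _ ->]] := row s; rewrite -Ei IH idxS.
    move: r0; rewrite inE => /eqP ->; rewrite /idx; case: ltnP => // P0.
    by rewrite sub0n mod0n addn0; lia.
  by have [i _ [Ei -> _]] := row t; rewrite /upw -/P -/Q -Ei rE.
exists idx; split=> [t||t|N].
- by apply: leq_trans (idx_lt t) _; rewrite -sl.
- rewrite inE /idx; case: ltnP => // P0.
  by rewrite sub0n mod0n addn0; move: P0; rewrite leqn0.
- rewrite /= H idxS; apply/mapP; exists (idx t); first by rewrite mem_iota sl idx_lt.
  by [].
- by exists N => //; rewrite mem_iota sl idx_lt.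
Qed.

Lemma up_word_upw s (q : upname s) t :
  val (up_word q t) = upw (size [seq val x | x <- up_pre q])
    (size [seq val x | x <- up_head q :: up_tail q])
    ([seq val x | x <- up_pre q] ++ [seq val x | x <- up_head q :: up_tail q]) t.
Proof.
rewrite /up_word /upw !size_map nth_cat size_map [size (_ :: _)]/=.
case: (ltnP t (size (up_pre q))) => lt; first by rewrite lt (nth_map (up_head q)).
rewrite ltnNge leq_addr /= addKn -/(map val (up_head q :: up_tail q)).
by rewrite (nth_map (up_head q)) //= ltn_mod.
Qed.

(** * Searching for an automaton *)

(** Parameters come first among the free variables, hence occupy the tracks from [k] on; the [k]
    arguments of the relation occupy the tracks below [k], in reversed order. *)
Definition outs k : seq nat := [seq k - i.+1 | i <- iota 0 k].
Definition domsF cd k r := conjF [seq domC cd v r | v <- outs k].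
Definition paramF cps n0 j :=
  let u := CodeSeq.decode (nth 0 (CodeSeq.decode cps) j) in
  up_aut (CodeSeq.decode (nth 0 u 0)) (CodeSeq.decode (nth 0 u 1)) (n0 - j.+1) n0.
Lemma good_param b cps n0 j : good b (paramF cps n0 j).
Proof. by []. Qed.
Definition paramsF cps n0 := conjF [seq paramF cps n0 j | j <- iota 0 (size (CodeSeq.decode cps))].
Definition bodyF cd b cphi k n0 := IAnd (domsF cd k n0) (trp cd b n0 cphi).
Definition iffF p q := IAnd (IImp p q) (IImp q p).
(** All tracks in use are quantified, so this is a sentence: whenever the parameter tracks carry the
    parameters, the candidate [N] agrees with the formula. *)
Definition chkF cd b cphi cps k N :=
  let n0 := size (CodeSeq.decode cps) + k in
  INot (exs (iota 0 n0) (IAnd (paramsF cps n0)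
    (INot (iffF (autC false N (outs k) n0) (bodyF cd b cphi k n0))))).

Definition is_nba_code s k N : bool :=
  let l := CodeSeq.decode N in
  let sz := nth 0 l 0 in
  [&& size l == 4, all (fun q => q < sz) (CodeSeq.decode (nth 0 l 1)),
      all (fun t => let u := CodeSeq.decode t in
        [&& size u == 3, nth 0 u 0 < sz, nth 0 u 2 < sz,
            size (CodeSeq.decode (nth 0 u 1)) == k &
            all (fun a => a < s) (CodeSeq.decode (nth 0 u 1))]) (CodeSeq.decode (nth 0 l 2)) &
      all (fun q => q < sz) (CodeSeq.decode (nth 0 l 3))].

(** The bound grows with the candidate, whose states must be letters. The formula is therefore
    translated anew for each candidate, which is sound because the translation is correct for every
    large enough [b]. *)
Definition search_pred (g : nat * nat * nat * nat) N : bool :=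
  let b := g.1.1.1 + g.1.2 + N + 2 in
  is_nba_code (nth 0 (CodeSeq.decode g.1.1.1) 1) g.2 N &&
  ev b (chkF g.1.1.1 b g.1.1.2 g.1.2 g.2 N) 0 1 [::].

Lemma comp_conjF G {EG : Enc G} ps : computable ps -> computable (fun g : G => conjF (ps g)).
Proof.
move=> cp; apply: (@comp_foldr _ _ _ _ _ _ ps (fun _ => ITrue) (fun _ => IAnd)) => //.
  by apply: comp_IAnd; comp_tac.
exact: comp_const.
Qed.

Ltac comp_user8 h := lazymatch h with
  | @conjF => apply: comp_conjF | @trp => apply: comp_trp | @ev => apply: comp_ev
  | @exs => apply: comp_exs | @autC => apply: comp_autC | @autF => apply: comp_autF
  | @INot => apply: comp_INot | @IAnd => apply: comp_IAnd end.
Ltac comp_user h ::= comp_user8 h.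

Lemma comp_search_pred : computable (fun p : (nat * nat * nat * nat) * nat => search_pred p.1 p.2).
Proof.
rewrite /search_pred /is_nba_code /chkF /paramsF /paramF /bodyF /domsF /domC /up_aut /iffF /IImp /outs.
by comp_tac.
Qed.

Lemma map_surj A B (g : A -> B) (P : B -> Prop) l : (forall x, P x -> exists y, g y = x) ->
  (forall i, i < size l -> forall d, P (nth d l i)) -> exists l', map g l' = l.
Proof.
move=> H; elim: l => [|x l IH] Hl; first by exists [::].
have [y Hy] := H x (Hl 0 isT x); have [|l' Hl'] := IH; last by exists (y :: l'); rewrite /= Hy Hl'.
by move=> i li d; apply: (Hl i.+1).
Qed.

Lemma map_surj_all A (B : eqType) (g : A -> B) (P : pred B) l : (forall x, P x -> exists y, g y = x) ->
  all P l -> exists l', map g l' = l.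
Proof.
move=> H al; apply: (@map_surj _ _ g P) => // i li d.
by move/(all_nthP d): al; apply.
Qed.

Lemma is_nba_codeP s k N : is_nba_code s k N ->
  exists B : nba (k.-tuple 'I_s), code_nba (@code_letter s k) B = N.
Proof.
rewrite /is_nba_code; case E: (CodeSeq.decode N) => [|sz [|ci [|ct [|ca [|? ?]]]]] //=.
case/and3P => Hi Ht Ha.
have [li Eli] : exists l : seq 'I_sz, map val l = CodeSeq.decode ci.
  by apply: (map_surj_all _ Hi) => x lx; exists (Ordinal lx).
have [la Ela] : exists l : seq 'I_sz, map val l = CodeSeq.decode ca.
  by apply: (map_surj_all _ Ha) => x lx; exists (Ordinal lx).
have [lt Elt] : exists l : seq ('I_sz * k.-tuple 'I_s * 'I_sz),
    [seq CodeSeq.code [:: val t.1.1; code_letter t.1.2; val t.2] | t <- l] = CodeSeq.decode ct.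
  apply: (map_surj_all _ Ht) => x /=.
  case Ex: (CodeSeq.decode x) => [|q [|c [|q' [|? ?]]]] //= /and4P [lq lq' sk ak].
  have [lc Elc] : exists l : seq 'I_s, map val l = CodeSeq.decode c.
    by apply: (map_surj_all _ ak) => y ly; exists (Ordinal ly).
  have sc : size lc == k by rewrite -(size_map val) Elc.
  exists (Ordinal lq, Tuple sc, Ordinal lq'); rewrite -[RHS]CodeSeq.decodeK Ex.
  by rewrite /code_letter /code_ords [tval _]/= Elc CodeSeq.decodeK.
exists (Nba li lt la); rewrite /code_nba /code_ords [nba_init _]/= [nba_trans _]/= [nba_acc _]/=.
by rewrite Eli Ela Elt !CodeSeq.decodeK -[RHS]CodeSeq.decodeK E.
Qed.

Lemma is_nba_code_nba s k (B : nba (k.-tuple 'I_s)) :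
  is_nba_code s k (code_nba (@code_letter s k) B).
Proof.
rewrite /is_nba_code /code_nba CodeSeq.codeK; apply/and4P; split=> //.
- rewrite -[nth 0 _ 1]/(CodeSeq.code _) CodeSeq.codeK all_map; apply/allP => q _; exact: ltn_ord.
- rewrite -[nth 0 _ 2]/(CodeSeq.code _) CodeSeq.codeK; apply/allP => x /mapP [t _ ->].
  cbv zeta; rewrite CodeSeq.codeK -[nth 0 _ 1]/(CodeSeq.code _) CodeSeq.codeK.
  apply/and5P; split=> //; try exact: ltn_ord; first by rewrite size_map size_tuple.
  by rewrite all_map; apply/allP => a _; apply: ltn_ord.
- rewrite -[nth 0 _ 3]/(CodeSeq.code _) CodeSeq.codeK all_map; apply/allP => q _; exact: ltn_ord.
Qed.

Lemma nba_size_lt (L : Type) (cl : L -> nat) (B : nba L) : nba_size B < code_nba cl B.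
Proof. exact/lt_code/mem_head. Qed.

Lemma presentation_bounds sg (d : presentation sg) b : code_presentation d <= b ->
  [/\ alph d <= b, nba_size (dom_aut d) <= b, nba_size (eq_aut d) <= b &
      forall i, nba_size (rel_aut d i) <= b].
Proof.
move=> lb; set l := [:: CodeSeq.code sg; alph d; code_nba val (dom_aut d);
  code_nba (@code_letter _ _) (eq_aut d);
  CodeSeq.code [seq code_nba (@code_letter _ _) (rel_aut d i) | i <- enum 'I_(size sg)]].
have H c : c \in l -> c <= b by move=> /lt_code lc; apply: ltnW; apply: leq_trans lc lb.
split.
- by apply: H; rewrite !inE eqxx orbT.
- by apply: leq_trans (ltnW (nba_size_lt val _)) _; apply: H; rewrite !inE eqxx !orbT.
- by apply: leq_trans (ltnW (nba_size_lt (@code_letter _ _) _)) _; apply: H; rewrite !inE eqxx !orbT.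
- move=> i; apply: leq_trans (ltnW (nba_size_lt (@code_letter _ _) _)) _.
  apply: leq_trans (H _ (_ : CodeSeq.code [seq code_nba (@code_letter _ _) (rel_aut d i) | i <- enum 'I_(size sg)] \in l)).
    by apply/ltnW/lt_code; apply/mapP; exists i; rewrite ?mem_enum.
  by rewrite !inE eqxx !orbT.
Qed.

Lemma mem_outs k v : (v \in outs k) = (v < k).
Proof.
apply/mapP/idP => [[i]|lv]; first by rewrite mem_iota => li ->; lia.
by exists (k - v.+1); rewrite ?mem_iota; lia.
Qed.

Lemma size_outs k : size (outs k) = k.
Proof. by rewrite size_map size_iota. Qed.

Lemma nth_outs k i : i < k -> nth 0 (outs k) i = k - i.+1.
Proof. by move=> li; rewrite (nth_map 0) ?size_iota // nth_iota. Qed.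

Section PartOne.
Variables (sg : signature) (A : structure sg) (d : presentation sg) (f : lang (dom_aut d) -> A).
Hypothesis Hf : is_presentation f.
Let cd := code_presentation d.

Lemma preimage_nm k (R : ('I_k -> A) -> Prop) (ws : 'I_k -> word 'I_(alph d)) :
  preimage_rel f R ws <->
  exists2 a : 'I_k -> A, forall i, nm f (fun t => val (ws i t)) (a i) & R a.
Proof.
split=> [[us [Hus Ra]]|[a Ha Ra]].
  by exists (fun i => f (us i)) => // i; exists (us i); split=> // t; rewrite Hus.
have [us Hus] := choice Ha; exists us; split=> [i|].
  by apply/funext => t; apply/val_inj; case: (Hus i) => /(_ t) ->.
by congr R: Ra; apply/funext => i; have [_ <-] := Hus i.
Qed.

Lemma isat_doms b k r w : cd <= b -> 1 < b -> k <= r ->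
  isat b (domsF cd k r) w <->
  exists a : 'I_k -> A, forall i : 'I_k, nm f (fun t => w t (k - i.+1)) (a i).
Proof.
move=> lb b1 lk; have [al db _ _] := presentation_bounds lb; rewrite isat_conj; split.
  move=> H; have ex (i : 'I_k) : exists a, nm f (fun t => w t (k - i.+1)) a.
    have li : k - i.+1 < k by have := ltn_ord i; lia.
    by apply/(domC_P _ db _ (leq_trans li lk)); apply: H; rewrite mem_outs.
  by have [a Ha] := choice ex; exists a.
move=> [a Ha] v; rewrite mem_outs => lv; apply/(domC_P f db _ (leq_trans lv lk)).
have lo : k - v.+1 < k by lia.
by exists (a (Ordinal lo)); have := Ha (Ordinal lo); rewrite /= subnSK // subKn // ltnW.
Qed.

Lemma isat_doms_trf b k (phi : formula sg k) w : cd <= b -> 1 < b -> bnd b w ->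
  isat b (IAnd (domsF cd k k) (trf cd b phi)) w <->
  exists2 a : 'I_k -> A, forall i : 'I_k, nm f (fun t => w t (k - i.+1)) (a i) & sat phi a.
Proof.
move=> lb b1 bdw; have [al db eb rb] := presentation_bounds lb; rewrite isat_and isat_doms //.
split=> [[[a Ha] Ht]|[a Ha Hs]].
  by exists a => //; apply: (trf_correct Hf b1 al db eb rb phi bdw Ha).1 Ht.
by split; [exists a | apply: (trf_correct Hf b1 al db eb rb phi bdw Ha).2].
Qed.

Variables (p k : nat) (phi : formula sg (p + k)) (qs : 'I_p -> upname (alph d))
  (us : 'I_p -> lang (dom_aut d)).
Hypothesis Hus : forall j, sval (us j) = up_word (qs j).
Let cps := code_params qs.
Let cphi := code_formula phi.
Let R (a : 'I_k -> A) := sat phi (env_cat (fun j => f (us j)) a).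

Lemma size_params : size (CodeSeq.decode cps) = p.
Proof. by rewrite /cps /code_params CodeSeq.codeK size_map size_enum_ord. Qed.

Lemma isat_param b w (j : 'I_p) : cps <= b -> isat b (paramF cps (p + k) j) w <->
  forall t, w t (p + k - j.+1) = val (up_word (qs j) t).
Proof.
move=> lb; rewrite /paramF.
have Eq : nth 0 (CodeSeq.decode cps) j = code_upname (qs j).
  by rewrite /cps /code_params CodeSeq.codeK (nth_map j) ?size_enum_ord // nth_ord_enum.
have lq : code_upname (qs j) < cps by apply/lt_code/mapP; exists j; rewrite ?mem_enum.
rewrite Eq /code_upname CodeSeq.codeK.
rewrite -[nth 0 _ 0]/(CodeSeq.code _) -[nth 0 _ 1]/(CodeSeq.code _) !CodeSeq.codeK isat_up.
- by split=> H t; rewrite H up_word_upw.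
- by have := ltn_ord j; lia.
- by rewrite size_map.
- rewrite size_cat.
  have sz (l : seq nat) : size l <= CodeSeq.code l by rewrite -enc_code; apply: size_enc.
  have h2 x y : x + y <= CodeSeq.code [:: x; y].
    rewrite -[CodeSeq.code _]/(consn x (consn y 0)).
    have := consn_ltl y 0; move: (consn y 0) => c; rewrite /consn.
    by have := ltn_expl x (ltnSn 1); move: (2 ^ x) => e; nia.
  apply: leq_trans (leq_add (sz _) (sz _)) _; apply: leq_trans (h2 _ _) _.
  by apply: leq_trans (ltnW lq) lb.
Qed.

Lemma isat_body b w : cd + cps + 2 <= b -> bnd b w ->
  (forall j : 'I_p, forall t, w t (p + k - j.+1) = val (up_word (qs j) t)) ->
  isat b (bodyF cd b cphi k (p + k)) w <->
  exists2 a : 'I_k -> A, forall i : 'I_k, nm f (fun t => w t (k - i.+1)) (a i) & R a.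
Proof.
move=> lb bdw Hw; have lb' : cd <= b by lia.
have b1 : 1 < b by lia.
have [al db eb rb] := presentation_bounds lb'.
rewrite /bodyF /cphi trpE isat_and isat_doms //; last exact: leq_addl.
have rep (a : 'I_k -> A) : (forall i : 'I_k, nm f (fun t => w t (k - i.+1)) (a i)) ->
    forall i : 'I_(p + k), nm f (fun t => w t (p + k - i.+1)) (env_cat (fun j => f (us j)) a i).
  move=> Ha i; rewrite /env_cat; case: fintype.splitP => j Ej; rewrite Ej.
    by exists (us j); split=> // t; rewrite Hw Hus.
  by rewrite -addnS subnDl; apply: Ha.
split=> [[[a Ha] Ht]|[a Ha Hs]].
  by exists a => //; apply: (trf_correct Hf b1 al db eb rb phi bdw (rep _ Ha)).1 Ht.
split; first by exists a.
exact: (trf_correct Hf b1 al db eb rb phi bdw (rep _ Ha)).2 Hs.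
Qed.

Lemma isat_params b w : cps <= b -> isat b (paramsF cps (p + k)) w <->
  forall j : 'I_p, forall t, w t (p + k - j.+1) = val (up_word (qs j) t).
Proof.
move=> lb; rewrite isat_conj size_params; split=> [H j|H j].
  by apply: ((@isat_param b w j) lb).1; apply: H; rewrite mem_iota ltn_ord.
by rewrite mem_iota => lj; exact: ((@isat_param b w (Ordinal lj)) lb).2 (H (Ordinal lj)).
Qed.

Lemma isat_chk b w (B : nba (k.-tuple 'I_(alph d))) :
  cd + cps + code_nba (@code_letter _ _) B + 2 <= b -> bnd b w ->
  isat b (chkF cd b cphi cps k (code_nba (@code_letter _ _) B)) w <->
  recognises B (preimage_rel f R).
Proof.
move=> lb bdw; set N := code_nba _ B in lb *; have lN : nba_size B <= b.
  by have := nba_size_lt (@code_letter _ _) B; rewrite -/N; lia.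
have b0 : 0 < b by lia.
have lb1 : cd + cps + 2 <= b by lia.
have lcp : cps <= b by lia.
have [al db eb rb] : [/\ alph d <= b, nba_size (dom_aut d) <= b, nba_size (eq_aut d) <= b &
      forall i, nba_size (rel_aut d i) <= b] by apply: presentation_bounds; rewrite -/cd; lia.
rewrite /chkF size_params.
have iffP_ b' q q' w' : isat b' (iffF q q') w' <-> (isat b' q w' <-> isat b' q' w').
  by rewrite /iffF isat_and !isat_imp; split=> -[].
have outs_lt v : v \in outs k -> v < p + k by rewrite mem_outs => lv; apply: ltn_addl.
split=> [H ws|HB].
  (* The sentence is instantiated with the given words on the argument tracks and the parameters
     above them. *)
  pose F v t : nat := if v < k then nth 0 [seq val (ws i t) | i <- enum 'I_k] (k - v.+1)
    else nth 0 [seq val (up_word (qs j) t) | j <- enum 'I_p] (p + k - v.+1).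
  have bF v : bw b (F v).
    move=> t; rewrite /F; case: (ltnP v k) => _.
      case: (ltnP (k - v.+1) k) => l; last by rewrite nth_default // size_map size_enum_ord.
      by rewrite (nth_map (Ordinal l)) ?size_enum_ord //; apply: leq_trans (ltn_ord _) al.
    case: (ltnP (p + k - v.+1) p) => l; last by rewrite nth_default // size_map size_enum_ord.
    by rewrite (nth_map (Ordinal l)) ?size_enum_ord //; apply: leq_trans (ltn_ord _) al.
  set w1 := updall w (iota 0 (p + k)) F.
  have bw1 : bnd b w1 by apply: bnd_updall.
  have w1p (j : 'I_p) t : w1 t (p + k - j.+1) = val (up_word (qs j) t).
    have lj := ltn_ord j; rewrite /w1 /updall mem_iota ifT; last by lia.
    rewrite /F ifN; last by lia.
    have -> : p + k - (p + k - j.+1).+1 = j by lia.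
    by rewrite (nth_map j) ?size_enum_ord // nth_ord_enum.
  have w1o (i : 'I_k) t : w1 t (k - i.+1) = val (ws i t).
    have li := ltn_ord i; rewrite /w1 /updall mem_iota ifT; last by lia.
    rewrite /F ifT; last by lia.
    have -> : k - (k - i.+1).+1 = i by lia.
    by rewrite (nth_map i) ?size_enum_ord // nth_ord_enum.
  have {}H : isat b (iffF (autC false N (outs k) (p + k)) (bodyF cd b cphi k (p + k))) w1.
    apply: contrapT => N1; apply: H; apply/isat_exs => //; exists F => //; split=> //.
    by apply/isat_params.
  move/iffP_: H; rewrite isat_body // /N autC_nba isat_nba // => H.
  rewrite preimage_nm.
  have -> : accepts B (convolution ws) <-> exists u : word (k.-tuple 'I_(alph d)),
      (forall t, letter_code false (code_letter (u t)) = [seq w1 t v | v <- outs k]) /\ accepts B u.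
    have E u t : letter_code false (code_letter (u t)) = [seq w1 t v | v <- outs k] <->
        u t = convolution ws t.
      rewrite /letter_code /code_letter /code_ords CodeSeq.codeK.
      have -> : [seq w1 t v | v <- outs k] = [seq val x | x <- convolution ws t].
        apply: (@eq_from_nth _ 0); rewrite !size_map ?size_iota -?enumT ?size_enum_ord // => i li.
        rewrite (nth_map 0) ?size_outs // nth_outs //.
        have -> : i = Ordinal li by [].
        rewrite w1o -map_comp (nth_map (Ordinal li)) -?enumT ?size_enum_ord //.
        by rewrite nth_ord_enum.
      by split=> [/(inj_map val_inj) /val_inj|->].
    split=> [aB|[u [Hu aB]]]; first by exists (convolution ws); split=> // t; apply/E.
    by have -> : convolution ws = u by apply/funext => t; apply/esym/E.
  rewrite H; split=> -[a Ha Ra]; exists a => // i; have := Ha i; congr (nm f _ _); apply/funext => t.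
    by rewrite w1o.
  by rewrite w1o.
move/isat_exs => /(_ bdw) [F bF [/(isat_params _ lcp) Hp NE]].
have bw1 : bnd b (updall w (iota 0 (p + k)) F) by apply: bnd_updall.
suff : isat b (iffF (autC false N (outs k) (p + k)) (bodyF cd b cphi k (p + k)))
  (updall w (iota 0 (p + k)) F) by apply: NE.
apply/iffP_; rewrite isat_body // (isat_rel _ HB) ?size_outs //.
split=> -[a Ha Ra]; exists a => // i; have := Ha i; by rewrite nth_outs.
Qed.

(** Quantifying the parameter tracks existentially leaves a recognisable relation of the argument
    tracks alone. This existence makes the search halt. *)
Lemma nba_exists : exists B : nba (k.-tuple 'I_(alph d)), recognises B (preimage_rel f R).
Proof.
pose b := cd + cps + 2; have lcp : cps <= b by rewrite /b; lia.
have b0 : 0 < b by rewrite /b; lia.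
have [al db eb rb] : [/\ alph d <= b, nba_size (dom_aut d) <= b, nba_size (eq_aut d) <= b &
      forall i, nba_size (rel_aut d i) <= b] by apply: presentation_bounds; rewrite -/cd /b; lia.
pose psi := exs (iota k p) (IAnd (paramsF cps (p + k)) (bodyF cd b cphi k (p + k))).
have gpsi : good b psi.
  apply/good_exs; apply: good_and; first by apply: good_conj => j; apply: good_param.
  by apply: good_and; [apply: good_conj => v; apply: good_domC | rewrite /cphi trpE; apply: good_trf].
pose col (a : k.-tuple 'I_(alph d)) v := nth 0 [seq val x | x <- a] (k - v.+1).
have bcol a v : col a v < b.
  rewrite /col; case: (ltnP (k - v.+1) k) => l; last by rewrite nth_default // size_map size_tuple.
  have a0 : 'I_(alph d) by case: k a l => [|k'] a // _; exact: (thead a).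
  by rewrite (nth_map a0) ?size_tuple //; apply: leq_trans (ltn_ord _) al.
have [B HB] := recog_nba (recog_isat gpsi) bcol; exists B => ws.
rewrite HB isat_exs; last by move=> t v; apply: bcol.
rewrite preimage_nm.
have w1o F (i : 'I_k) t :
    updall (fun t => col (convolution ws t)) (iota k p) F t (k - i.+1) = val (ws i t).
  have li := ltn_ord i; rewrite /updall mem_iota ifN; last by lia.
  rewrite /col; have -> : k - (k - i.+1).+1 = i by lia.
  rewrite (nth_map (ws i t)) ?size_tuple //.
  by have := tnth_mktuple (fun j => ws j t) i; rewrite (tnth_nth (ws i t)) => ->.
split=> [[F bF [/(isat_params _ lcp) Hp /isat_body [|||a Ha Ra]]]|[a Ha Ra]] //.
- by apply: bnd_updall => // t v; apply: bcol.
- by exists a => // i; have := Ha i; congr (nm f _ _); apply/funext => t; rewrite w1o.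
pose F v t : nat := nth 0 [seq val (up_word (qs j) t) | j <- enum 'I_p] (p + k - v.+1).
have bF v : bw b (F v).
  move=> t; rewrite /F.
  case: (ltnP (p + k - v.+1) p) => l; last by rewrite nth_default // size_map size_enum_ord.
  by rewrite (nth_map (Ordinal l)) ?size_enum_ord //; apply: leq_trans (ltn_ord _) al.
have w1p (j : 'I_p) t :
    updall (fun t => col (convolution ws t)) (iota k p) F t (p + k - j.+1) = val (up_word (qs j) t).
  have lj := ltn_ord j; rewrite /updall mem_iota ifT; last by lia.
  rewrite /F; have -> : p + k - (p + k - j.+1).+1 = j by lia.
  by rewrite (nth_map j) ?size_enum_ord // nth_ord_enum.
exists F => //; split; first exact/isat_params.
apply/isat_body => //; first by apply: bnd_updall => // t v; apply: bcol.
by exists a => // i; have := Ha i; congr (nm f _ _); apply/funext => t; rewrite w1o.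
Qed.

End PartOne.

Lemma presentation_program : exists prog : recfun,
  forall (sg : signature) (A : structure sg) (d : presentation sg) (f : lang (dom_aut d) -> A),
  is_presentation f ->
  forall (p k : nat) (phi : formula sg (p + k))
    (qs : 'I_p -> upname (alph d)) (us : 'I_p -> lang (dom_aut d)),
  (forall j, sval (us j) = up_word (qs j)) ->
  exists B : nba (k.-tuple 'I_(alph d)),
    computes prog [:: code_presentation d; code_formula phi; code_params qs; k]
      (code_nba (@code_letter (alph d) k) B) /\
    recognises B (preimage_rel f (fun b : 'I_k -> A => sat phi (env_cat (fun j => f (us j)) b))).
Proof.
have [q Hq] := comp_search comp_search_pred.
(* The four inputs are packed into the code of the tuple on which the search runs. *)
have [pc Hpc] : vcomp 4 (fun v => consn (consn (consn (nth 0 v 0) (nth 0 v 1)) (nth 0 v 2)) (nth 0 v 3)).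
  apply: (vcomp_c2 vcomp_consn); last exact: vcomp_nth.
  apply: (vcomp_c2 vcomp_consn); last exact: vcomp_nth.
  by apply: (vcomp_c2 vcomp_consn); exact: vcomp_nth.
exists (RComp q [:: pc]) => sg A d f Hf p k phi qs us Hus.
pose g := (code_presentation d, code_formula phi, code_params qs, k).
have sE (B : nba (k.-tuple 'I_(alph d))) : search_pred g (code_nba (@code_letter _ _) B) <->
    recognises B (preimage_rel f (fun b : 'I_k -> A => sat phi (env_cat (fun j => f (us j)) b))).
  rewrite /search_pred [nth 0 _ 1](_ : _ = alph d); last first.
    by rewrite /g /= CodeSeq.codeK.
  rewrite [g.2]/= is_nba_code_nba andTb; set b := _ + _ + _ + 2.
  have b0 : 0 < b by rewrite /b addn2.
  have bE : bl b [::] by move=> v; rewrite nth_nil.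
  have gc : good b (chkF g.1.1.1 b g.1.1.2 g.1.2 k (code_nba (@code_letter _ _) B)).
    apply/good_exs; split; first by apply: good_conj => j; apply: good_param.
    have gb : good b (bodyF g.1.1.1 b g.1.1.2 k (size (CodeSeq.decode g.1.2) + k)).
      apply: good_and; first by apply: good_conj => v; apply: good_domC.
      by rewrite [g.1.2]/= size_params [g.1.1.2]/= trpE; apply: good_trf.
    by split; split=> //; apply: good_autC.
  have r := @evP b _ 0 1 [::] gc b0 isT bE.
  have ic := isat_chk Hf phi Hus (leqnn _) (bnd_envl 0 1 b0 bE) (B := B).
  by split=> [/r|H]; [apply: ic.1 | apply/r; apply: ic.2].
have [B0 /sE HB0] := nba_exists Hf phi Hus.
have ex : exists N, search_pred g N by exists (code_nba (@code_letter _ _) B0).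
case: (ex_minnP ex) => N HN Nmin.
have [B EB] : exists B : nba (k.-tuple 'I_(alph d)), code_nba (@code_letter _ _) B = N.
  apply: is_nba_codeP; move: HN; rewrite /search_pred => /andP[+ _].
  by rewrite /g /= CodeSeq.codeK.
exists B; split; last by apply/sE; rewrite EB.
rewrite EB; apply: ev_comp (Hq g N HN _); last first.
  by move=> m lm; apply/negP => /Nmin; lia.
by apply: evs_cons (evs_nil _); apply: (Hpc [:: _; _; _; _]).
Qed.

Lemma theory_decidable (sg : signature) (A : structure sg) :
  omega_automatic A -> FOC_theory_decidable A.
Proof.
move=> [d [f Hf]]; pose cd := code_presentation d; pose b := cd + 2.
(* The presentation is fixed, so its code and the bound are constants of the program; a sentence is
   evaluated in the empty environment with preperiod 0 and period 1. *)
have [q Hq] : computable (fun c : nat => ev b (trp cd b 0 c) 0 1 [::]) by comp_tac.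
have lb : cd <= b by rewrite /b leq_addr.
have b1 : 1 < b by rewrite /b; lia.
have [al db eb rb] := presentation_bounds lb.
exists q => phi; have := Hq (code_formula phi); rewrite trpE.
have b0 : 0 < b by lia.
have bE : bl b [::] by move=> v; rewrite nth_nil.
have r := @evP b _ 0 1 [::] (good_trf cd b phi) b0 isT bE.
have e0 : forall i : 'I_0, nm f (fun t => envl 0 1 [::] t (0 - i.+1)) (@env0 A i) by case.
have tc := trf_correct Hf b1 al db eb rb phi (bnd_envl 0 1 b0 bE) e0.
have eE : reflect (sat phi (@env0 A)) (ev b (trf cd b phi) 0 1 [::]).
  by apply: (iffP r); apply tc.
by case: eE => H; split.
Qed.

(** * Interpretations *)

(** Variables are substituted semantically, by renaming tracks inside the congruence; this lets one
    domain formula be applied to every block of an argument tuple. *)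
Lemma recog_rename b K R (rho : nat -> nat) : recog b K R ->
  recog b K (fun w => R (fun t v => w t (rho v))).
Proof.
move=> [T [h [cT ch sh]]].
pose ren (c : nat -> nat) v := c (rho v).
exists T, (fun u => h (map ren u)); split=> //.
  by move=> u u' v v' e e'; rewrite !map_cat; apply: ch.
move=> w w' c c' bw bw' Hc Hc' e; apply: (sh _ _ c c') => // i.
by have := e i; rewrite /fac -!map_comp.
Qed.

Lemma recog_all b n (R : 'I_n -> (nat -> nat -> nat) -> Prop) :
  (forall j, exists K, recog b K (R j)) -> exists K, recog b K (fun w => forall j, R j w).
Proof.
elim: n R => [|n IH] R HR.
  exists 1, unit, (fun=> tt); split=> //; first by rewrite card_unit.
  by move=> w w' c c' _ _ _ _ _ _ [].
have [K HK] := IH (fun j => R (lift ord0 j)) (fun j => HR _); have [K0 HK0] := HR ord0.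
exists (K0 * K); apply: recog_iff (recog_and HK0 HK) => w _; split=> [[H0 H] j|H].
  by case: (unliftP ord0 j) => [i ->|->].
by split.
Qed.

Section Interpretation.
Variables (sg : signature) (A : structure sg) (d : presentation sg) (f : lang (dom_aut d) -> A).
Hypothesis Hf : is_presentation f.
Variables (D : nat) (dom : formula sg D).

Let cd := code_presentation d.
Let b := cd + 2.
Let b1 : 1 < b. Proof. by rewrite /b; lia. Qed.
Let lb : cd <= b. Proof. by rewrite /b; lia. Qed.

(* Tuples of words are named by words over the alphabet of tuples of letters. *)
Definition talph := #|{: D.-tuple 'I_(alph d)}|.

Definition row (a : 'I_talph) : seq nat := [seq val y | y <- enum_val a].
Definition track (x : word 'I_talph) (i : nat) t : nat := nth 0 (row (x t)) i.
Definition tnm (x : word 'I_talph) (xs : 'I_D -> A) : Prop := forall i : 'I_D, nm f (track x i) (xs i).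

Lemma row_bnd a i : nth 0 (row a) i < b.
Proof.
case: (ltnP i (size (row a))) => l; last by rewrite nth_default // ltnW.
have [al _ _ _] := presentation_bounds lb.
have /mapP [y _ ->] := mem_nth 0 l; exact: leq_trans (ltn_ord _) al.
Qed.

Lemma tnm_fun x xs xs' : tnm x xs -> tnm x xs' -> xs = xs'.
Proof. by move=> H H'; apply/funext => i; apply: nm_fun (H i) (H' i). Qed.

Lemma tnm_surj xs : exists x, tnm x xs.
Proof.
case: Hf => surj _ _; have [u Hu] := choice (fun i => surj (xs i)).
exists (fun t => enum_rank [tuple sval (u i) t | i < D]) => i; exists (u i); split=> // t.
rewrite /track /row enum_rankK (nth_map (sval (u i) t)) ?size_tuple //.
by have := tnth_mktuple (fun j => sval (u j) t) i; rewrite (tnth_nth (sval (u i) t)) => ->.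
Qed.

Definition inDom (x : word 'I_talph) : Prop := exists2 xs, tnm x xs & sat dom xs.

Let domI := IAnd (domsF cd D D) (trf cd b dom).

Let good_domI : good b domI.
Proof. by apply: good_and; [apply: good_conj => v; apply: good_domC | apply: good_trf]. Qed.

Let subK_ n i : i < n -> n - (n - i.+1).+1 = i. Proof. lia. Qed.

Lemma isat_domI w (x : word 'I_talph) : bnd b w ->
  (forall (i : 'I_D) t, w t (D - i.+1) = track x i t) -> isat b domI w <-> inDom x.
Proof.
move=> bdw Hw; rewrite (isat_doms_trf Hf dom lb b1 bdw).
split=> -[xs Hx Hs]; exists xs => // i; have := Hx i; congr (nm f _ _); apply/funext => t.
  exact: Hw.
by rewrite Hw.
Qed.

Lemma dom_nba : exists B : nba 'I_talph, forall x, accepts B x <-> inDom x.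
Proof.
have [B HB] := recog_nba (col := fun a v => nth 0 (row a) (D - v.+1)) (recog_isat good_domI)
  (fun a v => row_bnd a _).
exists B => x; rewrite HB; apply: isat_domI => [t v|i t]; first exact: row_bnd.
by rewrite subK_.
Qed.

(** The equation [HM] lets the same construction serve the relations and the equality formula, whose
    number of variables is written as a sum. *)
Lemma interp_nba k M (HM : M = k * D) (psi : formula sg M) :
  exists B : nba (k.-tuple 'I_talph), forall ws : 'I_k -> word 'I_talph,
    accepts B (convolution ws) <-> exists xs : 'I_k -> 'I_D -> A,
      [/\ forall j, tnm (ws j) (xs j), forall j, sat dom (xs j) &
          sat psi (fun i => env_flatten xs (cast_ord HM i))].
Proof.
subst M; have [al db eb rb] := presentation_bounds lb.
pose col (a : k.-tuple 'I_talph) v :=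
  nth 0 (nth [::] [seq row x | x <- a] ((k * D - v.+1) %/ D)) ((k * D - v.+1) %% D).
have bcol a v : col a v < b.
  rewrite /col; set j := _ %/ D; case: (ltnP j (size a)) => l; last first.
    by rewrite [nth [::] _ _]nth_default ?size_map // nth_nil ltnW.
  have a0 : 'I_talph by case: (tval a) l => // x.
  by rewrite (nth_map a0) //; apply: row_bnd.
(* The domain formula reads coordinate [i] on track [D - i.+1]; in the [j]-th block this coordinate
   has index j * D + i among the k * D variables. *)
pose rho (j : 'I_k) v := k * D - (j * D + (D - v.+1)).+1.
pose RR w := (forall j, isat b domI (fun t v => w t (rho j v))) /\ isat b (trf cd b psi) w.
have [K HK] : exists K, recog b K RR.
  have ex j : exists K, recog b K (fun w => isat b domI (fun t v => w t (rho j v))).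
    by exists (Kb b domI); apply: recog_rename; apply: recog_isat.
  have [K1 HK1] := recog_all ex.
  by eexists; apply: recog_and HK1 (recog_isat (good_trf _ _ _)).
have [B HB] := recog_nba HK bcol; exists B => ws; rewrite HB.
set w := fun t => col (convolution ws t).
have bdw : bnd b w by move=> t v; apply: bcol.
have wE (j : 'I_k) (o : 'I_D) t : w t (k * D - (j * D + o).+1) = track (ws j) o t.
  have lj := ltn_ord j; have lo := ltn_ord o.
  have ljo : j * D + o < k * D by have : j.+1 * D <= k * D by [rewrite leq_mul2r lj orbT]; rewrite mulSn; lia.
  have D0 : 0 < D by lia.
  rewrite /w /col subK_ // divnMDl // divn_small // addn0 modnMDl modn_small //.
  rewrite (nth_map (ws j t)) ?size_tuple //.
  by have := tnth_mktuple (fun i => ws i t) j; rewrite (tnth_nth (ws j t)) => ->.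
have dE j : isat b domI (fun t v => w t (rho j v)) <-> inDom (ws j).
  apply: isat_domI => [t v|i t]; first exact: bdw.
  by rewrite /rho subK_ // wE.
have pE (xs : 'I_k -> 'I_D -> A) : (forall j, tnm (ws j) (xs j)) ->
    isat b (trf cd b psi) w <-> sat psi (fun i => env_flatten xs (cast_ord erefl i)).
  move=> Hx; apply: (trf_correct Hf) => // i; rewrite cast_ord_id /env_flatten.
  have := Hx (Ordinal (block_subproof i)) (Ordinal (offset_subproof i)).
  congr (nm f _ _); apply/funext => t; rewrite -wE /=.
  by rewrite -divn_eq.
rewrite /RR; split=> [[H1 H2]|[xs [Hx Hd Hs]]].
  have ex j : exists xs, tnm (ws j) xs /\ sat dom xs by have /dE [xs] := H1 j; exists xs.
  have [xs Hxs] := choice ex; exists xs; split=> [j|j|]; try by case: (Hxs j).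
  by apply/(pE xs) => // j; case: (Hxs j).
by split=> [j|]; [apply/dE; exists (xs j) | apply/(pE xs)].
Qed.

End Interpretation.

(** An element of [B] is named by every word that names some tuple sent to it by [h]. The equality
    formula, not a choice of tuples, identifies these names, so non-injective presentations are the
    natural setting. *)
Lemma interpretation_closed (sg tau : signature) (I : FOC_interpretation sg tau)
    (A : structure sg) (B : structure tau) :
  omega_automatic A -> interprets I A B -> omega_automatic B.
Proof.
move=> [d [f Hf]] [h [hsurj heq hrel]].
set D := int_dim I in h hsurj heq hrel; pose dom := int_dom I.
have [Bd HBd] := dom_nba Hf dom.
have HM : D + D = 2 * D by rewrite mul2n addnn.
have [Be HBe] := interp_nba Hf dom HM (int_eq I).
have Hr (i : 'I_(size tau)) := interp_nba Hf dom (erefl (arity tau i * D)) (int_rel I i).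
pose d' := @Presentation tau (talph d D) Bd Be (fun i => projT1 (cid (Hr i))).
have Hu (u : lang (dom_aut d')) : exists x : {x : 'I_D -> A | sat dom x}, tnm f (sval u) (sval x).
  by have /HBd [xs Hx Hs] := proj2_sig u; exists (exist _ xs Hs).
have [g Hg] := choice Hu.
have sig_eq (x y : {x : 'I_D -> A | sat dom x}) : sval x = sval y -> x = y.
  by case: x y => [x px] [y py] /= e; apply: eq_exist.
pose f' u := h (g u).
exists d', f'.
have pre k (R : ('I_k -> B) -> Prop) (ws : 'I_k -> word 'I_(talph d D)) :
    preimage_rel f' R ws <-> exists2 xs : 'I_k -> {x : 'I_D -> A | sat dom x},
      forall j, tnm f (ws j) (sval (xs j)) & R (fun j => h (xs j)).
  split=> [[us [Hus Ru]]|[xs Hx Rx]].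
    by exists (fun j => g (us j)) => // j; rewrite -Hus.
  have ac j : accepts Bd (ws j) by apply/HBd; exists (sval (xs j)); [apply: Hx | apply: proj2_sig].
  exists (fun j => exist _ (ws j) (ac j)); split=> //.
  congr R: Rx; apply/funext => j; rewrite /f'; congr h; apply: sig_eq.
  exact: tnm_fun (Hx j) (Hg (exist _ (ws j) (ac j))).
have xsE k (xs : 'I_k -> 'I_D -> A) : (forall j, sat dom (xs j)) ->
    exists ys : 'I_k -> {x : 'I_D -> A | sat dom x}, xs = (fun j => sval (ys j)).
  by move=> Hd; exists (fun j => exist _ (xs j) (Hd j)).
split.
- move=> y; have [x Hx] := hsurj y; have [u Hux] := tnm_surj Hf (sval x).
  have ac : accepts Bd u by apply/HBd; exists (sval x) => //; apply: proj2_sig.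
  exists (exist _ u ac); rewrite /f' -Hx; congr h; apply: sig_eq.
  exact: tnm_fun (Hg (exist _ u ac)) Hux.
- move=> ws; rewrite HBe pre.
  have catE (xs : 'I_2 -> 'I_D -> A) :
      (fun i => env_flatten xs (cast_ord HM i)) = env_cat (xs ord0) (xs ord_max).
    apply/funext => i; rewrite /env_cat /env_flatten; case: fintype.splitP => j Ej.
      congr (xs _ _); apply: val_inj; rewrite /= Ej; have lj := ltn_ord j.
        by rewrite divn_small.
      by rewrite modn_small.
    have lj := ltn_ord j; congr (xs _ _); apply: val_inj; rewrite /= Ej.
      by rewrite -{1}(mul1n D) divnMDl ?divn_small //; lia.
    by rewrite -{1}(mul1n D) modnMDl modn_small.
  split=> [[xs [Hx Hd]]|[ys Hy E]].
    have [ys Ey] := xsE _ _ Hd; rewrite Ey catE => Hs; exists ys; last exact/heq.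
    by move=> j; have := Hx j; rewrite Ey.
  exists (fun j => sval (ys j)); split=> // [j|]; first exact: proj2_sig.
  by rewrite catE; apply/heq.
- move=> i ws; rewrite (projT2 (cid (Hr i))) pre.
  have fE (xs : 'I_(arity tau i) -> 'I_D -> A) :
      (fun i0 => env_flatten xs (cast_ord erefl i0)) = env_flatten xs.
    by apply/funext => j; rewrite cast_ord_id.
  split=> [[xs [Hx Hd]]|[ys Hy E]].
    have [ys Ey] := xsE _ _ Hd; rewrite Ey fE => Hs; exists ys; last exact/hrel.
    by move=> j; have := Hx j; rewrite Ey.
  exists (fun j => sval (ys j)); split=> // [j|]; first exact: proj2_sig.
  by rewrite fE; apply/hrel.
Qed.

(** Parameters enter through ultimately periodic names, since an input of the program must be a
    finite object. *)
Theorem theorem2p4 :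
  (exists prog : recfun,
     forall (sg : signature) (A : structure sg) (d : presentation sg)
       (f : lang (dom_aut d) -> A),
     is_presentation f ->
     forall (p k : nat) (phi : formula sg (p + k))
       (qs : 'I_p -> upname (alph d)) (us : 'I_p -> lang (dom_aut d)),
     (forall j, sval (us j) = up_word (qs j)) ->
     exists B : nba (k.-tuple 'I_(alph d)),
       computes prog
         [:: code_presentation d; code_formula phi; code_params qs; k]
         (code_nba (@code_letter (alph d) k) B) /\
       recognises B
         (preimage_rel f
            (fun b : 'I_k -> A => sat phi (env_cat (fun j => f (us j)) b))))
  /\
  (forall (sg : signature) (A : structure sg),
     omega_automatic A -> FOC_theory_decidable A)
  /\
  (forall (sg tau : signature) (I : FOC_interpretation sg tau)
     (A : structure sg) (B : structure tau),
     omega_automatic A -> interprets I A B -> omega_automatic B).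
Proof.
split; first exact: presentation_program.
by split; [exact: theory_decidable | exact: interpretation_closed].
Qed.
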